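(* Let $\Omega\subset\mathbb{R}^d$ be a bounded domain centered at the origin and let $\omega=\mathbb{R}^d\setminus\overline{\Omega}$. Assume the Hamiltonian flow is non-zero on the interval $[0,T_D]$. Then for all $T\in(0,T_D)$ with $T<\infty$ there exists a nonzero constant $C_T$, depending on $\Omega$, the $L^\infty([0,T])$ norm of $\kappa_2$ and the $C^1([0,T])$ norm of $\kappa_1$, such that the solution $u$ of $$\partial_tu+i\left(-\kappa_1(t)\Delta+\kappa_2(t)|x|^2\right)u=0,\quad 0<t\le T,\ x\in\mathbb{R}^d,\qquad u(0,x)=u_0(x),$$ with initial data $u_0\in\mathcal{A}$ (with associated $N,\eta,\tilde a_n,\tilde c_n$) satisfies $$\|u_0\|_{L^2(\mathbb{R}^d)}-\eta\le C_T\left(\|u\|_{L^2((0,T)\times\omega)}+T\eta\right)$$ provided that, with $|\alpha_N|=\max_{|m|,|n|\le N}|\tilde a_n-\tilde a_m|$ and $D_0(t)=\frac{y_2(t)^2}{1+16y_3(t)^2}$, for all $t\in[0,T]$ $$\max_n|\tilde a_n|>\sqrt{\frac{|\alpha_N|^2+2-2\log\sqrt{D_0(t)}}{4D_0(t)}}+\frac{|\alpha_N|}{y_2(t)}+\frac{\mathrm{diam}(\Omega)}{2}.$$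
   Context: Standing assumptions: $\kappa_1\in C^1$ is bounded below by a positive constant, $\kappa_2$ is continuous and $\kappa_2\ge0$. The Hamiltonian trajectory is the solution of $x_i'=2\kappa_1(t)p_i$, $p_i'=-2\kappa_2(t)x_i$ ($i=1,\dots,d$), $x(0)=(1,\dots,1)$, $p(0)=0$; the Hamiltonian flow is non-zero on an interval if $x_i(t)\neq0$ for all $i$ and all $t$ in it and $a(t)=\exp\big(-\int_0^t\frac{p_i(s)\kappa_1(s)}{x_i(s)}ds\big)$ is bounded on it. The functions $y_1,y_2,y_3$ solve $y_1'=-4\kappa_1y_1^2-\kappa_2$, $y_1(0)=0$; $y_2'=-4\kappa_1y_1y_2$, $y_2(0)=1$; $y_3'=-\kappa_1y_2^2$, $y_3(0)=0$. A bounded domain is centered at the origin if the (enclosing) ball containing it has its center at the origin. Let $B=\{u\in L^2(\mathbb{R}^d):x^\alpha D_x^\beta u\in L^2,\ |\alpha+\beta|\le2\}$ with $\|u\|_B^2=\sum_{|\alpha+\beta|=2}\|x^\alpha D_x^\beta u\|_{L^2}^2$. A $B$-valued solution is $u\in C^0([0,T],B)\cap C^1([0,T],L^2(\mathbb{R}^d))$ satisfying the equation in $L^2$; for each $u_0\in B$ a unique $B$-valued solution exists and propagation is unitary on $L^2$. The class $\mathcal{A}$ consists of $f\in L^2(\mathbb{R}^d)$ with bounded $B$ norm for which there exist a natural number $N>2$, $\eta\in(0,1)$, $\tilde a_n\in\mathbb{R}^d$ and $\tilde c_n\in\mathbb{R}_+$, indexed by $n=(n_1,\dots,n_d)$ with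 $n_i\in\{0,\dots,N\}$, $|n|=n_1+\dots+n_d\le N$, such that $\big(\int_{\mathbb{R}^d}|f(x)-\sum_{|n|\le N}\tilde c_ne^{-|x+\tilde a_n|^2}|^2dx\big)^{1/2}\le\eta$. *)

(* Defs.v *)
From HB Require Import structures.
From mathcomp Require Import all_boot all_order all_algebra.
From mathcomp Require Import complex.
From mathcomp Require Import all_classical all_reals all_analysis.

Set Implicit Arguments.
Unset Strict Implicit.
Unset Printing Implicit Defensive.

Import Order.TTheory GRing.Theory Num.Theory.
Import numFieldTopology.Exports numFieldNormedType.Exports.

Local Open Scope classical_set_scope.
Local Open Scope ring_scope.

(* Row vectors carry the product sigma-algebra, exactly as n.-tuple T does in
   MathComp-Analysis; for T = R this is the Borel sigma-algebra of R^n. *)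
Definition rV_display : measure_display -> measure_display.
Proof. exact. Qed.

Section measurable_rV.
Context {disp : measure_display} {T : measurableType disp}.
Variable n : nat.

Let coord : 'I_n -> 'rV[T]_n -> T := fun i x => x ord0 i.

Let rV_set0 : g_sigma_preimage coord set0.
Proof. exact: sigma_algebra0. Qed.

Let rV_setC A : g_sigma_preimage coord A -> g_sigma_preimage coord (~` A).
Proof. exact: sigma_algebraC. Qed.

Let rV_bigcup (F : _^nat) : (forall i, g_sigma_preimage coord (F i)) ->
  g_sigma_preimage coord (\bigcup_i (F i)).
Proof. exact: sigma_algebra_bigcup. Qed.

HB.instance Definition _ := @isMeasurable.Build (rV_display disp)
  'rV[T]_n (g_sigma_preimage coord) rV_set0 rV_setC rV_bigcup.

Lemma measurable_coord (i : 'I_n) :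
  measurable_fun [set: 'rV[T]_n] (fun x : 'rV[T]_n => x ord0 i).
Proof.
move=> _ Y mY; rewrite setTI; apply: sub_sigma_algebra => /=.
rewrite -bigcup_seq/=; exists i => /=; first by rewrite mem_index_enum.
by exists Y => //; rewrite setTI.
Qed.

Lemma measurable_fun_coord d1 (T1 : measurableType d1) (f : T1 -> 'rV[T]_n) :
  (forall i, measurable_fun [set: T1] (fun x => f x ord0 i)) ->
  measurable_fun [set: T1] f.
Proof.
move=> mf _ A mA; rewrite setTI.
have : g_sigma_preimage (fun i x => f x ord0 i) `<=` @measurable _ T1.
  apply: smallest_sub; first exact: sigma_algebra_measurable.
  rewrite -bigcup_seq; apply: bigcup_sub => i _.
  by move=> B [C mC <-]; exact: mf.
apply.
have := g_sigma_preimage_comp coord f.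
by move=> /(congr1 (fun S => S (f @^-1` A))) ->; exists A => //; rewrite setTI.
Qed.

End measurable_rV.

Section lebesgue.
Context {R : realType}.

Definition rV_cons n (p : 'rV[R]_n * R) : 'rV[R]_n.+1 :=
  row_mx (p.2)%:M p.1.

Lemma measurable_rV_cons n : measurable_fun [set: 'rV[R]_n * R] (@rV_cons n).
Proof.
apply: measurable_fun_coord => i.
case: (@split_ordP 1 n i) => j ->.
- apply: (eq_measurable_fun (snd : 'rV[R]_n * R -> R)) => //.
  by move=> p _ /=; rewrite [RHS](@row_mxEl _ 1 1 n) (ord1 j) mxE mulr1n.
- apply: (eq_measurable_fun (fun p : 'rV[R]_n * R => p.1 ord0 j)).
    by move=> p _ /=; rewrite [RHS](@row_mxEr _ 1 1 n).
  apply: (measurableT_comp (measurable_coord j)); exact: measurable_fst.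
Qed.

Section step.
Variables (n : nat) (mu : {measure set 'rV[R]_n -> \bar R}).

Definition leb_step : set 'rV[R]_n.+1 -> \bar R :=
  pushforward (mu \x lebesgue_measure)%E (@rV_cons n).

Let mcons := @measurable_rV_cons n.

Let leb_step0 : leb_step set0 = 0%E.
Proof. by rewrite /leb_step /pushforward preimage_set0 measure0. Qed.

Let leb_step_ge0 A : (0 <= leb_step A)%E.
Proof. exact: measure_ge0. Qed.

Let leb_step_sigma_additive : semi_sigma_additive leb_step.
Proof.
move=> F mF tF mUF; rewrite /leb_step /pushforward preimage_bigcup.
apply: measure_semi_sigma_additive.
- by move=> k; rewrite -[X in measurable X]setTI; exact: mcons.
- apply/trivIsetP => /= i j _ _ ij; rewrite -preimage_setI.
  by move/trivIsetP : tF => /(_ _ _ _ _ ij) ->//; rewrite preimage_set0.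
- by rewrite -preimage_bigcup -[X in measurable X]setTI; exact: mcons.
Qed.

HB.instance Definition _ := isMeasure.Build _ _ _ leb_step
  leb_step0 leb_step_ge0 leb_step_sigma_additive.
End step.

(* Lebesgue measure of R^n on Borel sets, as an iterated product measure. *)
Fixpoint leb (n : nat) : {measure set 'rV[R]_n -> \bar R} :=
  if n is k.+1 then leb_step (leb k) else dirac (0 : 'rV[R]_0).

End lebesgue.

(* Multi-indices of length d with entries in {0, ..., N}. *)
Notation midx d N := {ffun 'I_d -> 'I_N.+1}.

Section euclidean.
Context {R : realType}.
Variable d : nat.
Implicit Types (x : 'rV[R]_d) (Om : set 'rV[R]_d).

(* The library norm of 'rV[R]_d is the maximum norm; it has the same topology
   and the same bounded sets. *)
Definition enorm x : R := Num.sqrt (\sum_(i < d) x ord0 i ^+ 2).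

Definition ediam Om : R :=
  sup [set r | exists x y, [/\ Om x, Om y & r = enorm (x - y)]].

Definition bounded_domain Om : Prop :=
  [/\ Om !=set0, open Om, connected Om & bounded_set Om].

(* The smallest ball enclosing Om has its center at the origin. *)
Definition centered_at_origin Om : Prop :=
  forall (c : 'rV[R]_d) (r : R),
    Om `<=` [set x | enorm (x - c) <= r] -> Om `<=` [set x | enorm x <= r].

Definition mdeg N (n : midx d N) : nat := \sum_(i < d) n i.

Definition monomial N (n : midx d N) x : R := \prod_(i < d) x ord0 i ^+ n i.

End euclidean.

Section time_derivative.
Context {R : realType}.
Implicit Types (I : set R) (f : R -> R) (t : R).

(* Derivative relative to I: one-sided at the endpoints of an interval. *)
Definition is_deriv_in I f t (l : R) : Prop :=
  (f s - f t) / (s - t) @[s --> within I t^'] --> l.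

Definition deriv_in I f t : R :=
  lim ((f s - f t) / (s - t) @[s --> within I t^']).

Definition C1_on I f : Prop :=
  (forall t, I t -> is_deriv_in I f t (deriv_in I f t)) /\
  {within I, continuous (deriv_in I f)}.

Definition Linfty_norm (T : R) f : R :=
  fine ('N[@lebesgue_measure R]_+oo[EFin \o (f \_ `[0, T])]).

Definition C1_norm (T : R) f : R :=
  sup [set `|f t| | t in `[0, T]] +
  sup [set `|deriv_in `[0, T] f t| | t in `[0, T]].

(* [0, T] with T possibly +oo *)
Definition time_interval (T : \bar R) : set R :=
  [set t | 0 <= t /\ (t%:E <= T)%E].

Definition admissible_coefficients (k1 k2 : R -> R) : Prop :=
  [/\ C1_on `[0, +oo[ k1,
      exists2 m, 0 < m & forall t, 0 <= t -> m <= k1 t,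
      {within `[0, +oo[, continuous k2} &
      forall t, 0 <= t -> 0 <= k2 t].

Definition hamiltonian_trajectory d (I : set R) (k1 k2 : R -> R)
    (x p : R -> 'rV[R]_d) : Prop :=
  [/\ forall i t, I t ->
        is_deriv_in I (fun s => x s ord0 i) t (2 * k1 t * p t ord0 i),
      forall i t, I t ->
        is_deriv_in I (fun s => p s ord0 i) t (- (2 * k2 t * x t ord0 i)),
      forall i, x 0 ord0 i = 1 &
      forall i, p 0 ord0 i = 0].

Definition flow_amplitude d (k1 : R -> R) (x p : R -> 'rV[R]_d) i t : R :=
  expR (- \int[lebesgue_measure]_(s in `[0, t])
            (p s ord0 i * k1 s / x s ord0 i)).

Definition nonzero_flow (d : nat) (k1 k2 : R -> R) I : Prop :=
  exists x p : R -> 'rV[R]_d,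
    [/\ hamiltonian_trajectory I k1 k2 x p,
        forall i t, I t -> x t ord0 i != 0 &
        forall i, exists M, forall t, I t -> flow_amplitude k1 x p i t <= M].

Definition riccati_system (T : R) (k1 k2 y1 y2 y3 : R -> R) : Prop :=
  (forall t, 0 <= t <= T ->
     [/\ is_deriv_in `[0, T] y1 t (- 4 * k1 t * y1 t ^+ 2 - k2 t),
         is_deriv_in `[0, T] y2 t (- 4 * k1 t * y1 t * y2 t) &
         is_deriv_in `[0, T] y3 t (- k1 t * y2 t ^+ 2)]) /\
  [/\ y1 0 = 0, y2 0 = 1 & y3 0 = 0].

Definition D0 (y2 y3 : R -> R) t : R := y2 t ^+ 2 / (1 + 16 * y3 t ^+ 2).

End time_derivative.

Local Notation normc := (@ComplexField.Normc.normc _).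

Section function_spaces.
Context {R : realType}.
Variable d : nat.
Implicit Types (u v w g : 'rV[R]_d -> R[i]) (phi : 'rV[R]_d -> R).

Definition L2norm_on (om : set 'rV[R]_d) u : \bar R :=
  'N[leb d]_2[EFin \o ((normc \o u) \_ om)].

Definition L2norm u : \bar R := 'N[leb d]_2[EFin \o (normc \o u)].

Definition inL2 u : Prop :=
  [/\ measurable_fun setT (fun x => complex.Re (u x)),
      measurable_fun setT (fun x => complex.Im (u x)) &
      (L2norm u < +oo)%E].

Definition Cintegral u : R[i] :=
  Complex (\int[leb d]_x complex.Re (u x)) (\int[leb d]_x complex.Im (u x)).

Definition partial (i : 'I_d) phi : 'rV[R]_d -> R :=
  fun x => 'D_(delta_mx ord0 i) phi x.

Definition mpartial (b : midx d 2) phi : 'rV[R]_d -> R :=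
  foldr (fun i f => iter (b i) (partial i) f) phi (enum 'I_d).

(* C_c^oo: a function is smooth iff all its iterated partial derivatives are
   differentiable. *)
Definition test_function phi : Prop :=
  (forall (s : seq 'I_d) x, differentiable (foldr partial phi s) x) /\
  compact (closure [set x | phi x != 0]).

(* Weak derivatives are only ever needed as L^2 functions: among the conditions
   x^a D^b u \in L^2 defining B, the case a = 0 says D^b u \in L^2. *)
Definition is_weak_deriv (b : midx d 2) u g : Prop :=
  inL2 g /\
  forall phi, test_function phi ->
    Cintegral (fun x => u x * (mpartial b phi x)%:C%C) =
    (-1) ^+ mdeg b * Cintegral (fun x => g x * (phi x)%:C%C).

Definition weak_deriv (b : midx d 2) u : 'rV[R]_d -> R[i] :=
  xget (fun=> 0) [set g | is_weak_deriv b u g].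

Definition weighted_deriv (a b : midx d 2) u : 'rV[R]_d -> R[i] :=
  fun x => (monomial a x)%:C%C * weak_deriv b u x.

Definition inB u : Prop :=
  inL2 u /\
  forall a b : midx d 2, (mdeg a + mdeg b <= 2)%N ->
    is_weak_deriv b u (weak_deriv b u) /\ inL2 (weighted_deriv a b u).

(* The sum runs over |a + b| = 2 only, without lower-order terms. *)
Definition Bnorm u : \bar R :=
  sqrte (\sum_(ab : midx d 2 * midx d 2 | (mdeg ab.1 + mdeg ab.2)%N == 2%N)
           (L2norm (weighted_deriv ab.1 ab.2 u)) ^+ 2)%E.

Definition laplacian u : 'rV[R]_d -> R[i] :=
  fun x => \sum_(i < d)
    weak_deriv [ffun j => if j == i then ord_max else ord0] u x.

(* Elements of L^2 are represented by functions, equations between them being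
   understood almost everywhere. *)
Definition B_solution (T : R) (k1 k2 : R -> R) (u0 : 'rV[R]_d -> R[i])
    (u : R -> 'rV[R]_d -> R[i]) : Prop :=
  [/\ (forall t, 0 <= t <= T -> inB (u t)),
      (forall t, 0 <= t <= T ->
         Bnorm (fun x => u s x - u t x)
           @[s --> within `[0, T] (nbhs t)] --> 0%E),
      (exists u' : R -> 'rV[R]_d -> R[i],
        [/\ (forall t, 0 <= t <= T -> inL2 (u' t)),
            (forall t, 0 <= t <= T ->
               L2norm (fun x => ((s - t)^-1)%:C%C * (u s x - u t x) - u' t x)
                 @[s --> within `[0, T] t^'] --> 0%E),
            (forall t, 0 <= t <= T ->
               L2norm (fun x => u' s x - u' t x)
                 @[s --> within `[0, T] (nbhs t)] --> 0%E) &
            (forall t, 0 < t <= T -> {ae leb d, forall x,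
               u' t x + ('i * (- (k1 t)%:C * laplacian (u t) x
                               + (k2 t * enorm x ^+ 2)%:C * u t x))%C = 0})]) &
      {ae leb d, forall x, u 0 x = u0 x}].

(* The L^2((0,T) x om) norm is taken as that of L^2((0,T); L^2(om)): an iterated
   integral does not depend on how the representatives u t are chosen. *)
Definition L2norm_time_space (T : R) (om : set 'rV[R]_d)
    (u : R -> 'rV[R]_d -> R[i]) : \bar R :=
  sqrte (\int[lebesgue_measure]_(t in `]0%R, T[) (L2norm_on om (u t)) ^+ 2)%E.

Definition gaussian_sum N (a : midx d N -> 'rV[R]_d) (c : midx d N -> R) :
    'rV[R]_d -> R :=
  fun x => \sum_(n : midx d N | (mdeg n <= N)%N)
             c n * expR (- enorm (x + a n) ^+ 2).

Definition in_class_A (N : nat) (eta : R) (a : midx d N -> 'rV[R]_d)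
    (c : midx d N -> R) (f : 'rV[R]_d -> R[i]) : Prop :=
  [/\ inB f, (2 < N)%N, 0 < eta < 1,
      (forall n, (mdeg n <= N)%N -> 0 <= c n) &
      (L2norm (fun x => f x - (gaussian_sum a c x)%:C%C)%R <= eta%:E)%E].

Definition max_center N (a : midx d N -> 'rV[R]_d) : R :=
  \big[Num.max/0]_(n : midx d N | (mdeg n <= N)%N) enorm (a n).

Definition max_spread N (a : midx d N -> 'rV[R]_d) : R :=
  \big[Num.max/0]_(mn : midx d N * midx d N
                     | (mdeg mn.1 <= N)%N && (mdeg mn.2 <= N)%N)
    enorm (a mn.2 - a mn.1).

End function_spaces.

(* Main.v *)
(* Idea: u is tested against an explicit approximate solution living outside
   Omega. The datum u0 is within eta of a sum of Gaussians with nonnegative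
   coefficients. Replace each Gaussian by a smooth bump at the same center, or
   at a fixed far point if the center is close to Omega; this gives a compactly
   supported W. With y1, y2 the Riccati functions,
   w(t,x) = exp(i y1(t) |x|^2) W(y2(t) x) vanishes near Omega for t <= tau, tau
   small, and solves the equation up to an error that, like W, is dominated by
   S = sum c_n kap(. - z_n), where kap is a product of the profiles 1/(1+s^2).
   Differentiating (1 - t/tau) Re <u(t), w(t)> yields
   Re <u(0), W> <= C |S| |u|_{L^2((0,tau) x omega)}. As the coefficients are
   nonnegative, Young's inequality bounds |S|^2 by a multiple of
   <sum of Gaussians, W>, so |S| <= C' (|u|_{L^2((0,T) x omega)} + eta), while
   |u0| - eta is at most the norm of the sum of Gaussians, itself dominated by
   S. *)
From HB Require Import structures.
Require Import Defs.
From mathcomp Require Import all_boot all_order all_algebra.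
From mathcomp Require Import complex.
From mathcomp Require Import all_classical all_reals all_analysis.
From mathcomp Require Import measurable_realfun ess_sup_inf ring lra.
Import Order.TTheory GRing.Theory Num.Theory.
Import numFieldTopology.Exports numFieldNormedType.Exports.
Local Open Scope classical_set_scope.
Local Open Scope ring_scope.

(** * Lebesgue measure on row vectors *)

(** The constant must not see N, the centers or the coefficients. Hence every comparison is made for
    a single kernel, with the same weights on both sides, and then summed. Moving the center of a
    Gaussian by a bounded amount changes its values by an unbounded factor; the profile 1/(1+s^2)
    loses only a constant under bounded shifts, is integrable, and lies above Gaussians and bumps up
    to constants, which is why it serves as the majorant. In the equation for w the Riccati system
    cancels exactly the terms in |x|^2 W and x . grad W, which S could not bound uniformly in the
    centers; only W and its Laplacian remain. The time tau depends on T and on the coefficient norms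
    alone and keeps |y1| <= 1 and 1/2 <= y2 <= 3/2, so that the dilation by y2 costs only constants
    and enlarges the cube around Omega by at most 3/2. The factor 1 - t/tau removes the term at the
    final time. In place of Cauchy-Schwarz in time, a free parameter lam splits the integrand into a
    constant and the squared observation; it is set to the observation plus eta at the end. *)

Lemma measurable_fun_affine_rV (R : realType) (d : nat) (b : R) (v : 'rV[R]_d) :
  measurable_fun setT (fun x : 'rV[R]_d => b *: x + v).
Proof.
apply: measurable_fun_coord => i.
under eq_fun do rewrite !mxE.
apply: measurable_funD => //; apply: measurable_funM => //.
exact: measurable_coord.
Qed.

Lemma measurable_fun_subr_rV (R : realType) (d : nat) :
  measurable_fun setT (fun p : 'rV[R]_d * 'rV[R]_d => p.1 - p.2).
Proof.
apply: measurable_fun_coord => i.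
under eq_fun do rewrite !mxE.
apply: measurable_funB; apply: (measurableT_comp (measurable_coord i)).
  exact: measurable_fst.
exact: measurable_snd.
Qed.

(** The closed ball of the maximum norm, written by coordinates: its measurability comes from the
    coordinate maps, and its preimage under [rV_cons] is a product. *)
Definition cube {R : realType} {d : nat} (r : R) : set 'rV[R]_d :=
  [set x | forall i, `|x ord0 i| <= r].

Lemma measurable_cube (R : realType) d (r : R) : measurable (@cube R d r).
Proof.
have -> : @cube R d r = \bigcap_(i in [set: 'I_d])
    ((fun x : 'rV[R]_d => x ord0 i) @^-1` `[- r, r]).
  apply/seteqP; split => x /= h i; first by move=> _ /=; rewrite in_itv /= -ler_norml.
  by have := h i I; rewrite /= in_itv /= -ler_norml.
apply: fin_bigcap_measurable; first exact: finite_finset.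
move=> i _; rewrite -[X in measurable X]setTI.
exact: measurable_coord.
Qed.

Lemma rV_cons0 (R : realType) d (p : 'rV[R]_d * R) : rV_cons p ord0 ord0 = p.2.
Proof.
have -> : (ord0 : 'I_d.+1) = lshift d (ord0 : 'I_1) by apply/val_inj.
by rewrite /rV_cons [LHS](@row_mxEl _ 1 1 d) mxE mulr1n.
Qed.

Lemma rV_consS (R : realType) d (p : 'rV[R]_d * R) (i : 'I_d) :
  rV_cons p ord0 (lift ord0 i) = p.1 ord0 i.
Proof.
have -> : lift ord0 i = rshift 1 i by apply/val_inj.
by rewrite /rV_cons [LHS](@row_mxEr _ 1 1 d).
Qed.

Lemma rV_cons_preimage_cube (R : realType) d (r : R) :
  @rV_cons R d @^-1` cube r = cube r `*` `[- r, r].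
Proof.
apply/seteqP; split=> [[x s] /= h|[x s] /= [h1 h2] i].
  split; first by move=> i; have := h (lift ord0 i); rewrite rV_consS.
  by have := h ord0; rewrite rV_cons0 in_itv /= -ler_norml.
case: (unliftP ord0 i) => [j ->|->]; first by rewrite rV_consS; exact: h1.
by rewrite rV_cons0 /= ler_norml; move: h2; rewrite in_itv.
Qed.

Lemma leb_cube_lty (R : realType) d (r : R) : (leb d (@cube R d r) < +oo)%E.
Proof.
elim: d => [|d IH].
  rewrite /=.
  by rewrite /dirac /= indicE ltry.
rewrite /= /leb_step /pushforward rV_cons_preimage_cube product_measure1E//; last exact: measurable_cube.
rewrite lte_mul_pinfty//; first by rewrite ge0_fin_numE.
rewrite /= lebesgue_measure_itv/=; case: ifP => _; by rewrite ?ltry//.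
Qed.

Lemma leb_sigma_finite (R : realType) d : sigma_finite setT (@leb R d).
Proof.
exists (fun n => cube n%:R); last first.
  move=> n; split; [exact: measurable_cube|exact: leb_cube_lty].
apply/esym/seteqP; split => // x _.
exists (Num.bound (\sum_i `|x ord0 i|)) => // i /=.
apply/ltW; apply: le_lt_trans (archi_boundP _); last exact: sumr_ge0.
by rewrite (bigD1 i) //= lerDl; exact: sumr_ge0.
Qed.

(** [leb d] again, packed with its sigma-finiteness so that the Fubini-Tonelli theorems apply to
    it. *)
Definition lebs (R : realType) d : {sigma_finite_measure set 'rV[R]_d -> \bar R} :=
  let s := isSFinite.Build _ _ _ _ (sfinite_measure_sigma_finite (leb_sigma_finite R d)) in
  let m := @isSigmaFinite.Build _ _ _ (leb d) (leb_sigma_finite R d) in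
  HB.pack_for {sigma_finite_measure set 'rV[R]_d -> \bar R} (Measure.sort (leb d)) s m.

Lemma lebsE (R : realType) d : lebs R d = leb d :> {measure set _ -> \bar R}.
Proof. exact: eq_measure. Qed.

(** [leb d.+1] is an image of a product measure, so Tonelli peels off one coordinate. Inductions on
    the dimension rest on this formula. *)
Lemma ge0_integral_lebS (R : realType) d (f : 'rV[R]_d.+1 -> \bar R) :
  measurable_fun setT f -> (forall x, 0 <= f x)%E ->
  (\int[leb d.+1]_x f x =
   \int[leb d]_x \int[lebesgue_measure]_s f (rV_cons (x, s)))%E.
Proof.
move=> mf f0.
rewrite /= ge0_integral_pushforward//=; last exact: measurable_rV_cons.
rewrite preimage_setT.
rewrite -lebsE (@fubini_tonelli1 _ _ _ _ _ (lebs R d) lebesgue_measure (f \o @rV_cons _ d))//.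
by apply: measurableT_comp mf _; exact: measurable_rV_cons.
by move=> x; exact: f0.
Qed.

(** By uniqueness of Lebesgue measure: b times the image of the measure under s -> b s + v gives
    each interval ]p, q] its length. *)
Lemma ge0_integral_affine1 (R : realType) (b v : R) (f : R -> \bar R) : 0 < b ->
  measurable_fun setT f -> (forall x, 0 <= f x)%E ->
  (b%:E * \int[lebesgue_measure]_s f (b * s + v)%R = \int[lebesgue_measure]_s f s)%E.
Proof.
move=> b0 mf f0.
have mphi : measurable_fun setT (fun s : measurableTypeR R => b * s + v : measurableTypeR R).
  apply: measurable_funD => //; exact: measurable_funM.
pose m := mscale (NngNum (ltW b0)) (pushforward lebesgue_measure (fun s : measurableTypeR R => b * s + v : measurableTypeR R)).
rewrite [RHS](@eq_measure_integral _ _ _ _ (m mphi)); last first.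
  move=> A mA _; apply: (lebesgue_measure_unique (mu := m mphi)) => // X [[p q] _ <-].
  pose J := `](p - v) / b, (q - v) / b]%classic.
  transitivity (b%:E * lebesgue_measure J)%E.
    rewrite /J !lebesgue_measure_itv /= !lte_fin ltr_pM2r ?invr_gt0// ltrD2r.
    case: ifP => _; last by rewrite mule0.
    by rewrite -!EFinB -EFinM -mulrBl opprB addrA subrK mulrCA divff ?gt_eqF// mulr1.
  rewrite /m /mscale /= /pushforward; congr (_ * lebesgue_measure _)%E.
  apply/funext => s; apply/propext; rewrite /J /= !in_itv /=.
  by rewrite ltr_pdivrMr// ler_pdivlMr// ltrBlDr lerBrDr mulrC.
rewrite ge0_integral_mscale//=.
rewrite (ge0_integral_pushforward mphi) ?preimage_setT//.
Qed.

Lemma ge0_integral_affine (R : realType) d (b : R) (v : 'rV[R]_d) (f : 'rV[R]_d -> \bar R) : 0 < b ->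
  measurable_fun setT f -> (forall x, 0 <= f x)%E ->
  ((b ^+ d)%:E * \int[leb d]_x f (b *: x + v)%R = \int[leb d]_x f x)%E.
Proof.
move=> b0; elim: d v f => [|d IH] v f mf f0.
  rewrite expr0 mul1e; apply: eq_integral => x _; congr f.
  by apply/rowP => -[].
rewrite !ge0_integral_lebS//; last exact: measurableT_comp (measurable_fun_affine_rV _ _ _ _).
pose v' : 'rV[R]_d := \row_i v ord0 (lift ord0 i).
have E (x : 'rV[R]_d) (s : R) : b *: rV_cons (x, s) + v = rV_cons (b *: x + v', b * s + v ord0 ord0).
  apply/rowP => i; rewrite mxE [X in X + _]mxE; case: (unliftP ord0 i) => [j ->|->].
    by rewrite !rV_consS /= !mxE.
  by rewrite !rV_cons0.
have mF : measurable_fun setT (fun p : 'rV[R]_d * R => f (rV_cons p)).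
  by apply: measurableT_comp mf _; exact: measurable_rV_cons.
rewrite exprS EFinM muleAC -muleA.
pose v0 := v ord0 ord0.
pose g (x : 'rV[R]_d) (s : R) : \bar R := f (rV_cons (x, b * s + v0)).
have mg : measurable_fun setT (fun p : 'rV[R]_d * R => g p.1 p.2).
  apply: (measurableT_comp mF); apply: measurable_fun_pair => //.
  by apply: measurable_funD => //; apply: measurable_funM.
have mGg : measurable_fun setT (fun x => \int[lebesgue_measure]_s g x s)%E.
  apply: (@measurable_fun_fubini_tonelli_F _ _ _ _ _ lebesgue_measure
     (fun p : 'rV[R]_d * R => g p.1 p.2)) => // p; exact: f0.
transitivity (b%:E * \int[leb d]_x \int[lebesgue_measure]_s g x s)%E.
  congr (_ * _)%E; rewrite muleC.
  have g0 x : (0 <= \int[lebesgue_measure]_s g x s)%E by apply: integral_ge0 => s _; exact: f0.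
  rewrite -(IH v' _ mGg g0); congr (_ * _)%E; apply: eq_integral => x _.
  by apply: eq_integral => s _; rewrite E.
rewrite -ge0_integralZl//.
- apply: eq_integral => x _.
  rewrite (@ge0_integral_affine1 _ b _ (fun s => f (rV_cons (x, s))))//.
  exact: measurable_fun_pair2 mF.
- by move=> x _; apply: integral_ge0 => s _; exact: f0.
- by rewrite lee_fin ltW.
Qed.

Lemma leb_cube (R : realType) d (r : R) : 0 <= r ->
  leb d (@cube R d r) = ((2 * r) ^+ d)%:E.
Proof.
move=> r0; elim: d => [|d IH].
  rewrite /= /dirac /= indicE expr0 mem_set//; by case.
rewrite /= /leb_step /pushforward rV_cons_preimage_cube product_measure1E//; last exact: measurable_cube.
rewrite /= IH lebesgue_measure_itv/= lte_fin exprSr EFinM; congr (_ * _)%E.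
case: ltP => h; first by rewrite -EFinD opprK mulr_natl mulr2n.
have -> : r = 0 by lra.
by rewrite mulr0.
Qed.

(** The heavy-tailed majorant: a product of Cauchy profiles, equal to 1 at the origin. *)
Definition kap {R : realType} {d : nat} (x : 'rV[R]_d) : R := \prod_(i < d) (oneDsqr (x ord0 i))^-1.

Lemma kap_gt0 (R : realType) d (x : 'rV[R]_d) : 0 < kap x.
Proof. by apply: prodr_gt0 => i _; rewrite invr_gt0 /oneDsqr ltr_pwDl// sqr_ge0. Qed.

Lemma kap_ge0 (R : realType) d (x : 'rV[R]_d) : 0 <= kap x.
Proof. exact/ltW/kap_gt0. Qed.

(** In each coordinate, |a - b| <= r gives b^2 <= 2 a^2 + 2 r^2, hence 1 + b^2 <= 2 (1 + r^2) (1 +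
    a^2). This is the tolerance to bounded shifts that a Gaussian does not have. *)
Lemma kap_near (R : realType) d (r : R) (x y : 'rV[R]_d) :
  (forall i, `|x ord0 i - y ord0 i| <= r) -> kap x <= (2 * (1 + r ^+ 2)) ^+ d * kap y.
Proof.
move=> h.
have -> : (2 * (1 + r ^+ 2)) ^+ d = \prod_(i < d) (2 * (1 + r ^+ 2)).
  by rewrite prodr_const card_ord.
rewrite /kap -big_split /=; apply: ler_prod => i _.
rewrite invr_ge0 (le_trans _ (oneDsqr_ge1 _))//=.
rewrite ler_pdivlMr ?(lt_le_trans _ (oneDsqr_ge1 _))// mulrC ler_pdivrMr ?(lt_le_trans _ (oneDsqr_ge1 _))//.
move: (h i); rewrite /oneDsqr ler_norml; set a := x ord0 i; set b := y ord0 i => /andP[h1 h2].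
by have : (a - b) ^+ 2 <= r ^+ 2; nra.
Qed.

Lemma measurable_kap (R : realType) d : measurable_fun setT (@kap R d).
Proof.
apply: measurable_prod => i _.
apply: (measurableT_comp (f := fun s : R => (oneDsqr s)^-1)); last exact: measurable_coord.
by apply: continuous_measurable_fun; exact: continuous_oneDsqrV.
Qed.

Lemma integral_oneDsqrV_lty (R : realType) :
  (\int[@lebesgue_measure R]_s ((oneDsqr s)^-1)%:E < +oo)%E.
Proof.
rewrite (@ge0_symfun_integralT R (fun s => (oneDsqr s)^-1)).
- rewrite (_ : [set x | _] = `[0, +oo[%classic); last first.
    by apply/seteqP; split => x/=; rewrite in_itv/= andbT.
  by rewrite integral0y_oneDsqr -EFinM ltry.
- by move=> x; rewrite invr_ge0 (le_trans _ (oneDsqr_ge1 _)).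
- exact: continuous_oneDsqrV.
- by move=> x /=; rewrite /oneDsqr sqrrN.
Qed.

Lemma integral_kap_lty (R : realType) d : (\int[leb d]_x (@kap R d x)%:E < +oo)%E.
Proof.
elim: d => [|d IH].
  rewrite integral_dirac//; last by apply/measurable_EFinP; exact: (@measurable_kap R 0).
  by rewrite diracT mul1e ltry.
rewrite ge0_integral_lebS; [|apply/measurable_EFinP; exact: measurable_kap|by move=> x; rewrite lee_fin kap_ge0].
set I := (\int[@lebesgue_measure R]_s ((oneDsqr s)^-1)%:E)%E.
have I0 : (0 <= I)%E by apply: integral_ge0 => s _; rewrite lee_fin invr_ge0 (le_trans _ (oneDsqr_ge1 _)).
have E (x : 'rV[R]_d) : (\int[lebesgue_measure]_s (kap (rV_cons (x, s)))%:E = (kap x)%:E * I)%E.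
  rewrite -ge0_integralZl//.
  - apply: eq_integral => s _; rewrite -EFinM; congr EFin.
    rewrite /kap big_ord_recl rV_cons0 mulrC; congr (_ * _).
    by apply: eq_bigr => i _; rewrite rV_consS.
  - apply/measurable_EFinP; apply: continuous_measurable_fun; exact: continuous_oneDsqrV.
  - by rewrite lee_fin kap_ge0.
under eq_integral do rewrite E.
rewrite ge0_integralZr//; last 2 first.
- apply/measurable_EFinP; exact: measurable_kap.
- by move=> x _; rewrite lee_fin kap_ge0.
rewrite lte_mul_pinfty//.
- by apply: integral_ge0 => x _; rewrite lee_fin kap_ge0.
- by rewrite ge0_fin_numE//; apply: integral_ge0 => x _; rewrite lee_fin kap_ge0.
- exact: integral_oneDsqrV_lty.
Qed.

(** On the unit cube [kap_near] compares [kap] with its value 1 at the origin, which gives a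
    positive lower bound on a set of positive measure. *)
Lemma integral_kap_gt0 (R : realType) d : (0 < \int[leb d]_x (@kap R d x)%:E)%E.
Proof.
apply: (@lt_le_trans _ _ (\int[leb d]_(x in cube 1) (((2 * (1 + 1 ^+ 2)) ^+ d)^-1)%:E)%E).
  rewrite integral_cst//=; last exact: measurable_cube.
  rewrite leb_cube// -EFinM lte_fin; apply: mulr_gt0; rewrite ?invr_gt0; apply: exprn_gt0; lra.
rewrite integral_mkcond; apply: ge0_le_integral => //.
- by move=> x _; apply: erestrict_ge0 => y _; rewrite lee_fin invr_ge0 exprn_ge0//; lra.
- apply/(measurable_restrictT _ _).1; first exact: measurable_cube.
  exact: measurable_cst.
- by apply/measurable_EFinP; exact: measurable_kap.
- move=> x _; rewrite patchE; case: ifPn => [/set_mem hx|_]; last by rewrite lee_fin kap_ge0.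
  have h2 : 0 < (2 * (1 + 1 ^+ 2)) ^+ d :> R by apply: exprn_gt0; rewrite expr1n; lra.
  rewrite lee_fin -[leLHS]mul1r ler_pdivrMr//.
  have k1 : @kap R d 0 = 1.
    by rewrite /kap big1 // => i _; rewrite mxE /oneDsqr expr0n addr0 invr1.
  rewrite mulrC -[leLHS]k1.
  by apply: kap_near => i; rewrite mxE sub0r normrN; exact: hx.
Qed.

(** Cauchy-Schwarz for the finite measure of density [kap], in the form of a discriminant argument.
    The bound M on G makes the integrals finite. *)
Lemma convolution_kap_sqr (R : realType) d (G : 'rV[R]_d -> R) (M : R) (x : 'rV[R]_d) :
  measurable_fun setT G -> (forall x, 0 <= G x <= M) ->
  let conv (H : 'rV[R]_d -> R) := (\int[leb d]_y (kap y * H (x - y))%:E)%E in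
  (conv G ^+ 2 <= (\int[leb d]_x (@kap R d x)%:E) * conv (fun y => (G y ^+ 2)%R))%E.
Proof.
move=> mG G0; cbv zeta.
have msub : measurable_fun setT (fun y : 'rV[R]_d => x - y).
  apply: measurable_fun_coord => i; under eq_fun do rewrite !mxE.
  by apply: measurable_funB => //; exact: measurable_coord.
have mGx : measurable_fun setT (fun y : 'rV[R]_d => G (x - y)) by exact: measurableT_comp mG msub.
have mk : measurable_fun setT (@kap R d) by exact: measurable_kap.
set K := (\int[leb d]_x (kap x)%:E)%E.
set T := (\int[leb d]_y _)%E.
set U := (\int[leb d]_y _)%E.
have K0 : (0 < K)%E by exact: integral_kap_gt0.
have Ky : (K < +oo)%E by exact: integral_kap_lty.
have M0 : 0 <= M by have /andP[h1 h2] := G0 0; exact: le_trans h2.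
have mkE : measurable_fun setT (fun y => (@kap R d y)%:E) by apply/measurable_EFinP.
have kE0 (y : 'rV[R]_d) : (0 <= (kap y)%:E)%E by rewrite lee_fin kap_ge0.
have kG0 y : 0 <= kap y * G (x - y) by apply: mulr_ge0; [exact: kap_ge0|have /andP[] := G0 (x-y)].
have kGG0 y : 0 <= kap y * G (x - y) ^+ 2 by apply: mulr_ge0; [exact: kap_ge0|exact: sqr_ge0].
have T0 : (0 <= T)%E by apply: integral_ge0 => y _; rewrite lee_fin.
have U0 : (0 <= U)%E by apply: integral_ge0 => y _; rewrite lee_fin.
have bnd (H : 'rV[R]_d -> R) (B : R) : measurable_fun setT H -> (forall y, 0 <= H y <= B) ->
    (\int[leb d]_y (kap y * H y)%:E < +oo)%E.
  move=> mH hH.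
  apply: (@le_lt_trans _ _ (B%:E * K)%E).
    rewrite -ge0_integralZl//.
    - apply: ge0_le_integral => //.
      + by move=> y _; rewrite lee_fin mulr_ge0 ?kap_ge0//; have /andP[] := hH y.
      + by apply/measurable_EFinP; apply: measurable_funM.
      + by apply/measurable_EFinP; apply: measurable_funM.
      + move=> y _; rewrite lee_fin mulrC ler_wpM2r ?kap_ge0//; have /andP[] := hH y => //.
    - by rewrite lee_fin; have /andP[h1 h2] := hH 0; exact: le_trans h2.
  rewrite lte_mul_pinfty ?lee_fin//.
  by have /andP[h1 h2] := hH 0; exact: le_trans h2.
have Ty : (T < +oo)%E by apply: (bnd (fun y => G (x - y)) M).
have Uy : (U < +oo)%E.
  apply: (bnd (fun y => G (x - y) ^+ 2) (M ^+ 2)); first exact: measurable_funX.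
  move=> y; have /andP[h1 h2] := G0 (x - y).
  by rewrite sqr_ge0 lerXn2r// nnegrE.
(* The integral of kap (l - G)^2 is nonnegative. *)
have key (l : R) : 0 <= l -> ((2 * l)%:E * T <= (l ^+ 2)%:E * K + U)%E.
  move=> l0.
  rewrite -ge0_integralZl//; last 3 first.
    by apply/measurable_EFinP; apply: measurable_funM.
    by move=> y _; rewrite lee_fin.
    by rewrite lee_fin mulr_ge0.
  rewrite -[X in (_ <= X + _)%E]ge0_integralZl//; last by rewrite lee_fin sqr_ge0.
  rewrite -ge0_integralD//; last 4 first.
    by move=> y _; rewrite -EFinM lee_fin mulr_ge0 ?sqr_ge0 ?kap_ge0.
    by apply/measurable_EFinP; apply: measurable_funM.
    by move=> y _; rewrite lee_fin.
    by apply/measurable_EFinP; apply: measurable_funM => //; exact: measurable_funX.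
  apply: ge0_le_integral => //.
  - by move=> y _; rewrite -EFinM lee_fin; apply: mulr_ge0 => //; apply: mulr_ge0.
  - by apply/measurable_EFinP; apply: measurable_funM => //; apply: measurable_funM.
  - apply: emeasurable_funD; apply/measurable_EFinP.
      by apply: measurable_funM.
    by apply: measurable_funM => //; exact: measurable_funX.
  - move=> y _; rewrite -!EFinM -EFinD lee_fin.
    have := @kap_ge0 R d y; have : 0 <= (l - G (x - y)) ^+ 2 by exact: sqr_ge0.
    by nra.
rewrite -(@fineK _ K) ?ge0_fin_numE ?(ltW K0)// -(@fineK _ T) ?ge0_fin_numE//.
rewrite -(@fineK _ U) ?ge0_fin_numE// in key *.
rewrite -(@fineK _ K) ?ge0_fin_numE ?(ltW K0)// -(@fineK _ T) ?ge0_fin_numE// in key.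
have k0 : 0 < fine K by apply: fine_gt0; rewrite K0.
have t0 : 0 <= fine T by exact: fine_ge0.
move: (fine K) (fine T) (fine U) k0 t0 key => k t u k0 t0 key.
rewrite -EFin_expe -EFinM lee_fin.
(* The value of l that makes l^2 K - 2 l T smallest. *)
have := key (t / k) (divr_ge0 t0 (ltW k0)).
rewrite -!EFinM -EFinD lee_fin => h.
have e1 : 2 * (t / k) * t = 2 * t ^+ 2 / k by field; rewrite gt_eqF.
have e2 : (t / k) ^+ 2 * k = t ^+ 2 / k by field; rewrite gt_eqF.
rewrite e1 e2 -mulrA in h.
have : t ^+ 2 / k <= u by lra.
by rewrite ler_pdivrMr// mulrC.
Qed.

(** * Superpositions and Young's inequality *)

(** Half-width 1/2 gives the cube volume one, so [box] has integral one. *)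
Definition box {R : realType} {d : nat} (x : 'rV[R]_d) : R := \1_(cube (2^-1)) x.

Lemma measurable_box (R : realType) d : measurable_fun setT (@box R d).
Proof. apply: measurable_indic; exact: measurable_cube. Qed.

Lemma box_ge0 (R : realType) d (x : 'rV[R]_d) : 0 <= box x.
Proof. by rewrite /box indicE. Qed.

Lemma box_le1 (R : realType) d (x : 'rV[R]_d) : box x <= 1.
Proof. by rewrite /box indicE; case: (_ \in _). Qed.

Lemma measurable_fun_shift_rV (R : realType) d (z : 'rV[R]_d) :
  measurable_fun setT (fun x : 'rV[R]_d => x - z).
Proof.
under eq_fun do rewrite -[X in X - _]scale1r; exact: measurable_fun_affine_rV.
Qed.

Lemma ge0_integral_shift (R : realType) d (v : 'rV[R]_d) (f : 'rV[R]_d -> \bar R) :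
  measurable_fun setT f -> (forall x, 0 <= f x)%E ->
  (\int[leb d]_x f (x - v)%R = \int[leb d]_x f x)%E.
Proof.
move=> mf f0; rewrite -[RHS](@ge0_integral_affine R d 1 (- v))// expr1n mul1e.
by apply: eq_integral => x _; rewrite scale1r.
Qed.

(** The constant of [kap_near] for r = 1/2, the half-width of [box]. *)
Definition kapA {R : realType} d : R := (2 * (1 + 2^-1 ^+ 2)) ^+ d.

Lemma kapA_gt0 (R : realType) d : 0 < @kapA R d.
Proof. apply: exprn_gt0; have := sqr_ge0 (2^-1 : R); lra. Qed.

(** The convolution is the mean of [kap] over the unit cube around x, where [kap] varies by at most
    the factor [kapA]. *)
Lemma kap_le_conv_box (R : realType) d (x : 'rV[R]_d) :
  ((kap x)%:E <= (kapA d)%:E * \int[leb d]_y (kap y * box (x - y))%:E)%E.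
Proof.
have mb : measurable_fun setT (fun y : 'rV[R]_d => box (x - y)).
  apply: (measurableT_comp (@measurable_box R d)).
  apply: measurable_fun_coord => i; under eq_fun do rewrite !mxE.
  by apply: measurable_funB => //; exact: measurable_coord.
have mk : measurable_fun setT (@kap R d) by exact: measurable_kap.
have A0 := @kapA_gt0 R d.
rewrite -ge0_integralZl//; last 3 first.
- by apply/measurable_EFinP; apply: measurable_funM.
- by move=> y _; rewrite lee_fin mulr_ge0 ?kap_ge0 ?box_ge0.
- by rewrite lee_fin ltW.
apply: (@le_trans _ _ (\int[leb d]_y ((kap x)%:E * (box (x - y))%:E))%E).
  rewrite ge0_integralZl//; last 3 first.
  - by apply/measurable_EFinP.
  - by move=> y _; rewrite lee_fin box_ge0.
  - by rewrite lee_fin kap_ge0.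
  rewrite (_ : \int[leb d]_y _ = 1)%E ?mule1//.
  transitivity (\int[leb d]_y (box (y - x))%:E)%E.
    apply: eq_integral => y _; congr EFin; rewrite /box !indicE; congr ((_ : bool)%:R).
    by apply/idP/idP => /set_mem h; apply/mem_set => i; have := h i; rewrite !mxE distrC.
  rewrite (@ge0_integral_shift R d x (fun y => (box y)%:E)).
  - rewrite /box integral_indic//; last exact: measurable_cube.
    by rewrite setIT leb_cube// divff// expr1n.
  - by apply/measurable_EFinP; exact: measurable_box.
  - by move=> y; rewrite lee_fin box_ge0.
apply: ge0_le_integral => //.
- by move=> y _; rewrite -EFinM lee_fin mulr_ge0 ?kap_ge0 ?box_ge0.
- by apply/measurable_EFinP; apply: measurable_funM.
- by apply/measurable_EFinP; apply: measurable_funM => //; apply: measurable_funM.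
- move=> y _; rewrite -!EFinM lee_fin mulrA.
  have [h|h] := boolP ((x - y) \in (cube (2^-1) : set 'rV[R]_d)); last first.
    by rewrite /box indicE (negbTE h) !mulr0.
  rewrite /box indicE h !mulr1; move: h => /set_mem h.
  by apply: kap_near => i; have := h i; rewrite !mxE.
Qed.

Section superposition.
Variables (R : realType) (d : nat) (I : finType) (c : I -> R) (z : I -> 'rV[R]_d).
Hypothesis c0 : forall n, 0 <= c n.

(** The sum of Gaussians, the packet W, the majorant S and the sum of boxes are all superpositions
    with common weights; only the profile changes, and for the Gaussians also the centers. *)
Definition superpose (g : 'rV[R]_d -> R) (x : 'rV[R]_d) : R :=
  \sum_n c n * g (x - z n).

Lemma measurable_superpose g : measurable_fun setT g -> measurable_fun setT (superpose g).
Proof.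
move=> mg; rewrite /superpose.
apply: measurable_sum => n; apply: measurable_funM => //.
apply: (measurableT_comp mg); exact: measurable_fun_shift_rV.
Qed.

Lemma superpose_ge0 g x : (forall y, 0 <= g y) -> 0 <= superpose g x.
Proof. by move=> g0; apply: sumr_ge0 => n _; rewrite mulr_ge0 ?c0. Qed.

Lemma superpose_kap_le x :
  ((superpose kap x)%:E <= (kapA d)%:E * \int[leb d]_y (kap y * superpose box (x - y))%:E)%E.
Proof.
have mk : measurable_fun setT (@kap R d) by exact: measurable_kap.
have mb n : measurable_fun setT (fun y : 'rV[R]_d => box (x - z n - y)).
  apply: (measurableT_comp (@measurable_box R d)).
  apply: measurable_fun_coord => i; under eq_fun do rewrite !mxE.
  by apply: measurable_funB => //; exact: measurable_coord.
have -> : (\int[leb d]_y (kap y * superpose box (x - y))%:E =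
   \sum_n (c n)%:E * \int[leb d]_y (kap y * box (x - z n - y))%:E)%E.
  transitivity (\int[leb d]_y \sum_n (c n * (kap y * box (x - z n - y)))%:E)%E.
    apply: eq_integral => y _; rewrite sumEFin; congr EFin.
    rewrite mulr_sumr; apply: eq_bigr => n _.
    by rewrite mulrCA addrAC.
  rewrite ge0_integral_sum//; last 2 first.
  - by move=> n; apply/measurable_EFinP; apply: measurable_funM => //; apply: measurable_funM.
  - move=> n y _.
    by rewrite lee_fin mulr_ge0 ?c0// mulr_ge0 ?kap_ge0 ?box_ge0.
  apply: eq_bigr => n _.
  under eq_integral do rewrite EFinM.
  rewrite ge0_integralZl//.
  - by apply/measurable_EFinP; apply: measurable_funM.
  - by move=> y _; rewrite lee_fin mulr_ge0 ?kap_ge0 ?box_ge0.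
  - by rewrite lee_fin c0.
rewrite ge0_sume_distrr//; last first.
  move=> n _; apply: mule_ge0; rewrite ?lee_fin ?c0//.
  by apply: integral_ge0 => y _; rewrite lee_fin mulr_ge0 ?kap_ge0 ?box_ge0.
rewrite -sumEFin; apply: lee_sum => n _.
by rewrite EFinM muleCA lee_wpmul2l ?lee_fin ?c0// kap_le_conv_box.
Qed.

(* Young's inequality |kap * F|_2 <= |kap|_1 |F|_2 after bounding kap by the convolution of kap with the box. *)
Lemma integral_superpose_kap_sqr :
  (\int[leb d]_x (superpose kap x ^+ 2)%:E <=
   (kapA d ^+ 2)%:E * (\int[leb d]_x (@kap R d x)%:E) ^+ 2
   * \int[leb d]_x (superpose box x ^+ 2)%:E)%E.
Proof.
have mk : measurable_fun setT (@kap R d) by exact: measurable_kap.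
have mkE : measurable_fun setT (fun y => (@kap R d y)%:E) by apply/measurable_EFinP.
have mS := @measurable_superpose box (@measurable_box R d).
have mSk := @measurable_superpose kap mk.
set K := (\int[leb d]_x (@kap R d x)%:E)%E.
have K0 : (0 <= K)%E by apply: integral_ge0 => y _; rewrite lee_fin kap_ge0.
have kE0 (y : 'rV[R]_d) : (0 <= (kap y)%:E)%E by rewrite lee_fin kap_ge0.
pose H (p : 'rV[R]_d * 'rV[R]_d) := (kap p.2 * superpose box (p.1 - p.2) ^+ 2)%:E.
have mH : measurable_fun setT H.
  apply/measurable_EFinP; apply: measurable_funM.
    by apply: (measurableT_comp mk); exact: measurable_snd.
  apply: measurable_funX; apply: (measurableT_comp mS); exact: measurable_fun_subr_rV.
have H0 p : (0 <= H p)%E by rewrite lee_fin mulr_ge0 ?kap_ge0 ?sqr_ge0.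
have S0 y : 0 <= superpose box y <= \sum_n c n.
  apply/andP; split; first by apply: superpose_ge0; exact: box_ge0.
  by apply: ler_sum => n _; rewrite -[leRHS]mulr1 ler_wpM2l ?c0// box_le1.
apply: (@le_trans _ _ (\int[leb d]_x ((kapA d ^+ 2)%:E * (K * \int[leb d]_y H (x, y))))%E).
  apply: ge0_le_integral => //.
  - by move=> x _; rewrite lee_fin sqr_ge0.
  - by apply/measurable_EFinP; exact: measurable_funX.
  - apply: measurable_funeM; apply: measurable_funeM.
    exact: (@measurable_fun_fubini_tonelli_F _ _ _ _ _ (lebs R d) H).
  - move=> x _; apply: le_trans (_ : _ <= ((kapA d)%:E * \int[leb d]_y (kap y * superpose box (x - y))%:E) ^+ 2)%E _.
      have h := superpose_kap_le x.
      have h0 : (0 <= (superpose kap x)%:E)%E.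
        by rewrite lee_fin; apply: superpose_ge0; exact: kap_ge0.
      by rewrite EFin_expe lee_sqr// (le_trans h0 h).
    rewrite expe2 muleACA -EFinM -expr2 -expe2.
    rewrite lee_wpmul2l ?lee_fin ?sqr_ge0//.
    exact: (convolution_kap_sqr _ _ _ _ x mS S0).
rewrite ge0_integralZl//; last 3 first.
- apply: measurable_funeM.
  exact: (@measurable_fun_fubini_tonelli_F _ _ _ _ _ (lebs R d) H).
- by move=> x _; apply: mule_ge0 => //; exact: integral_ge0.
- by rewrite lee_fin sqr_ge0.
rewrite -muleA lee_wpmul2l ?lee_fin ?sqr_ge0//.
rewrite ge0_integralZl//; last 2 first.
- exact: (@measurable_fun_fubini_tonelli_F _ _ _ _ _ (lebs R d) H).
- by move=> x _; exact: integral_ge0.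
rewrite -muleA lee_wpmul2l//.
(* With y outermost, the inner integral no longer depends on y by translation invariance, and the
   remaining integral of [kap] factors out. *)
have -> : (\int[leb d]_x \int[leb d]_y H (x, y) = \int[leb d]_y \int[leb d]_x H (x, y))%E.
  exact: (@fubini_tonelli _ _ _ _ _ (lebs R d) (lebs R d) H).
rewrite -ge0_integralZr//; last by apply: integral_ge0 => y _; rewrite lee_fin sqr_ge0.
apply: ge0_le_integral => //.
- by move=> y _; exact: integral_ge0.
- exact: (@measurable_fun_fubini_tonelli_G _ _ _ _ _ (lebs R d) H).
- by apply: emeasurable_funM => //; exact: measurable_cst.
move=> y _; rewrite /H /=.
under eq_integral do rewrite EFinM.
rewrite ge0_integralZl//; last 2 first.
- apply/measurable_EFinP; apply: measurable_funX.
  apply: (measurableT_comp mS); exact: measurable_fun_shift_rV.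
- by move=> x _; rewrite lee_fin sqr_ge0.
rewrite (@ge0_integral_shift R d y (fun x => (superpose box x ^+ 2)%:E))//.
- by apply/measurable_EFinP; exact: measurable_funX.
- by move=> x; rewrite lee_fin sqr_ge0.
Qed.

End superposition.

(** * Smooth functions and bumps *)

Section smooth1.
Context {R : realType}.

(** Off by one: [smooth1 n] provides n + 1 derivatives. A finite order allows the closure properties
    to be proved by induction. *)
Fixpoint smooth1 (n : nat) (h : R -> R) : Prop :=
  exists2 h' : R -> R, forall s : R, is_derive s (1:R) h (h' s) &
    if n is m.+1 then smooth1 m h' else True.

Lemma smooth1_derivable n h s : smooth1 n h -> derivable h s (1 : R).
Proof. by case: n => [|n] [h' hh' _]; have [] := hh' s. Qed.

Lemma smooth1_derive n h : smooth1 n.+1 h -> smooth1 n (derive1 h).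
Proof.
move=> [h' hh' sh']; have -> : derive1 h = h'; last exact: sh'.
by apply/funext => s; rewrite derive1E; have [_ ->] := hh' s.
Qed.

Lemma smooth1D n f g : smooth1 n f -> smooth1 n g -> smooth1 n (f \+ g).
Proof.
elim: n f g => [|n IH] f g [f' ff' sf] [g' gg' sg]; exists (f' \+ g') => //; last exact: IH.
- by move=> s; apply: is_deriveD.
- by move=> s; apply: is_deriveD.
Qed.

Lemma smooth1Z n k f : smooth1 n f -> smooth1 n (fun s => k * f s).
Proof.
elim: n f => [|n IH] f [f' ff' sf]; exists (fun s => k * f' s) => //; last exact: IH.
- by move=> s; apply: is_deriveZ.
- by move=> s; apply: is_deriveZ.
Qed.

Lemma smooth1_sin_cos n : smooth1 n (@sin R) /\ smooth1 n (@cos R).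
Proof.
elim: n => [|n [IHs IHc]]; split.
- by exists cos => // s; exact: is_derive_sin.
- by exists (fun s => - sin s) => // s; exact: is_derive_cos.
- by exists cos => // s; exact: is_derive_sin.
- exists (fun s => -1 * sin s) => [s|]; last exact: smooth1Z.
  by rewrite mulN1r; exact: is_derive_cos.
Qed.

(** Raise x / n <= exp (x / n) to the power n. *)
Lemma expR_ge_exprn n (x : R) : 0 <= x -> x ^+ n <= n%:R ^+ n * expR x.
Proof.
move=> x0; case: n => [|n]; first by rewrite !expr0 mul1r; have := expR_ge1Dx x; lra.
have e : x = (x / n.+1%:R) * n.+1%:R by rewrite divfK.
have x1 : 0 <= x / n.+1%:R by rewrite divr_ge0.
rewrite {2}e expRM_natr -exprMn; apply: lerXn2r; rewrite ?nnegrE ?mulr_ge0 ?expR_ge0//.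
rewrite mulrC -ler_pdivrMr ?ltr0n//; by apply: le_trans (expR_ge1Dx _); rewrite lerDr.
Qed.

(* [flat k] is r^(-k) exp(-1/r) on r > 0: the derivatives of [flat 0] are combinations of these. *)
Definition flat (k : nat) (r : R) : R := if 0 < r then r ^- k * expR (- r^-1) else 0.

Lemma flat_ge0 k r : 0 <= flat k r.
Proof.
rewrite /flat; case: ifP => // r0.
by rewrite mulr_ge0 ?expR_ge0// invr_ge0 exprn_ge0// ltW.
Qed.

(** [expR_ge_exprn] at 1/r with exponent k + m. Every [flat k] thus vanishes to any order m at the
    origin. *)
Lemma flat_le k m r : 0 <= r -> flat k r <= (k + m)%:R ^+ (k + m) * r ^+ m.
Proof.
move=> r0; rewrite /flat; case: ifPn => [{}r0|_]; last by rewrite mulr_ge0 ?exprn_ge0.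
have := @expR_ge_exprn (k + m) r^-1; rewrite invr_ge0 (ltW r0) => /(_ isT).
rewrite expRN -(ler_pM2r (_ : 0 < r ^+ m * (expR r^-1)^-1)); last first.
  by rewrite mulr_gt0 ?exprn_gt0// invr_gt0 expR_gt0.
have -> : r^-1 ^+ (k + m) * (r ^+ m / expR r^-1) = r ^- k / expR r^-1.
  rewrite exprD mulrA -[_ * _ * r ^+ m]mulrA -exprMn mulVf ?gt_eqF// expr1n mulr1.
  by rewrite exprVn.
suff -> : (k + m)%:R ^+ (k + m) * expR r^-1 * (r ^+ m / expR r^-1) =
  (k + m)%:R ^+ (k + m) * r ^+ m by [].
rewrite -mulrA; congr (_ * _); rewrite mulrCA mulfV ?mulr1//.
by rewrite gt_eqF// expR_gt0.
Qed.

(** The derivative stays in the span of the family, which turns smoothness into an induction. Away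
    from 0 this is calculus; at 0 it is the flatness of [flat_le]. *)
Lemma is_derive_flat k (r : R) :
  is_derive r (1 : R) (flat k) (flat k.+2 r + - k%:R * flat k.+1 r).
Proof.
have [r0|r0|r0] := ltgtP r 0.
- rewrite {2 3}/flat !ltNge ltW//= mulr0 addr0.
  apply: (near_eq_is_derive _ (is_derive_cst (0:R) r (1:R))).
  near=> y; rewrite /flat ifF//; apply/negbTE; rewrite -leNgt ltW//.
  by near: y; apply: lt_nbhsl.
- rewrite {2 3}/flat r0.
  have rn0 : r != 0 by rewrite gt_eqF.
  have d1 : is_derive r (1 : R) (fun r : R => - r^-1) (r ^- 2).
    have := is_deriveN (is_deriveV rn0 (is_derive_id r (1:R))).
    by move=> h; apply: (is_derive_eq h); rewrite scaleNr opprK [_ *: _]mulr1.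
  have d2 := is_derive1_comp (is_derive_expR _) d1.
  have d3 : is_derive r (1 : R) (fun r : R => r ^- k) (- k%:R * r ^- k.+1).
    have rk0 : r ^+ k != 0 by rewrite expf_neq0.
    have hk : is_derive r (1 : R) (fun r : R => r ^+ k) (k%:R * r ^+ k.-1).
      apply: DeriveDef; first exact: exprn_derivable.
      by rewrite exp_derive [_ *: _]mulr1.
    have h := is_deriveV (f := fun r => r ^+ k) rk0 hk.
    apply: (is_derive_eq h).
    rewrite [_ *: _]mulrA.
    case: k rk0 {hk h} => [|k] rk0; first by rewrite mulr0 !mul0r oppr0 mul0r.
    by rewrite /= !exprS; field; rewrite rn0 expf_neq0.
  have h := is_deriveM d3 d2.
  have h' := near_eq_is_derive (g := flat k) _ h.
  apply: (is_derive_eq (h' _)).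
    near=> y; rewrite /flat ifT//.
    by near: y; apply: lt_nbhsr.
  rewrite /= ![_ *: _]mulrA !exprS; field.
  by rewrite rn0 expf_neq0.
- rewrite r0 {2 3}/flat ltxx mulr0 addr0.
  have hc : h^-1 *: (flat k (h *: (1 : R) + 0) - flat k 0) @[h --> (0 : R)^'] --> (0 : R).
  apply/cvgrPdist_le => e e0.
  (* Flatness of order two: flat k h <= C h^2, so the difference quotient at 0 is at most C |h|. *)
  set C : R := (k + 2)%:R ^+ (k + 2).
  have C0 : 0 < C by rewrite exprn_gt0// ltr0n addn2.
  near=> h.
  rewrite sub0r normrN addr0 [h *: 1]mulr1 {2}/flat ltxx subr0 normrM normfV.
  have hn0 : h != 0 by near: h; exact: nbhs_dnbhs_neq.
  rewrite mulrC ler_pdivrMr ?normr_gt0//.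
  have he : `|h| <= e / C.
    near: h; apply: dnbhs0_le; exact: divr_gt0.
  have [hle|hgt] := leP h 0.
    by rewrite /flat ltNge hle normr0 mulr_ge0// ltW.
  rewrite (ger0_norm (flat_ge0 _ _)). apply: (le_trans (flat_le k 2 _ (ltW hgt))).
  rewrite -/C expr2 mulrA (gtr0_norm hgt) ler_wpM2r ?(ltW hgt)//.
  by move: he; rewrite (gtr0_norm hgt) ler_pdivlMr// mulrC.
by apply: DeriveDef; [apply/cvg_ex; exists 0|exact/cvg_lim].
Unshelve. all: by end_near. Qed.

Lemma smooth1_flat n k : smooth1 n (flat k).
Proof.
elim: n k => [|n IH] k; (exists (fun r => flat k.+2 r + - k%:R * flat k.+1 r) => //;
  first by move=> r; exact: is_derive_flat).
by apply: smooth1D; [exact: IH|apply: smooth1Z; exact: IH].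
Qed.

Lemma smooth1_low n f : smooth1 n.+1 f -> smooth1 n f.
Proof. elim: n f => [|m IHm] h [h' hh' sh']; exists h' => //; exact: IHm. Qed.

Lemma smooth1M n f g : smooth1 n f -> smooth1 n g -> smooth1 n (f \* g).
Proof.
elim: n f g => [|n IH] f g sf sg.
  case: sf sg => [f' ff' _] [g' gg' _].
  by exists (fun s => f s *: g' s + g s *: f' s) => // s; exact: is_deriveM.
case: (sf) (sg) => [f' ff' sf'] [g' gg' sg'].
exists ((f \* g') \+ (g \* f')) => [s|]; first exact: is_deriveM.
by apply: smooth1D; apply: IH => //; exact: smooth1_low.
Qed.

Lemma smooth1_comp n f g : smooth1 n f -> smooth1 n g -> smooth1 n (f \o g).
Proof.
elim: n f g => [|n IH] f g sf sg.
  case: sf sg => [f' ff' _] [g' gg' _].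
  exists (fun s => f' (g s) * g' s) => // s; exact: is_derive1_comp.
case: (sf) (sg) => [f' ff' sf'] [g' gg' sg'].
exists ((f' \o g) \* g') => [s|]; first exact: is_derive1_comp.
by apply: smooth1M => //; apply: IH => //; exact: smooth1_low.
Qed.

Lemma smooth1_cst n (k : R) : smooth1 n (cst k).
Proof. elim: n k => [|n IH] k; exists (cst 0) => //; try exact: IH; by move=> s; exact: is_derive_cst. Qed.

Lemma smooth1_id n : smooth1 n (id : R -> R).
Proof. case: n => [|n]; exists (cst 1) => //; try exact: smooth1_cst; by move=> s; exact: is_derive_id. Qed.

(** The classical exp (- 1 / (1 - s^2)), extended by zero outside ]-1, 1[. *)
Definition bump (s : R) : R := flat 0 (1 - s ^+ 2).

Lemma smooth1_bump n : smooth1 n bump.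
Proof.
apply: (@smooth1_comp n (flat 0) (fun s => 1 - s ^+ 2)); first exact: smooth1_flat.
have -> : (fun s : R => 1 - s ^+ 2) = (cst 1 \+ (fun s => -1 * (s * s))).
  by apply/funext => s /=; rewrite mulN1r.
apply: smooth1D; [exact: smooth1_cst|apply: smooth1Z].
by apply: (@smooth1M n id id); exact: smooth1_id.
Qed.

Lemma bump_ge0 s : 0 <= bump s.
Proof. exact: flat_ge0. Qed.

Lemma bump_eq0 s : 1 <= `|s| -> bump s = 0.
Proof.
move=> s1; rewrite /bump /flat ifF//; apply/negbTE; rewrite -leNgt subr_le0.
by rewrite -(real_normK (num_real s)) exprn_ege1.
Qed.

(** 1 - s^2 >= 3/4 on the half-width of [box], so the bump stays away from zero there. *)
Lemma bump_ge s : `|s| <= 2^-1 -> expR (- (3 / 4)^-1) <= bump s.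
Proof.
move=> s1; have h : 3 / 4 <= 1 - s ^+ 2.
  by move: s1; rewrite ler_norml => /andP[h1 h2]; nra.
rewrite /bump /flat ifT ?expr0 ?invr1 ?mul1r; last by apply: lt_le_trans h.
rewrite ler_expR lerN2 lef_pV2// posrE//.
by apply: lt_le_trans h.
Qed.

End smooth1.

Section bump_derivatives.
Context {R : realType}.

(** The strict inequality describes an open set, near each point of which h is constantly zero. *)
Lemma derive1_supp (h : R -> R) : (forall s, 1 < `|s| -> h s = 0) ->
  forall s, 1 < `|s| -> derive1 h s = 0.
Proof.
move=> h0 s s1; rewrite derive1E -(near_eq_derive (f := cst (0:R))) ?derive_cst//.
near=> t; rewrite h0//; near: t.
have : (fun t : R => `|t|) t @[t --> s] --> `|s| by exact: norm_continuous.
by move=> /cvgr_gt; apply.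
Unshelve. all: by end_near. Qed.

Lemma smooth1_continuous n (h : R -> R) : smooth1 n h -> continuous h.
Proof.
move=> sh s; apply: differentiable_continuous; apply/derivable1_diffP.
exact: smooth1_derivable sh.
Qed.

Lemma supp_bounded (h : R -> R) : continuous h -> (forall s, 1 < `|s| -> h s = 0) ->
  exists2 M, 0 <= M & forall s, `|h s| <= M.
Proof.
move=> ch h0.
have c1 : {within `[-1, 1], continuous (fun s : R => `|h s|)}.
  apply: continuous_subspaceT => s; apply: continuous_comp; first exact: ch.
  exact: norm_continuous.
have [|c _ hc] := EVT_max _ c1; first by lra.
exists `|h c| => // s.
have [hs|hs] := leP `|s| 1; last by rewrite h0// normr0.
by apply: hc; rewrite in_itv /= -ler_norml.
Qed.

Lemma bump_derivatives_bounded : exists2 M : R, 0 < M &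
  forall s, [/\ `|bump s| <= M, `|derive1 bump s| <= M & `|derive1 (derive1 bump) s| <= M].
Proof.
have z0 (s : R) : 1 < `|s| -> bump s = 0 by move=> /ltW; exact: bump_eq0.
have z1 := derive1_supp _ z0.
have z2 := derive1_supp _ z1.
have s0 := @smooth1_bump R 2.
have s1 := smooth1_derive _ _ s0.
have s2 := smooth1_derive _ _ s1.
have [M0 M00 h0] := supp_bounded _ (smooth1_continuous _ _ s0) z0.
have [M1 M10 h1] := supp_bounded _ (smooth1_continuous _ _ s1) z1.
have [M2 M20 h2] := supp_bounded _ (smooth1_continuous _ _ s2) z2.
exists (1 + M0 + M1 + M2); first by lra.
move=> s; split; [apply: le_trans (h0 s) _|apply: le_trans (h1 s) _|apply: le_trans (h2 s) _]; lra.
Qed.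

End bump_derivatives.

(** * Differentiability of finite order in several variables *)

Section smooth.
Context {R : realType} {d : nat}.
Implicit Types (f g : 'rV[R]_d -> R) (i : 'I_d) (x : 'rV[R]_d).

(** As for [smooth1], the index counts from zero: [smooth 0] is differentiability and [smooth n]
    concerns n + 1 orders of partial derivatives. *)
Fixpoint smooth (n : nat) f : Prop :=
  (forall x, differentiable f x) /\
  (if n is m.+1 then forall i, smooth m (partial i f) else True).

Lemma smooth_low n f : smooth n.+1 f -> smooth n f.
Proof.
elim: n f => [|n IH] f [df pf]; split => // i.
by apply: IH; exact: pf.
Qed.

Lemma partialD i f g x : differentiable f x -> differentiable g x ->
  partial i (f \+ g) x = partial i f x + partial i g x.
Proof. by move=> df dg; rewrite /partial deriveD//; exact: diff_derivable. Qed.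

Lemma partialM i f g x : differentiable f x -> differentiable g x ->
  partial i (f \* g) x = f x * partial i g x + g x * partial i f x.
Proof. by move=> df dg; rewrite /partial deriveM//; exact: diff_derivable. Qed.

Lemma partial_cst i (k : R) x : partial i (cst k) x = 0.
Proof. by rewrite /partial derive_cst. Qed.

Lemma partial_comp i (h : R -> R) f x : derivable h (f x) (1 : R) -> differentiable f x ->
  partial i (h \o f) x = derive1 h (f x) * partial i f x.
Proof.
move=> dh df; have dh' : differentiable h (f x) by apply/derivable1_diffP.
rewrite /partial deriveE; last exact: differentiable_comp.
rewrite diff_comp//= deriveE// (deriv1E dh) /=.
by rewrite [_ *: _]mulrC.
Qed.

Lemma partial_affine i (b : R) (z : 'rV[R]_d) f x : differentiable f (b *: x + z) ->
  partial i (fun x => f (b *: x + z)) x = b * partial i f (b *: x + z).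
Proof.
move=> df; have da : differentiable (fun x : 'rV[R]_d => b *: x + z) x.
  by apply: differentiableD => //; apply: differentiableZ.
rewrite /partial.
have -> : (fun x => f (b *: x + z)) = f \o (fun x : 'rV[R]_d => b *: x + z) by [].
rewrite deriveE; last exact: differentiable_comp.
rewrite diff_comp//= deriveE//.
set v := delta_mx ord0 i.
have -> : 'd (fun x : 'rV[R]_d => b *: x + z) x v = b *: v.
  rewrite -deriveE//.
  have h := is_deriveD (is_deriveZ b (is_derive_id x v)) (is_derive_cst z x v).
  have [_ ->] := h.
  by rewrite addr0.
by rewrite linearZ.
Qed.

Lemma smooth_cst n (k : R) : smooth n (cst k).
Proof.
elim: n k => [|n IH] k; split => //= i.
have -> : partial i (cst k) = cst 0 :> ('rV[R]_d -> R) by apply/funext => x; rewrite partial_cst.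
exact: IH.
Qed.

Lemma smoothD n f g : smooth n f -> smooth n g -> smooth n (f \+ g).
Proof.
elim: n f g => [|n IH] f g [df pf] [dg pg]; split.
- by move=> x; apply: differentiableD.
- by [].
- by move=> x; apply: differentiableD.
move=> i; have -> : partial i (f \+ g) = partial i f \+ partial i g.
  by apply/funext => x; rewrite partialD.
exact: (IH _ _ (pf i) (pg i)).
Qed.

Lemma smoothM n f g : smooth n f -> smooth n g -> smooth n (f \* g).
Proof.
elim: n f g => [|n IH] f g sf sg; case: (sf) (sg) => [df pf] [dg pg]; split.
- by move=> x; apply: differentiableM.
- by [].
- by move=> x; apply: differentiableM.
move=> i; have -> : partial i (f \* g) = (f \* partial i g) \+ (g \* partial i f).
  by apply/funext => x; rewrite partialM.
apply: (smoothD n); apply: IH; [exact: smooth_low|exact: pg|exact: smooth_low|exact: pf].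
Qed.

Lemma smooth_comp n (h : R -> R) f : smooth1 n h -> smooth n f -> smooth n (h \o f).
Proof.
elim: n h f => [|n IH] h f sh sf; case: (sf) => [df pf]; split.
- by move=> x; apply: differentiable_comp => //; apply/derivable1_diffP; exact: smooth1_derivable sh.
- by [].
- by move=> x; apply: differentiable_comp => //; apply/derivable1_diffP; exact: smooth1_derivable sh.
move=> i; have -> : partial i (h \o f) = (derive1 h \o f) \* partial i f.
  by apply/funext => x; rewrite partial_comp//; exact: smooth1_derivable sh.
apply: (smoothM n) (pf i); apply: IH; last exact: smooth_low.
exact: smooth1_derive.
Qed.

End smooth.

Set Implicit Arguments.
Unset Strict Implicit.
Unset Printing Implicit Defensive.

Section smooth_tensor.
Context {R : realType} {d : nat}.
Implicit Types (f g : 'rV[R]_d -> R) (i : 'I_d) (x : 'rV[R]_d).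

Lemma partial_coord i j x :
  partial i (fun x : 'rV[R]_d => x ord0 j) x = (j == i)%:R.
Proof.
rewrite /partial; set v := delta_mx _ _.
have /matrixP /(_ ord0 j) := derive_mx (@derivable_id R 'rV[R]_d x v).
by rewrite derive_id !mxE eqxx => <-.
Qed.

Lemma smooth_coord n j : smooth n (fun x : 'rV[R]_d => x ord0 j).
Proof.
case: n => [|n]; split; try by move=> x; exact: differentiable_coord.
  by [].
move=> i; have -> : partial i (fun x : 'rV[R]_d => x ord0 j) = cst ((j == i)%:R).
  by apply/funext => x; rewrite partial_coord.
exact: smooth_cst.
Qed.

Lemma smoothZ n (k : R) f : smooth n f -> smooth n (fun x => k * f x).
Proof. by move=> sf; apply: (smoothM n (cst k)) => //; exact: smooth_cst. Qed.

Lemma partialZ i (k : R) f x : differentiable f x ->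
  partial i (fun x => k * f x) x = k * partial i f x.
Proof.
move=> df; rewrite (partialM i (cst k) f x _ df); last by exact: differentiable_cst.
by rewrite partial_cst mulr0 addr0.
Qed.

Lemma smooth_sum n (I : Type) (s : seq I) (P : pred I) (F : I -> 'rV[R]_d -> R) :
  (forall j, smooth n (F j)) -> smooth n (fun x => \sum_(j <- s | P j) F j x).
Proof.
move=> sF; elim: s => [|j s IH].
  have -> : (fun x : 'rV[R]_d => \sum_(j <- [::] | P j) F j x) = cst 0.
    by apply/funext => x; rewrite big_nil.
  exact: smooth_cst.
case Pj : (P j).
  rewrite (_ : (fun _ => _) = F j \+ (fun x => \sum_(j <- s | P j) F j x)).
    exact: smoothD.
  by apply/funext => x; rewrite big_cons Pj.
by under eq_fun do rewrite big_cons Pj.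
Qed.

Lemma partial_sum i (I : Type) (s : seq I) (P : pred I) (F : I -> 'rV[R]_d -> R) x :
  (forall j, smooth 0 (F j)) ->
  partial i (fun x => \sum_(j <- s | P j) F j x) x = \sum_(j <- s | P j) partial i (F j) x.
Proof.
move=> sF; elim: s => [|j s IH].
  have -> : (fun x : 'rV[R]_d => \sum_(j <- [::] | P j) F j x) = cst 0.
    by apply/funext => y; rewrite big_nil.
  by rewrite partial_cst big_nil.
rewrite big_cons; case: ifPn => Pj; last first.
  by under eq_fun do rewrite big_cons (negbTE Pj).
rewrite (_ : (fun _ => _) = F j \+ (fun x => \sum_(j <- s | P j) F j x)); last first.
  by apply/funext => y; rewrite big_cons Pj.
rewrite partialD ?IH//; first by have [] := sF j.
by have [] := @smooth_sum 0 I s P F sF.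
Qed.

Lemma smooth_affine n (b : R) (z : 'rV[R]_d) f : smooth n f -> smooth n (fun x => f (b *: x + z)).
Proof.
have da x : differentiable (fun x : 'rV[R]_d => b *: x + z) x.
  by apply: differentiableD => //; apply: differentiableZ.
have dfa f0 x : (forall x, differentiable f0 x) -> differentiable (fun x : 'rV[R]_d => f0 (b *: x + z)) x.
  by move=> df; apply: (@differentiable_comp _ _ _ _ (fun x : 'rV[R]_d => b *: x + z) f0).
elim: n f => [|n IH] f [df pf]; split; try by move=> x; exact: dfa.
  by [].
move=> i; have -> : partial i (fun x => f (b *: x + z)) = (fun x => b * partial i f (b *: x + z)).
  by apply/funext => x; rewrite partial_affine.
by apply: smoothZ; exact: (IH _ (pf i)).
Qed.

Lemma smooth_prod n (s : seq 'I_d) (P : pred 'I_d) (F : 'I_d -> 'rV[R]_d -> R) :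
  (forall j, smooth n (F j)) -> smooth n (fun x => \prod_(j <- s | P j) F j x).
Proof.
move=> sF; elim: s => [|j s IH].
  have -> : (fun x : 'rV[R]_d => \prod_(j <- [::] | P j) F j x) = cst 1.
    by apply/funext => x; rewrite big_nil.
  exact: smooth_cst.
case Pj : (P j).
  rewrite (_ : (fun _ => _) = F j \* (fun x => \prod_(j <- s | P j) F j x)).
    exact: smoothM.
  by apply/funext => x; rewrite big_cons Pj.
by under eq_fun do rewrite big_cons Pj.
Qed.

Lemma partial_prod_eq0 i (s : seq 'I_d) (P : pred 'I_d) (F : 'I_d -> 'rV[R]_d -> R) x :
  (forall j, smooth 0 (F j)) -> (forall j, P j -> partial i (F j) x = 0) ->
  partial i (fun x => \prod_(j <- s | P j) F j x) x = 0.
Proof.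
move=> sF F0; elim: s => [|j s IH].
  have -> : (fun x : 'rV[R]_d => \prod_(j <- [::] | P j) F j x) = cst 1.
    by apply/funext => y; rewrite big_nil.
  by rewrite partial_cst.
have [Pj|Pj] := boolP (P j); last first.
  by under eq_fun do rewrite big_cons (negbTE Pj).
rewrite (_ : (fun _ => _) = F j \* (fun x => \prod_(j <- s | P j) F j x)); last first.
  by apply/funext => y; rewrite big_cons Pj.
rewrite partialM ?IH// ?F0// ?mulr0 ?addr0//; first by have [] := sF j.
by have [] := @smooth_prod 0 s P F sF.
Qed.

Definition tens (h : 'I_d -> R -> R) x : R := \prod_j h j (x ord0 j).

Definition upd (h : 'I_d -> R -> R) i (g : R -> R) : 'I_d -> R -> R :=
  fun j => if j == i then g else h j.

Lemma smooth_tens n h : (forall j, smooth1 n (h j)) -> smooth n (tens h).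
Proof.
move=> sh; apply: smooth_prod => j; apply: (smooth_comp n (h j)) => //.
exact: smooth_coord.
Qed.

(** Only the factor with index i depends on the i-th coordinate; the product of the others has zero
    partial derivative. *)
Lemma partial_tens i h x : (forall j, smooth1 0 (h j)) ->
  partial i (tens h) x = tens (upd h i (derive1 (h i))) x.
Proof.
move=> sh.
have sc j : smooth 0 (fun x : 'rV[R]_d => h j (x ord0 j)).
  by apply: (smooth_comp 0 (h j)) => //; exact: smooth_coord.
pose rest (x : 'rV[R]_d) := \prod_(j | j != i) h j (x ord0 j).
have -> : tens h = (fun x : 'rV[R]_d => h i (x ord0 i)) \* rest.
  by apply/funext => y; rewrite /tens (bigD1 i).
rewrite partialM; last 2 first.
  by have [] := sc i.
  by have [] := @smooth_prod 0 (index_enum _) (fun j => j != i) (fun j x => h j (x ord0 j)) sc.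
have pc j : partial i (fun x : 'rV[R]_d => h j (x ord0 j)) x = derive1 (h j) (x ord0 j) * (j == i)%:R.
  rewrite (partial_comp i (h j) (fun x : 'rV[R]_d => x ord0 j)) ?partial_coord//.
  exact: smooth1_derivable (sh j).
  exact: differentiable_coord.
rewrite (@partial_prod_eq0 i (index_enum _) (fun j => j != i) (fun j x => h j (x ord0 j)))//; last first.
  by move=> j /negbTE ji; rewrite pc ji mulr0.
rewrite mulr0 add0r pc eqxx mulr1 mulrC /tens (bigD1 i)//= /upd eqxx; congr (_ * _).
by apply: eq_bigr => j /negbTE ->.
Qed.

Lemma measurable_tens h : (forall j, continuous (h j)) -> measurable_fun setT (tens h).
Proof.
move=> ch; apply: measurable_prod => j _.
apply: (measurableT_comp (f := h j)); last exact: measurable_coord.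
exact: continuous_measurable_fun.
Qed.

Lemma smooth_iter_partial f : (forall n, smooth n f) ->
  forall (s : seq 'I_d) n, smooth n (foldr (@partial R d) f s).
Proof.
move=> sf; elim => [|i s IH] n //=.
by have [_] := IH n.+1; apply.
Qed.

Lemma compact_cube (r : R) : compact (@cube R d r).
Proof.
have -> : cube r = [set v : 'rV[R]_d | forall i, `[- r, r]%classic (v ord0 i)].
  by apply/seteqP; split=> v h i; have := h i; rewrite /= in_itv /= -ler_norml.
apply: (@rV_compact R d (fun=> `[- r, r]%classic)) => i; exact: segment_compact.
Qed.

Lemma closed_cube (r : R) : closed (@cube R d r).
Proof. by apply: compact_closed; [exact: norm_hausdorff|exact: compact_cube]. Qed.

Lemma smooth_test_function f (r : R) : (forall n, smooth n f) ->
  (forall x, f x != 0 -> cube r x) -> test_function f.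
Proof.
move=> sf f0; split.
  by move=> s x; have [] := smooth_iter_partial sf s 0.
apply: (subclosed_compact _ (@compact_cube r)); first exact: closed_closure.
rewrite closureE => x; apply; split; [exact: closed_cube|exact: f0].
Qed.

(** In 'I_3 [ord_max] is the order two, and the duplicate-free list of coordinates meets i exactly
    once; every other entry iterates zero times. *)
Lemma mpartial2E i f : mpartial [ffun j => if j == i then ord_max else ord0] f =
  partial i (partial i f).
Proof.
rewrite /mpartial.
have : uniq (enum 'I_d) := enum_uniq _.
have : i \in enum 'I_d by rewrite mem_enum.
elim: (enum 'I_d) => //= j s IH; rewrite inE => /orP[/eqP <-|js] /andP[nis us].
  rewrite ffunE eqxx /=.
  have -> : foldr (fun i0 f0 => iter ([ffun j0 => if j0 == i then ord_max else ord0] i0 : 'I_3) (partial i0) f0) f s = f; last by [].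
  elim: s nis {IH us} => //= j0 s IH; rewrite inE negb_or => /andP[ij nis].
  by rewrite IH// ffunE eq_sym (negbTE ij).
have ji : (j == i) = false by apply/negP => /eqP e; rewrite e js in nis.
rewrite (IH js us) ffunE ji; exact: erefl.
Qed.

End smooth_tensor.

(** * Square-integrable functions *)

Section square_integrable.
Context {dsp : measure_display} {T : measurableType dsp} {R : realType} (mu : {measure set T -> \bar R}).
Implicit Types f g : T -> R.

Definition sqint f : \bar R := (\int[mu]_x (f x ^+ 2)%:E)%E.

Definition sqintegrable f : Prop := measurable_fun setT f /\ (sqint f < +oo)%E.

(** A real number, by [fine]: it is 0 when the integral is infinite, so it is meaningful only
    together with [sqintegrable]. *)
Definition n2 f : R := Num.sqrt (fine (sqint f)).

Lemma sqint_ge0 f : (0 <= sqint f)%E.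
Proof. by apply: integral_ge0 => x _; rewrite lee_fin sqr_ge0. Qed.

Lemma n2_ge0 f : 0 <= n2 f.
Proof. exact: sqrtr_ge0. Qed.

Lemma n2_sqr f : sqintegrable f -> (n2 f ^+ 2)%:E = sqint f.
Proof.
move=> [_ foo]; rewrite sqr_sqrtr ?fine_ge0 ?sqint_ge0// fineK// ge0_fin_numE//.
exact: sqint_ge0.
Qed.

Lemma Lnorm2E f : 'N[mu]_2[EFin \o f]%E = sqrte (sqint f).
Proof.
rewrite unlock poweR12_sqrt; last by apply: integral_ge0 => x _; exact: poweR_ge0.
congr (sqrte _); apply: eq_integral => x _ /=.
by rewrite powR_mulrn// real_normK// num_real.
Qed.

Lemma CauchySchwarz f g : sqintegrable f -> sqintegrable g ->
  mu.-integrable setT (EFin \o (f \* g)) /\ `|\int[mu]_x (f x * g x)| <= n2 f * n2 g.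
Proof.
move=> sf sg; have [[mf foo] [mg goo]] := (sf, sg).
have h := @hoelder _ _ _ mu f g 2 2 mf mg.
have {h} := h (ltr0Sn _ _) (ltr0Sn _ _).
rewrite (_ : 2^-1 + 2^-1 = 1 :> R); last by field.
move=> /(_ erefl); rewrite !Lnorm2E Lnorm1 => h.
have e f0 : sqintegrable f0 -> sqrte (sqint f0) = (n2 f0)%:E.
  by move=> s0; rewrite -n2_sqr// EFin_expe sqrte_sqr gee0_abs// lee_fin n2_ge0.
rewrite !e// -EFinM in h.
have int : mu.-integrable setT (EFin \o (f \* g)).
  apply/integrableP; split; first by apply/measurable_EFinP; exact: measurable_funM.
  by apply: le_lt_trans h _; rewrite ltry.
split => //.
rewrite -lee_fin; apply: le_trans h.
rewrite EFin_normr_Rintegral//.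
by apply: le_abse_integral => //; exact: (measurable_int _ int).
Qed.

Lemma le_sqintegrable f g : measurable_fun setT f -> sqintegrable g ->
  (forall x, `|f x| <= `|g x|) -> sqintegrable f /\ n2 f <= n2 g.
Proof.
move=> mf [mg goo] fg.
have le : (sqint f <= sqint g)%E.
  apply: ge0_le_integral => //.
  - by move=> x _; rewrite lee_fin sqr_ge0.
  - by apply/measurable_EFinP; exact: measurable_funX.
  - by apply/measurable_EFinP; exact: measurable_funX.
  - by move=> x _; rewrite lee_fin -(real_normK (num_real (g x))) -(real_normK (num_real (f x))) lerXn2r// ?nnegrE.
have foo : (sqint f < +oo)%E by exact: le_lt_trans goo.
split => //; rewrite /n2 ler_wsqrtr// fine_le// ge0_fin_numE//; exact: sqint_ge0.
Qed.

Lemma n2_ger0_norm f (k : R) : sqintegrable f -> sqintegrable (fun x => k * f x) /\ n2 (fun x => k * f x) = `|k| * n2 f.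
Proof.
move=> [mf foo].
have e : sqint (fun x => k * f x) = ((k ^+ 2)%:E * sqint f)%E.
  rewrite /sqint -ge0_integralZl//.
  - by apply: eq_integral => x _; rewrite exprMn EFinM.
  - by apply/measurable_EFinP; exact: measurable_funX.
  - by move=> x _; rewrite lee_fin sqr_ge0.
  - by rewrite lee_fin sqr_ge0.
split.
  split; first exact: measurable_funM.
  by rewrite e lte_mul_pinfty// lee_fin sqr_ge0.
rewrite /n2 e fineM//; last by rewrite ge0_fin_numE ?sqint_ge0.
by rewrite /= sqrtrM ?sqr_ge0// sqrtr_sqr.
Qed.

Lemma n2_triangle f g : sqintegrable f -> sqintegrable g ->
  sqintegrable (f \+ g) /\ n2 (f \+ g) <= n2 f + n2 g.
Proof.
move=> sf sg; have [[mf foo] [mg goo]] := (sf, sg).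
have h := @minkowski_EFin _ _ _ mu f g 2 mf mg.
have {h} := h (ler1n _ 2).
rewrite !Lnorm2E => h.
have e f0 : sqintegrable f0 -> sqrte (sqint f0) = (n2 f0)%:E.
  by move=> s0; rewrite -n2_sqr// EFin_expe sqrte_sqr gee0_abs// lee_fin n2_ge0.
rewrite (e _ sf) (e _ sg) -EFinD in h.
have s : sqintegrable (f \+ g).
  split; first exact: measurable_funD.
  have : (sqrte (sqint (f \+ g)%R) < +oo)%E by apply: le_lt_trans h _; rewrite ltry.
  by case: (sqint (f \+ g)) => [r||]; rewrite /= ?ltry ?ltNyy.
by split => //; rewrite (e _ s) lee_fin in h.
Qed.

End square_integrable.

Section complex_L2.
Context {R : realType} {d : nat}.
Local Notation normc := (@ComplexField.Normc.normc _).
Implicit Types (u v g : 'rV[R]_d -> R[i]) (phi : 'rV[R]_d -> R).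

Definition reim2 u : 'rV[R]_d -> R := fun x => complex.Re (u x) ^+ 2 + complex.Im (u x) ^+ 2.

Lemma normc_sqr u x : normc (u x) ^+ 2 = reim2 u x.
Proof.
rewrite /reim2; case: (u x) => a b /=.
by rewrite sqr_sqrtr// addr_ge0 ?sqr_ge0.
Qed.

Lemma L2normE u : L2norm u = sqrte (\int[leb d]_x (reim2 u x)%:E)%E.
Proof.
rewrite /L2norm Lnorm2E /sqint; congr sqrte.
by apply: eq_integral => x _; rewrite /= normc_sqr.
Qed.

Lemma inL2_sqintegrable u : inL2 u ->
  [/\ sqintegrable (leb d) (fun x => complex.Re (u x)),
      sqintegrable (leb d) (fun x => complex.Im (u x)) &
      L2norm u = (n2 (leb d) (fun x => Num.sqrt (reim2 u x)))%:E].
Proof.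
move=> [mr mi]; rewrite L2normE => uoo.
have I0 : (0 <= \int[leb d]_x (reim2 u x)%:E)%E.
  by apply: integral_ge0 => x _; rewrite lee_fin addr_ge0 ?sqr_ge0.
have Ioo : (\int[leb d]_x (reim2 u x)%:E < +oo)%E.
  by move: uoo I0; case: (\int[_]_x _)%E => [r||]; rewrite /= ?ltry ?ltNyy.
have mre : measurable_fun setT (reim2 u) by apply: measurable_funD; exact: measurable_funX.
split.
- split => //; apply: le_lt_trans Ioo; apply: ge0_le_integral => //.
  + by move=> x _; rewrite lee_fin sqr_ge0.
  + by apply/measurable_EFinP; exact: measurable_funX.
  + exact/measurable_EFinP.
  + by move=> x _; rewrite lee_fin lerDl sqr_ge0.
- split => //; apply: le_lt_trans Ioo; apply: ge0_le_integral => //.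
  + by move=> x _; rewrite lee_fin sqr_ge0.
  + by apply/measurable_EFinP; exact: measurable_funX.
  + exact/measurable_EFinP.
  + by move=> x _; rewrite lee_fin lerDr sqr_ge0.
- rewrite /n2 /sqint.
  under [in RHS]eq_integral do rewrite sqr_sqrtr ?addr_ge0 ?sqr_ge0//.
  by move: I0 Ioo; case: (\int[_]_x _)%E => // r.
Qed.

(** Test functions are real, so the weak identity splits into real and imaginary parts; the order
    two makes its sign positive. *)
Lemma weak_deriv2_duality u i phi : inB u -> test_function phi ->
  let b : midx d 2 := [ffun j => if j == i then ord_max else ord0] in
  let g := weak_deriv b u in
  [/\ inL2 g,
   \int[leb d]_x (complex.Re (u x) * partial i (partial i phi) x) = \int[leb d]_x (complex.Re (g x) * phi x) &
   \int[leb d]_x (complex.Im (u x) * partial i (partial i phi) x) = \int[leb d]_x (complex.Im (g x) * phi x)].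
Proof.
move=> [_ uB] tphi b g.
have db : mdeg b = 2%N.
  rewrite /mdeg (bigD1 i)//= ffunE eqxx big1 // => j /negbTE ji.
  by rewrite ffunE ji.
have d0 : mdeg ([ffun=> ord0] : midx d 2) = 0%N.
  by rewrite /mdeg big1 // => j _; rewrite ffunE.
(* The weight x^0 in the definition of B yields the weak derivative itself. *)
have := uB [ffun=> ord0] b; rewrite db d0 => /(_ isT) [[L2g wg] _].
have := wg phi tphi; rewrite db sqrrN expr1n mul1r mpartial2E => h.
have re (z : R[i]) (r : R) : complex.Re (z * r%:C%C) = complex.Re z * r.
  by case: z => a c /=; rewrite mulr0 subr0.
have im (z : R[i]) (r : R) : complex.Im (z * r%:C%C) = complex.Im z * r.
  by case: z => a c /=; rewrite mulr0 add0r.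
split => //.
- have := congr1 (@complex.Re R) h; rewrite /Cintegral /=.
  under eq_Rintegral do rewrite re.
  by under [in X in _ = X]eq_Rintegral do rewrite re.
- have := congr1 (@complex.Im R) h; rewrite /Cintegral /=.
  under eq_Rintegral do rewrite im.
  by under [in X in _ = X]eq_Rintegral do rewrite im.
Qed.

End complex_L2.

(** * Differentiating and continuing pairings in time *)

Section time_dependent_pairing.
Context {dsp : measure_display} {T : measurableType dsp} {R : realType} (mu : {measure set T -> \bar R}).

Lemma sqintegrable_indic (K : set T) (M : R) : measurable K -> (mu K < +oo)%E ->
  sqintegrable mu (fun x => M * \1_K x).
Proof.
move=> mK Koo; apply: (n2_ger0_norm M _).1; split; first exact: measurable_indic.
rewrite /sqint; under eq_integral => x _.
  rewrite (_ : (\1_K x : R) ^+ 2 = \1_K x); last by rewrite indicE; case: (_ \in _); rewrite ?expr1n ?expr0n.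
  over.
by rewrite integral_indic// setIT.
Qed.

Variables (P : R -> T -> R) (P' : T -> R) (w : R -> T -> R) (K : set T) (M T0 t : R).
Hypotheses (t0 : 0 < t) (tT : t < T0).
Hypothesis sP : forall s, 0 <= s <= T0 -> sqintegrable mu (P s).
Hypothesis sP' : sqintegrable mu P'.
Hypothesis cvgP : n2 mu (fun x => (s - t)^-1 * (P s x - P t x) - P' x)
  @[s --> within `[0, T0]%classic t^'] --> (0 : R).
Hypotheses (mK : measurable K) (Koo : (mu K < +oo)%E).
Hypothesis mw : forall s, measurable_fun setT (w s).
Hypothesis wb : forall s x, 0 < s < T0 -> `|w s x| <= M * \1_K x.
Hypothesis dw : forall s x, 0 < s < T0 -> derivable (w ^~ x) s (1 : R).
Hypothesis dwb : forall s x, 0 < s < T0 -> `|derive1 (w ^~ x) s| <= M * \1_K x.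

Let G : T -> R := fun x => M * \1_K x.

Let sG : sqintegrable mu G.
Proof. exact: sqintegrable_indic. Qed.

Let inT : 0 < t < T0.
Proof. by rewrite t0 tT. Qed.

Let G0 : forall x, 0 <= G x.
Proof. by move=> x; apply: (le_trans _ (wb x inT)). Qed.

Let sw s : 0 < s < T0 -> sqintegrable mu (w s) /\ n2 mu (w s) <= n2 mu G.
Proof.
move=> hs; apply: le_sqintegrable => // x.
by rewrite (ger0_norm (G0 x)); exact: wb.
Qed.

Let intG (f : T -> R) : sqintegrable mu f -> mu.-integrable setT (EFin \o (fun x => `|f x| * G x)).
Proof.
move=> [mf foo]; have sf : sqintegrable mu (fun x => `|f x|).
  split; first exact: measurableT_comp.
  by rewrite /sqint; under eq_integral => x _ do rewrite (real_normK (num_real _)); exact: foo.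
exact: (CauchySchwarz sf sG).1.
Qed.

(** Dominated convergence with the majorant |f| G, integrable by Cauchy-Schwarz. *)
Lemma cvg_pairing_continuous (f : T -> R) : sqintegrable mu f ->
  \int[mu]_x (f x * w s x) @[s --> t] --> \int[mu]_x (f x * w t x).
Proof.
move=> sf.
have c1 s : `]0, T0[%classic s -> mu.-integrable setT (EFin \o (fun x => f x * w s x)).
  by rewrite /= in_itv /= => hs; exact: (CauchySchwarz sf (sw hs).1).1.
have c2 : \forall x \ae mu, setT x -> {in `]0, T0[%classic, continuous (fun s => f x * w s x)}.
  apply/aeW => x _ s; rewrite inE/= in_itv /= => hs.
  apply: (@continuous_comp _ _ _ (fun s => w s x) (fun y => f x * y)).
    by apply: differentiable_continuous; apply/derivable1_diffP; exact: dw.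
  exact: mulrl_continuous.
have c3 s : `]0, T0[%classic s -> \forall x \ae mu, setT x -> `|f x * w s x| <= `|f x| * G x.
  rewrite /= in_itv /= => hs; apply/aeW => x _.
  by rewrite normrM ler_wpM2l// wb.
apply: (continuity_under_integral measurableT c1 c2 (intG sf) c3).
by rewrite inE /= in_itv /= t0 tT.
Qed.

Lemma cvg_pairing_derive (f : T -> R) : sqintegrable mu f ->
  h^-1 *: (\int[mu]_x (f x * w (h + t) x) - \int[mu]_x (f x * w t x)) @[h --> (0:R)^'] -->
    \int[mu]_x (f x * derive1 (w ^~ x) t).
Proof.
move=> sf.
have dfw s x : 0 < s < T0 -> is_derive s (1:R) (fun s => f x * w s x) (f x * derive1 (w ^~ x) s).
  move=> hs; apply: is_deriveZ; rewrite derive1E; apply: derivableP; exact: dw.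
have c0 : `]0, T0[%classic t by rewrite /= in_itv /= t0 tT.
have c1 s : `]0, T0[%classic s -> mu.-integrable setT (EFin \o (fun x => f x * w s x)).
  by rewrite /= in_itv /= => hs; exact: (CauchySchwarz sf (sw hs).1).1.
have c2 s x : `]0, T0[%classic s -> setT x -> derivable (fun s => f x * w s x) s (1 : R).
  by rewrite /= in_itv /= => hs _; have [] := dfw s x hs.
have c3 x : 0 <= `|f x| * G x by rewrite mulr_ge0.
have e s x : 0 < s < T0 -> partial1of2 (fun s x => f x * w s x) s x = f x * derive1 (w ^~ x) s.
  by move=> hs; rewrite partial1of2E; have [_ ->] := dfw s x hs.
have c4 s x : `]0, T0[%classic s -> setT x -> `|partial1of2 (fun s x => f x * w s x) s x| <= `|f x| * G x.
  rewrite /= in_itv /= => hs _; rewrite e//.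
  by rewrite normrM ler_wpM2l// dwb.
have -> : \int[mu]_x (f x * derive1 (w ^~ x) t) =
    \int[mu]_x partial1of2 (fun s x => f x * w s x) t x.
  by apply: eq_Rintegral => x _; rewrite e.
exact: (cvg_differentiation_under_integral measurableT c0 c1 c2 c3 (intG sf) c4).
Qed.

(** Product rule: with D the L^2 error of the difference quotient of P, the quotient of the pairing
    is <D, w> + <P', w> plus the quotient of <P t, w>. The three terms are handled by
    Cauchy-Schwarz, by continuity and by differentiation under the integral. *)
Lemma is_derive_pairing :
  is_derive t (1 : R) (fun s => \int[mu]_x (P s x * w s x))
    (\int[mu]_x (P' x * w t x) + \int[mu]_x (P t x * derive1 (w ^~ x) t)).
Proof.
pose F s := \int[mu]_x (P s x * w s x).
pose D s x := (s - t)^-1 * (P s x - P t x) - P' x.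
have t01 : 0 <= t <= T0 by rewrite (ltW t0) (ltW tT).
have nT : \forall h \near (0:R)^', 0 < h + t < T0.
  near=> h; apply/andP; split.
    rewrite -ltrBlDr sub0r.
    have : `|h| < t by near: h; apply: dnbhs0_lt.
    by rewrite ltr_norml => /andP[].
  rewrite -ltrBrDr.
  have : `|h| < T0 - t by near: h; apply: dnbhs0_lt; rewrite subr_gt0.
  by rewrite ltr_norml => /andP[].
have sD s : 0 <= s <= T0 -> sqintegrable mu (D s).
  move=> hs.
  have s1 := (n2_triangle (sP hs) (n2_ger0_norm (-1) (sP t01)).1).1.
  have s2 := (n2_ger0_norm (s - t)^-1 s1).1.
  have s3 := (n2_triangle s2 (n2_ger0_norm (-1) sP').1).1.
  suff -> : D s = (fun x => (s - t)^-1 * (P s \+ (fun x => -1 * P t x)) x) \+ (fun x => -1 * P' x) by [].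
  by apply/funext => x; rewrite /D /= !mulN1r.
have cA : \int[mu]_x (D (h + t) x * w (h + t) x) @[h --> (0:R)^'] --> (0:R).
  apply/cvgrPdist_le => e e0.
  have e1 : 0 < e / (n2 mu G + 1) by rewrite divr_gt0// ltr_wpDl// n2_ge0.
  move/cvgrPdist_le : cvgP => /(_ _ e1).
  rewrite /within /= => /nbhs_ballP[r /= r0 hr].
  near=> h.
  have hT : 0 < h + t < T0 by near: h.
  have hT' : 0 <= h + t <= T0 by case/andP: hT => a b; rewrite !ltW.
  rewrite sub0r normrN; apply: le_trans (CauchySchwarz (sD _ hT') (sw hT).1).2 _.
  have : n2 mu (D (h + t)) <= e / (n2 mu G + 1).
    have hn0 : h != 0 by near: h; exact: nbhs_dnbhs_neq.
    have := hr (h + t); rewrite sub0r normrN ger0_norm ?n2_ge0//; apply => //=.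
    - rewrite /ball /= opprD addrA addrAC subrr sub0r normrN.
      by near: h; exact: dnbhs0_lt.
    - by rewrite -subr_eq0 addrK.
  move=> hD; apply: (@le_trans _ _ (e / (n2 mu G + 1) * (n2 mu G + 1))).
    apply: ler_pM; rewrite ?n2_ge0//.
    by apply: le_trans (sw hT).2 _; rewrite lerDl.
  by rewrite divfK// gt_eqF// ltr_wpDl// n2_ge0.
have cB : \int[mu]_x (P' x * w (h + t) x) @[h --> (0:R)^'] --> \int[mu]_x (P' x * w t x).
  have h1 : h + t @[h --> (0:R)^'] --> (0:R) + t.
    apply: cvgD; last exact: cvg_cst.
    by apply: cvg_within_filter; exact: cvg_id.
  rewrite add0r in h1.
  exact: (cvg_comp _ _ h1 (cvg_pairing_continuous sP')).
have cC := cvg_pairing_derive (sP t01).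
have c : h^-1 *: (F (h *: (1:R) + t) - F t) @[h --> (0:R)^'] -->
   (\int[mu]_x (P' x * w t x) + \int[mu]_x (P t x * derive1 (w ^~ x) t)).
  have h3 := cvgD (cvgD cA cB) cC; rewrite add0r in h3.
  apply: (cvg_trans _ (h3 _ _)); apply: near_eq_cvg.
  near=> h.
  have hT : 0 < h + t < T0 by near: h.
  have hT' : 0 <= h + t <= T0 by case/andP: hT => a b; rewrite !ltW.
  have hn0 : h != 0 by near: h; exact: nbhs_dnbhs_neq.
  rewrite [h *: 1]mulr1 /F /=.
  have iD := (CauchySchwarz (sD _ hT') (sw hT).1).1.
  have iP' := (CauchySchwarz sP' (sw hT).1).1.
  have iPt := (CauchySchwarz (sP t01) (sw hT).1).1.
  have iPt' := (CauchySchwarz (sP t01) (sw inT).1).1.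
  have -> : \int[mu]_x (P (h + t) x * w (h + t) x) =
     h * (\int[mu]_x (D (h + t) x * w (h + t) x) + \int[mu]_x (P' x * w (h + t) x))
     + \int[mu]_x (P t x * w (h + t) x).
    rewrite -RintegralD// -RintegralZl//; last exact: (integrableD _ iD iP').
    rewrite -RintegralD//; last exact: (integrableZl measurableT h (integrableD measurableT iD iP')).
    apply: eq_Rintegral => x _; rewrite /D addrK.
    by field.
  set A := \int[mu]_x (D (h + t) x * _); set B := \int[mu]_x (P' x * _).
  change (A + B + h^-1 * (\int[mu]_x (P t x * w (h + t) x) - \int[mu]_x (P t x * w t x)) =
    h^-1 * (h * (A + B) + \int[mu]_x (P t x * w (h + t) x) - \int[mu]_x (P t x * w t x))).
  by field.
by apply: DeriveDef; [apply/cvg_ex; eexists; exact: c|exact/cvg_lim].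
Unshelve. all: by end_near. Qed.

End time_dependent_pairing.

Section L2_continuity.
Context {dsp : measure_display} {T : measurableType dsp} {R : realType} (mu : {measure set T -> \bar R}).

Lemma sqintegrableB (f g : T -> R) : sqintegrable mu f -> sqintegrable mu g -> sqintegrable mu (fun x => f x - g x).
Proof.
move=> sf sg; have [] := n2_triangle sf (n2_ger0_norm (-1) sg).1.
suff -> : (f \+ (fun x => -1 * g x)) = (fun x => f x - g x) by [].
by apply/funext => x /=; rewrite mulN1r.
Qed.

Lemma n2_0 : n2 mu (fun=> 0) = 0.
Proof. by rewrite /n2 /sqint; under eq_integral do rewrite expr0n /=; rewrite integral0 sqrtr0. Qed.

(** Differentiability implies continuity, for curves in L^2: P s - P t is s - t times a quotient
    bounded by 1 + |P'| near t. The L^2 continuity of the solution is obtained in this way. *)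
Lemma n2_cvg_of_quotient (A : set R) (P : R -> T -> R) (P' : T -> R) (t : R) :
  A t -> (forall s, A s -> sqintegrable mu (P s)) -> sqintegrable mu P' ->
  n2 mu (fun x => (s - t)^-1 * (P s x - P t x) - P' x) @[s --> within A t^'] --> (0 : R) ->
  n2 mu (fun x => P s x - P t x) @[s --> within A (nbhs t)] --> (0 : R).
Proof.
move=> At sP sP' cP.
move/cvgrPdist_le : cP => /(_ 1 ltr01); rewrite near_withinE near_withinE => /nbhs_ballP[r /= r0 hr].
apply/cvgrPdist_le => e e0; rewrite near_withinE.
have C0 : 0 < 1 + n2 mu P' by rewrite ltr_pwDl// n2_ge0.
near=> s => As; rewrite sub0r normrN ger0_norm ?n2_ge0//.
have [->|st] := eqVneq s t.
  by rewrite (_ : (fun x => _) = fun=> 0) ?n2_0 ?ltW//; apply/funext => x; rewrite subrr.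
have sQ := (n2_ger0_norm (s - t)^-1 (sqintegrableB (sP _ As) (sP _ At))).1.
have sD := sqintegrableB sQ sP'.
have hD : n2 mu (fun x => (s - t)^-1 * (P s x - P t x) - P' x) <= 1.
  have := hr s; rewrite sub0r normrN ger0_norm ?n2_ge0//; apply => //.
  by near: s; exact: nbhsx_ballx.
have st0 : s - t != 0 by rewrite subr_eq0.
have -> : (fun x => P s x - P t x) = (fun x => (s - t) *
    ((fun x => (s - t)^-1 * (P s x - P t x) - P' x) \+ P') x).
  by apply/funext => x /=; rewrite subrK mulrA mulfV// mul1r.
have [sS hS] := n2_triangle sD sP'.
rewrite (n2_ger0_norm (s - t) sS).2.
have h1 : `|s - t| <= e / (1 + n2 mu P').
  near: s; apply/nbhs_ballP; exists (e / (1 + n2 mu P')) => /=; first exact: divr_gt0.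
  by move=> s; rewrite /ball /= distrC => /ltW.
apply: (@le_trans _ _ (e / (1 + n2 mu P') * (1 + n2 mu P'))); last by rewrite divfK// gt_eqF.
apply: ler_pM => //; first exact: n2_ge0.
by apply: (le_trans hS); rewrite lerD2r.
Unshelve. all: by end_near. Qed.

(** Split into <P s - P t, w s>, small by Cauchy-Schwarz, and <P t, w s>, by dominated convergence.
    Limits within A cover the endpoints of a time interval. *)
Lemma pairing_continuous (A : set R) (P : R -> T -> R) (w : R -> T -> R) (K : set T) (M t : R) :
  A t -> (forall s, A s -> sqintegrable mu (P s)) ->
  n2 mu (fun x => P s x - P t x) @[s --> within A (nbhs t)] --> (0 : R) ->
  measurable K -> (mu K < +oo)%E ->
  (forall s, measurable_fun setT (w s)) ->
  (forall s x, `|w s x| <= M * \1_K x) ->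
  (forall x, continuous (w ^~ x)) ->
  \int[mu]_x (P s x * w s x) @[s --> within A (nbhs t)] --> \int[mu]_x (P t x * w t x).
Proof.
move=> At sP cP mK Koo mw wb cw.
pose G x := M * \1_K x.
have sG : sqintegrable mu G by exact: sqintegrable_indic.
have G0 x : 0 <= G x by exact: (le_trans _ (wb t x)).
have sw s : sqintegrable mu (w s) /\ n2 mu (w s) <= n2 mu G.
  by apply: le_sqintegrable => // x; rewrite (ger0_norm (G0 x)).
have c1 : \int[mu]_x (P t x * w s x) @[s --> t] --> \int[mu]_x (P t x * w t x).
  have sPt : sqintegrable mu (fun x => `|P t x|).
    have [mf foo] := sP t At; split; first exact: measurableT_comp.
    by rewrite /sqint; under eq_integral => x _ do rewrite (real_normK (num_real _)); exact: foo.
  have iG := (CauchySchwarz sPt sG).1.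
  have d1 s : `]t-1, t+1[%classic s -> mu.-integrable setT (EFin \o (fun x => P t x * w s x)).
    by move=> _; exact: (CauchySchwarz (sP _ At) (sw s).1).1.
  have d2 : \forall x \ae mu, setT x -> {in `]t-1, t+1[%classic, continuous (fun s => P t x * w s x)}.
    apply/aeW => x _ s _.
    by apply: (@continuous_comp _ _ _ (fun s => w s x) (fun y => P t x * y)) => //; [exact: cw|exact: mulrl_continuous].
  have d3 s : `]t-1, t+1[%classic s -> \forall x \ae mu, setT x -> `|P t x * w s x| <= (fun x => `|P t x| * G x) x.
    by move=> _; apply/aeW => x _; rewrite normrM ler_wpM2l// wb.
  apply: (continuity_under_integral measurableT d1 d2 iG d3).
  by rewrite inE /= in_itv /=; apply/andP; split; lra.
have c2 : \int[mu]_x ((P s x - P t x) * w s x) @[s --> within A (nbhs t)] --> (0:R).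
  apply/cvgrPdist_le => e e0.
  have e1 : 0 < e / (n2 mu G + 1) by rewrite divr_gt0// ltr_wpDl// n2_ge0.
  move/cvgrPdist_le : cP => /(_ _ e1); rewrite near_withinE => hc.
  rewrite near_withinE.
  near=> s => As.
  rewrite sub0r normrN; apply: (le_trans (CauchySchwarz (sqintegrableB (sP _ As) (sP _ At)) (sw s).1).2).
  have : n2 mu (fun x => P s x - P t x) <= e / (n2 mu G + 1).
    have : A s -> `|0 - n2 mu (fun x => P s x - P t x)| <= e / (n2 mu G + 1) by near: s.
    by rewrite sub0r normrN ger0_norm ?n2_ge0//; apply.
  move=> hD; apply: (@le_trans _ _ (e / (n2 mu G + 1) * (n2 mu G + 1))).
    apply: ler_pM; rewrite ?n2_ge0//.
    by apply: (le_trans (sw s).2); rewrite lerDl.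
  by rewrite divfK// gt_eqF// ltr_wpDl// n2_ge0.
have c1' : \int[mu]_x (P t x * w s x) @[s --> within A (nbhs t)] --> \int[mu]_x (P t x * w t x).
  by apply: cvg_within_filter.
have := cvgD c2 c1' => /(_ _ _); rewrite add0r => h.
apply: (cvg_trans _ h); apply: near_eq_cvg.
rewrite near_withinE; near=> s => As.
change (\int[mu]_x ((P s x - P t x) * w s x) + \int[mu]_x (P t x * w s x) = \int[mu]_x (P s x * w s x)).
rewrite -RintegralD//.
- by apply: eq_Rintegral => x _; rewrite mulrBl subrK.
- exact: (CauchySchwarz (sqintegrableB (sP _ As) (sP _ At)) (sw s).1).1.
- exact: (CauchySchwarz (sP _ At) (sw s).1).1.
Unshelve. all: by end_near. Qed.

End L2_continuity.

(** * Riccati system and coefficient norms *)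

Section real_functions.
Context {R : realType}.
Implicit Types (f : R -> R) (a b t s : R).

(** Retraction onto [a, b]. Composing with it freezes a function outside the interval and turns
    continuity within [a, b] into continuity on the line. *)
Definition clamp a b s : R := Num.max a (Num.min s b).

Lemma clamp_itv a b s : a <= b -> a <= clamp a b s <= b.
Proof. by move=> ab; rewrite /clamp le_max lexx ge_max ab ge_min lexx orbT. Qed.

Lemma clamp_id a b s : a <= s <= b -> clamp a b s = s.
Proof. by move=> /andP[sa sb]; rewrite /clamp (min_idPl sb) (max_idPr sa). Qed.

Lemma clamp_dist a b s t : `|clamp a b s - clamp a b t| <= `|s - t|.
Proof.
have : - `|s - t| <= s - t <= `|s - t| by rewrite -ler_norml.
move: (`|s - t| : R) => z /andP[z1 z2].
rewrite /clamp /Num.max /Num.min.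
by case: (ltP s b) => h1; case: (ltP t b) => h2; do 2?case: (ltP a _) => ?;
  rewrite ler_norml; apply/andP; split; lra.
Qed.

Lemma continuous_clamp f a b : a <= b -> {within `[a, b], continuous f} ->
  continuous (fun s => f (clamp a b s)).
Proof.
move=> ab /subspace_continuousP cf t.
have ct : `[a, b]%classic (clamp a b t) by rewrite /= in_itv /= clamp_itv.
have := cf _ ct => /cvgrPdist_lt h.
apply/cvgrPdist_lt => e e0.
move: (h e e0); rewrite near_withinE => /nbhs_ballP[r /= r0 hr].
apply/nbhs_ballP; exists r => //= s hs.
apply: hr; last by rewrite /= in_itv /= clamp_itv.
by apply: le_lt_trans hs; exact: clamp_dist.
Qed.

Lemma is_deriv_in_continuous (I : set R) f t l : is_deriv_in I f t l ->
  f s @[s --> within I (nbhs t)] --> f t.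
Proof.
rewrite /is_deriv_in => hl.
apply/cvgrPdist_le => e e0.
move/cvgrPdist_le : hl => /(_ 1 ltr01); rewrite !near_withinE => /nbhs_ballP[r /= r0 hr].
apply/nbhs_ballP; exists (Num.min r (e / (1 + `|l|))) => /=.
  by rewrite lt_min r0 divr_gt0// ltr_pwDl.
move=> s; rewrite /ball /= lt_min => /andP[sr se] Is.
have [->|st] := eqVneq s t; first by rewrite subrr normr0 ltW.
have := hr s sr st Is => h.
have st0 : 0 < `|s - t| by rewrite normr_gt0 subr_eq0.
have : `|(f s - f t) / (s - t)| <= 1 + `|l|.
  have := ler_normB l (l - (f s - f t) / (s - t)).
  by rewrite opprB addrCA subrr addr0 => h2; lra.
rewrite normrM normfV ler_pdivrMr// distrC => h2.
apply: (le_trans h2); rewrite mulrC -ler_pdivlMr ?ltr_pwDl// distrC.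
exact: ltW.
Qed.

Lemma is_deriv_in_is_derive (a b : R) f t l : a < t < b -> is_deriv_in `[a, b] f t l ->
  is_derive t (1 : R) f l.
Proof.
move=> /andP[at0 tb] hl.
have c : h^-1 *: (f (h *: (1:R) + t) - f t) @[h --> (0:R)^'] --> l.
  apply/cvgrPdist_le => e e0.
  move/cvgrPdist_le : hl => /(_ e e0) hl; rewrite !near_withinE in hl.
  move/nbhs_ballP : hl => [r /= r0 hr].
  near=> h.
  have hn0 : h != 0 by near: h; exact: nbhs_dnbhs_neq.
  have h1 : `|h| < r by near: h; exact: dnbhs0_lt.
  have h2 : `|h| < t - a by near: h; apply: dnbhs0_lt; rewrite subr_gt0.
  have h3 : `|h| < b - t by near: h; apply: dnbhs0_lt; rewrite subr_gt0.
  have := hr (h + t); rewrite addrK [h *: 1]mulr1 [h^-1 *: _]mulrC; apply.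
  - by rewrite /ball /= opprD addrCA subrr addr0 normrN.
  - by rewrite -subr_eq0 addrK.
  - move: h2 h3; rewrite /= in_itv /= !ltr_norml => /andP[? ?] /andP[? ?].
    by apply/andP; split; lra.
by apply: DeriveDef; [apply/cvg_ex; eexists; exact: c|exact/cvg_lim].
Unshelve. all: by end_near. Qed.

(** Continuity argument: up to the first time s0 with |f s0| >= 1 one has |f| <= 1, hence |f'| <= L,
    and the mean value theorem gives |f s0| <= L s0 < 1. *)
Lemma barrier f (f' : R -> R) (tau L : R) : 0 <= tau -> continuous f -> f 0 = 0 ->
  (forall t, 0 < t < tau -> is_derive t (1 : R) f (f' t)) ->
  (forall t, 0 < t < tau -> `|f t| <= 1 -> `|f' t| <= L) -> L * tau < 1 ->
  forall t, 0 <= t <= tau -> `|f t| <= 1.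
Proof.
move=> tau0 cf f0 df bf Lt t1 /andP[t10 t1tau]; rewrite leNgt; apply/negP => ft1.
pose B := [set s : R | `[0, t1]%classic s /\ 1 <= `|f s|].
have cB : compact B.
  apply: (subclosed_compact _ (@segment_compact _ 0 t1)); last by move=> s [].
  have -> : B = `[0, t1]%classic `&` (fun s => `|f s|) @^-1` `[1, +oo[%classic.
    by apply/seteqP; split=> s /=; rewrite !in_itv /= andbT.
  apply: closedI; first exact: itv_closed.
  apply: preimage_closed; last exact: rray_closed.
  by move=> s _; apply: continuous_comp; [exact: cf|exact: norm_continuous].
have B0 : B !=set0 by exists t1; split; [rewrite /= in_itv /= t10 lexx|exact: ltW].
have [|s0 Bs0 hs0] := @compact_EVT_min R R id B B0 cB.
  by apply: continuous_subspaceT => x; exact: cvg_id.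
move: Bs0; rewrite inE /B /= in_itv /= => -[/andP[s00 s0t1] fs0].
have s0p : 0 < s0.
  rewrite lt_neqAle s00 andbT; apply/eqP => e; move: fs0; rewrite -e f0 normr0.
  by rewrite leNgt ltr01.
have small t : 0 < t < s0 -> `|f t| <= 1.
  move=> /andP[ht0 hts]; rewrite leNgt; apply/negP => h.
  have Bt : t \in B.
    rewrite inE; split; last exact: ltW.
    by rewrite /= in_itv /= (ltW ht0) /= (le_trans (ltW hts)).
  by have := hs0 t Bt; rewrite /= leNgt hts.
have dfx x : x \in `]0, s0[%R -> is_derive x (1 : R) f (f' x).
  by rewrite in_itv /= => /andP[? ?]; apply: df; apply/andP; split => //; lra.
have [c] := MVT s0p dfx (continuous_subspaceT cf).
rewrite in_itv /= => /andP[c0 cs0]; rewrite f0 !subr0 => e.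
move: fs0; rewrite e normrM (gtr0_norm s0p) leNgt => /negP; apply.
have c0tau : 0 < c < tau by rewrite c0; lra.
have L1 : `|f' c| <= L by apply: bf => //; apply: small; rewrite c0.
have L0 : 0 <= L by exact: le_trans L1.
nra.
Qed.

End real_functions.

(** * Pointwise bounds from the coefficient norms, and the Riccati functions for short times *)

Section coefficient_norms.
Context {R : realType}.
Implicit Types (f : R -> R) (T t s : R).

Lemma sup_norm_ge0 (A : set R) f : 0 <= sup [set `|f t| | t in A].
Proof.
(* A set without a finite supremum has [sup] equal to 0. *)
have [[[x Ax] ub]|h] := pselect (has_sup [set `|f t| | t in A]); last by rewrite sup_out.
by apply: (le_trans _ (ub_le_sup ub Ax)); case: Ax => t _ <-.
Qed.

Lemma le_C1_norm T f t : {within `[0, T], continuous f} -> 0 <= t <= T -> `|f t| <= C1_norm T f.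
Proof.
move=> cf /andP[t0 tT].
have T0 : 0 <= T by exact: le_trans tT.
rewrite /C1_norm; apply: le_trans (_ : _ <= sup [set `|f t| | t in `[0, T]]) _; last first.
  by rewrite lerDl sup_norm_ge0.
have cn : {within `[0, T], continuous (fun s => `|f s|)}.
  move=> x; apply: continuous_comp; first exact: cf.
  exact: norm_continuous.
have [c _ hc] := EVT_max T0 cn.
apply: ub_le_sup; last by exists t => //; rewrite /= in_itv /= t0.
by exists `|f c| => _ [s hs <-]; apply: hc.
Qed.

Lemma within_cc_cy f T : {within `[0, +oo[, continuous f} -> {within `[0, T], continuous f}.
Proof.
apply: continuous_subspaceW => s /=; rewrite !in_itv /= => /andP[-> _] //.
Qed.

(** If f t exceeded the essential supremum, continuity would make f exceed it on an interval of
    positive length, which cannot lie in a null set. *)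
Lemma le_Linfty_norm T f t : {within `[0, T], continuous f} -> 0 < T -> 0 <= t <= T ->
  f t <= Linfty_norm T f.
Proof.
move=> cf T0 tT.
have cn : {within `[0, T], continuous (fun s => `|f s|)}.
  move=> x; apply: continuous_comp; first exact: cf.
  exact: norm_continuous.
have [c _ hc] := EVT_max (ltW T0) cn.
(* The infinity norm is an essential supremum only under positive total mass. *)
have muT : (0 < @lebesgue_measure R setT)%E.
  apply: (@lt_le_trans _ _ (@lebesgue_measure R `[0, 1]%classic)).
    by rewrite lebesgue_measure_itv /= lte_fin ltr01 -EFinB subr0 lte_fin.
  by apply: le_measure; rewrite ?inE.
rewrite /Linfty_norm unlock muT.
set g := (abse \o (EFin \o (f \_ `[0, T]))).
have g0 x : (0 <= g x)%E by exact: abse_ge0.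
have gub x : (g x <= `|f c|%:E)%E.
  rewrite /g /= patchE; case: ifPn => [|_]; last by rewrite normr0 lee_fin.
  by rewrite inE lee_fin => h; apply: hc.
have e1 : (ess_sup lebesgue_measure g <= `|f c|%:E)%E.
  by apply/ess_supP; apply/aeW => x; exact: gub.
have e0 : (0 <= ess_sup lebesgue_measure g)%E by apply: ess_sup_gee => //; apply/aeW.
have efin : ess_sup lebesgue_measure g \is a fin_num.
  by rewrite ge0_fin_numE//; apply: le_lt_trans e1 _; rewrite ltry.
rewrite leNgt; apply/negP => hlt.
set L := fine _ in hlt.
have ct : f s @[s --> within `[0, T]%classic (nbhs t)] --> f t.
  by move/subspace_continuousP : cf => /(_ t); apply; rewrite /= in_itv.
move/cvgr_gt : ct => /(_ _ hlt); rewrite near_withinE => /nbhs_ballP[r /= r0 hr].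
have [N [mN N0 sN]] := ess_sup_ge lebesgue_measure g.
(* An interval around t cut at 0 and T; as T > 0 it is nondegenerate even when t is an endpoint. *)
pose a := Num.max 0 (t - r / 2); pose b := Num.min T (t + r / 2).
have ab : a < b.
  move/andP : tT => [t0 tT].
  by rewrite /a /b lt_min !gt_max; apply/andP; split; apply/andP; split; lra.
have IN : `[a, b]%classic `<=` N.
  move=> s /=; rewrite in_itv /= /a /b ge_max le_min => /andP[/andP[s0 s1] /andP[s2 s3]].
  apply: sN => /=; apply/negP; rewrite -ltNge.
  have sT : `[0, T]%classic s by rewrite /= in_itv /= s0.
  rewrite /g /= patchE mem_set// -(fineK efin) lte_fin.
  have hf : L < f s.
    apply: hr => //; rewrite /ball /= ltr_norml; apply/andP; split; lra.
  by apply: (lt_le_trans hf); exact: ler_norm.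
have : (lebesgue_measure `[a, b]%classic <= lebesgue_measure N)%E by apply: le_measure; rewrite ?inE.
by rewrite N0 lebesgue_measure_itv /= lte_fin ab -EFinB lee_fin subr_le0 leNgt ab.
Qed.

(** While |y1| <= 1 its derivative is at most 4 K1 + K2, and while |y2 - 1| <= 1/2 that of 2 (y2 -
    1) is at most 12 K1; the two smallness conditions on tau are those of [barrier]. [Y1] and [Y2]
    are y1 and y2 frozen outside [0, tau], so that the bounds hold at all times. *)
Lemma riccati_bounds (k1 k2 : R -> R) T (y1 y2 y3 : R -> R) (tau K1 K2 : R) :
  admissible_coefficients k1 k2 -> riccati_system T k1 k2 y1 y2 y3 ->
  0 < tau -> tau <= T ->
  (forall t, 0 <= t <= T -> 0 <= k1 t <= K1) -> (forall t, 0 <= t <= T -> 0 <= k2 t <= K2) ->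
  (4 * K1 + K2) * tau < 1 -> 12 * K1 * tau < 1 ->
  exists Y1 Y2 : R -> R,
    [/\ continuous Y1, continuous Y2, Y1 0 = 0 /\ Y2 0 = 1,
        (forall s, `|Y1 s| <= 1 /\ 2^-1 <= Y2 s <= 3 / 2) &
        forall t, 0 < t < tau ->
          is_derive t (1 : R) Y1 (- 4 * k1 t * Y1 t ^+ 2 - k2 t) /\
          is_derive t (1 : R) Y2 (- 4 * k1 t * Y1 t * Y2 t)].
Proof.
move=> adm [ric [y10 y20 _]] tau0 tauT hk1 hk2 htau1 htau2.
pose Y1 s := y1 (clamp 0 tau s); pose Y2 s := y2 (clamp 0 tau s).
have tau0' := ltW tau0.
have T0 : 0 < T by exact: lt_le_trans tauT.
have cy (y : R -> R) : (forall t, 0 <= t <= T -> exists l, is_deriv_in `[0, T] y t l) ->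
    continuous (fun s => y (clamp 0 tau s)).
  move=> hy; apply: continuous_clamp => //.
  have : {within `[0, T], continuous y}.
    apply/subspace_continuousP => t; rewrite /= in_itv /= => ht.
    have [l hl] := hy t ht; exact: is_deriv_in_continuous hl.
  by apply: continuous_subspaceW => s /=; rewrite !in_itv /= => /andP[-> h]; exact: le_trans tauT.
have cY1 : continuous Y1 by apply: cy => t ht; have [h _ _] := ric t ht; eexists; exact: h.
have cY2 : continuous Y2 by apply: cy => t ht; have [_ h _] := ric t ht; eexists; exact: h.
have YE t : 0 < t < tau -> \forall s \near t, clamp 0 tau s = s.
  move=> /andP[t0 tt]; near=> s; apply: clamp_id; apply/andP; split; apply/ltW.
    by near: s; exact: lt_nbhsr.
  by near: s; exact: lt_nbhsl.
have dY (y : R -> R) t l : 0 < t < tau -> is_deriv_in `[0, T] y t l ->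
    is_derive t (1 : R) (fun s => y (clamp 0 tau s)) l.
  move=> ht hy; have ht' : 0 < t < T by case/andP: ht => a b; rewrite a (lt_le_trans b).
  apply: near_eq_is_derive (is_deriv_in_is_derive ht' hy).
  by near=> s; congr y; apply/esym; near: s; exact: YE.
have cl t : 0 < t < tau -> clamp 0 tau t = t.
  by move=> /andP[a b]; apply: clamp_id; rewrite !ltW.
have le0T t : 0 < t < tau -> 0 <= t <= T by case/andP => a b; rewrite ltW//= (le_trans (ltW b)).
have d1 t : 0 < t < tau -> is_derive t (1 : R) Y1 (- 4 * k1 t * Y1 t ^+ 2 - k2 t).
  move=> ht; have [h _ _] := ric t (le0T t ht).
  by have := dY _ _ _ ht h; rewrite /Y1 cl.
have d2 t : 0 < t < tau -> is_derive t (1 : R) Y2 (- 4 * k1 t * Y1 t * Y2 t).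
  move=> ht; have [_ h _] := ric t (le0T t ht).
  by have := dY _ _ _ ht h; rewrite /Y2 /Y1 cl.
have c0 : clamp 0 tau 0 = 0 by apply: clamp_id; rewrite lexx.
have Y10 : Y1 0 = 0 by rewrite /Y1 c0.
have Y20 : Y2 0 = 1 by rewrite /Y2 c0.
have b1 t : 0 <= t <= tau -> `|Y1 t| <= 1.
  apply: (barrier tau0' cY1 Y10 d1 _ htau1) => {}t ht h.
  have /andP[k10 k1K] := hk1 t (le0T t ht); have /andP[k20 k2K] := hk2 t (le0T t ht).
  have y2' : Y1 t ^+ 2 <= 1 by rewrite -(real_normK (num_real (Y1 t))) expr_le1.
  have y20' := sqr_ge0 (Y1 t).
  by rewrite ler_norml; apply/andP; split; nra.
have b1' s : `|Y1 s| <= 1.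
  have := b1 (clamp 0 tau s) (clamp_itv s tau0'); rewrite /Y1 clamp_id//; exact: clamp_itv.
(* The rescaling turns |Y2 - 1| <= 1/2 into the unit threshold of [barrier]. *)
pose Z s := 2 * (Y2 s - 1).
have cZ : continuous Z.
  by move=> s; apply: cvgM; [exact: cvg_cst|apply: cvgB; [exact: cY2|exact: cvg_cst]].
have dZ t : 0 < t < tau -> is_derive t (1 : R) Z (2 * (- 4 * k1 t * Y1 t * Y2 t)).
  move=> ht; have h2 := d2 t ht.
  have := is_deriveZ (2:R) (is_deriveB h2 (is_derive_cst (1:R) t (1:R))).
  by rewrite subr0.
have bZ t : 0 <= t <= tau -> `|Z t| <= 1.
  apply: (barrier tau0' cZ _ dZ _ htau2); first by rewrite /Z Y20 subrr mulr0.
  move=> {}t ht; rewrite /Z ler_norml => /andP[z1 z2].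
  have /andP[k10 k1K] := hk1 t (le0T t ht).
  rewrite !normrM normrN (ger0_norm (ler0n _ 2)) (ger0_norm (ler0n _ 4)) (ger0_norm k10).
  have := b1' t; have : `|Y2 t| <= 3 / 2 by rewrite ler_norml; apply/andP; split; lra.
  have := normr_ge0 (Y2 t); have := normr_ge0 (Y1 t).
  move: (`|Y2 t| : R) (`|Y1 t| : R) => p q q0 p0 pb qb.
  have : q * p <= 3 / 2 by nra.
  have : 0 <= q * p by nra.
  move=> qp0 qp1; have : k1 t * (q * p) <= K1 * (3 / 2) by apply: ler_pM.
  by move=> h; lra.
exists Y1, Y2; split => //; last by move=> t ht; split; [exact: d1|exact: d2].
move=> s; split; first exact: b1'.
have := bZ (clamp 0 tau s) (clamp_itv s tau0'); rewrite /Z /Y2 clamp_id; last exact: clamp_itv.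
by rewrite ler_norml => /andP[? ?]; apply/andP; split; lra.
Unshelve. all: by end_near. Qed.

End coefficient_norms.

(** * Wave packets *)

Arguments superpose {R d I} c z g x.
Section profile.
Context {R : realType} {d : nat}.
Implicit Types (x z : 'rV[R]_d) (i : 'I_d).

Definition psi : 'rV[R]_d -> R := tens (fun=> bump).

Lemma smooth_psi n : smooth n psi.
Proof. by apply: smooth_tens => j; exact: smooth1_bump. Qed.

Lemma partial_psi i : partial i psi = tens (upd (fun=> bump) i (derive1 bump)).
Proof. by apply/funext => x; rewrite partial_tens// => j; exact: smooth1_bump. Qed.

Lemma smooth1_upd n i (g : R -> R) j : smooth1 n g -> smooth1 n (upd (fun=> bump) i g j).
Proof. by move=> sg; rewrite /upd; case: eqP => // _; exact: smooth1_bump. Qed.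

Lemma partial2_psi i : partial i (partial i psi) =
  tens (upd (fun=> bump) i (derive1 (derive1 bump))).
Proof.
have s1 n : smooth1 n (derive1 (@bump R)) by apply: smooth1_derive; exact: smooth1_bump.
rewrite partial_psi; apply/funext => x; rewrite partial_tens; last by move=> j; exact: smooth1_upd.
congr (tens _ x); apply/funext => j; rewrite /upd eqxx.
by case: eqP.
Qed.

(** On the unit cube [kap_near] with r = 1 gives 1 <= 4^d kap, so a product bounded by M^d and
    supported there is dominated by [kap]. *)
Lemma tens_supp_bounded (h : 'I_d -> R -> R) (M : R) : 0 <= M ->
  (forall j s, 1 < `|s| -> h j s = 0) -> (forall j s, `|h j s| <= M) ->
  forall x, (tens h x != 0 -> cube 1 x) /\ `|tens h x| <= (4 * M) ^+ d * kap x.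
Proof.
move=> M0 h0 hM x.
have supp : tens h x != 0 -> cube 1 x.
  move=> /prodf_neq0 hx i; rewrite leNgt; apply/negP => xi.
  by have := hx i isT; rewrite h0 ?eqxx.
split => //.
have [->|/supp hx] := eqVneq (tens h x) 0.
  by rewrite normr0 mulr_ge0 ?kap_ge0// exprn_ge0// mulr_ge0.
have hM' : `|tens h x| <= M ^+ d.
  rewrite /tens normr_prod; have -> : M ^+ d = \prod_(i < d) M by rewrite prodr_const card_ord.
  by apply: ler_prod => i _; rewrite normr_ge0 hM.
apply: (le_trans hM'); rewrite exprMn mulrAC mulrC ler_peMr ?exprn_ge0//.
have k1 : kap (0 : 'rV[R]_d) = 1.
  by rewrite /kap big1 // => i _; rewrite mxE /oneDsqr expr0n addr0 invr1.
rewrite -[leLHS]k1.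
have := @kap_near R d 1 0 x; rewrite expr1n (_ : 2 * (1 + 1) = 4 :> R); last by ring.
by apply => i; rewrite mxE sub0r normrN; exact: hx.
Qed.

Lemma psi_bounds : exists2 C : R, 0 < C &
  (forall x, `|psi x| <= C * kap x) /\
  (forall i x, `|partial i psi x| <= C * kap x /\ `|partial i (partial i psi) x| <= C * kap x) /\
  (forall i x, ~ cube 1 x -> psi x = 0 /\ partial i psi x = 0 /\ partial i (partial i psi) x = 0).
Proof.
have [M M0 hM] := @bump_derivatives_bounded R.
have z0 (s : R) : 1 < `|s| -> bump s = 0 by move=> /ltW; exact: bump_eq0.
have z1 := derive1_supp _ z0.
have z2 := derive1_supp _ z1.
exists ((4 * M) ^+ d); first by rewrite exprn_gt0// mulr_gt0.
have t0 := @tens_supp_bounded (fun=> bump) M (ltW M0) (fun=> z0) (fun _ s => let: And3 a _ _ := hM s in a).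
have t1 i : forall x, (tens (upd (fun=> bump) i (derive1 bump)) x != 0 -> cube 1 x) /\
    `|tens (upd (fun=> bump) i (derive1 bump)) x| <= (4 * M) ^+ d * kap x.
  apply: tens_supp_bounded; first exact: ltW.
  - by move=> j s hs; rewrite /upd; case: eqP => _; [exact: z1|exact: z0].
  - by move=> j s; rewrite /upd; case: eqP => _; have [] := hM s.
have t2 i : forall x, (tens (upd (fun=> bump) i (derive1 (derive1 bump))) x != 0 -> cube 1 x) /\
    `|tens (upd (fun=> bump) i (derive1 (derive1 bump))) x| <= (4 * M) ^+ d * kap x.
  apply: tens_supp_bounded; first exact: ltW.
  - by move=> j s hs; rewrite /upd; case: eqP => _; [exact: z2|exact: z0].
  - by move=> j s; rewrite /upd; case: eqP => _; have [] := hM s.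
split; first by move=> x; exact: (t0 x).2.
split; first by move=> i x; rewrite partial2_psi partial_psi; split; [exact: (t1 i x).2|exact: (t2 i x).2].
move=> i x hx; rewrite partial2_psi partial_psi; split; [|split].
- by apply/eqP; apply/negPn/negP => /(t0 x).1.
- by apply/eqP; apply/negPn/negP => /(t1 i x).1.
- by apply/eqP; apply/negPn/negP => /(t2 i x).1.
Qed.

Lemma psi_ge_box x : expR (- (3 / 4)^-1) ^+ d * box x <= psi x.
Proof.
rewrite /box indicE; case: (boolP (x \in _)) => [/set_mem hx|_]; last first.
  by rewrite mulr0 /psi /tens; apply: prodr_ge0 => i _; exact: bump_ge0.
rewrite mulr1 (_ : _ ^+ d = \prod_(i < d) expR (- (3 / 4)^-1)); last by rewrite prodr_const card_ord.
by apply: ler_prod => i _; rewrite expR_ge0 /=; apply: bump_ge; exact: hx.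
Qed.

Lemma measurable_psi i : measurable_fun setT psi /\ measurable_fun setT (partial i psi) /\
  measurable_fun setT (partial i (partial i psi)).
Proof.
have s1 n : smooth1 n (derive1 (@bump R)) by apply: smooth1_derive; exact: smooth1_bump.
have s2 n : smooth1 n (derive1 (derive1 (@bump R))) by apply: smooth1_derive; exact: s1.
rewrite partial2_psi partial_psi; split; [|split]; apply: measurable_tens => j.
- exact: (smooth1_continuous 0 _ (smooth1_bump 0)).
- by apply: (smooth1_continuous 0); exact: smooth1_upd.
- by apply: (smooth1_continuous 0); exact: smooth1_upd.
Qed.

Section superposition_smooth.
Variables (I : finType) (c : I -> R) (z : I -> 'rV[R]_d).

Lemma smooth_superpose n (g : 'rV[R]_d -> R) : smooth n g -> smooth n (superpose c z g).
Proof.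
move=> sg; apply: smooth_sum => j; apply: smoothZ.
under eq_fun do rewrite -[X in X - _]scale1r.
exact: smooth_affine.
Qed.

Lemma partial_superpose i (g : 'rV[R]_d -> R) : smooth 0 g ->
  partial i (superpose c z g) = superpose c z (partial i g).
Proof.
move=> sg; apply/funext => x; rewrite /superpose.
have sgn j : smooth 0 (fun x => g (x - z j)).
  by under eq_fun do rewrite -[X in X - _]scale1r; exact: smooth_affine.
rewrite (@partial_sum R d i I (index_enum I) xpredT (fun j x => c j * g (x - z j))); last first.
  by move=> j; exact: smoothZ.
apply: eq_bigr => j _; rewrite partialZ; last by have [] := sgn j.
congr (_ * _).
under eq_fun do rewrite -[X in X - _]scale1r.
rewrite (partial_affine i 1 (- z j) g x); last by have [] := sg.
by rewrite mul1r scale1r.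
Qed.

End superposition_smooth.

(** The square of [enorm], written as a polynomial, so that its smoothness involves no square
    root. *)
Definition qf x : R := \sum_(i < d) x ord0 i ^+ 2.

Lemma smooth_qf n : smooth n qf.
Proof.
apply: smooth_sum => j; under eq_fun do rewrite expr2.
by apply: (smoothM n (fun x : 'rV[R]_d => x ord0 j)); exact: smooth_coord.
Qed.

Lemma partial_qf i x : partial i qf x = 2 * x ord0 i.
Proof.
rewrite (@partial_sum R d i 'I_d (index_enum _) xpredT (fun j x => x ord0 j ^+ 2)); last first.
  move=> j; under eq_fun do rewrite expr2.
  by apply: (smoothM 0 (fun x : 'rV[R]_d => x ord0 j)); exact: smooth_coord.
have pj j : partial i (fun x : 'rV[R]_d => x ord0 j ^+ 2) x = 2 * x ord0 j * (j == i)%:R.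
  under eq_fun do rewrite expr2.
  rewrite (partialM i (fun x : 'rV[R]_d => x ord0 j) (fun x : 'rV[R]_d => x ord0 j));
    [|exact: differentiable_coord..].
  by rewrite partial_coord -mulrDl mulr_natl mulr2n.
rewrite (bigD1 i)//= pj eqxx mulr1 big1 ?addr0// => j /negbTE ji.
by rewrite pj ji mulr0.
Qed.

Lemma measurable_qf : measurable_fun setT qf.
Proof.
by apply: measurable_sum => j; apply: measurable_funX; exact: measurable_coord.
Qed.

Section phased.
Variables (W : 'rV[R]_d -> R) (sW : forall n, smooth n W).

(** With h = cos and h = sin, the real and imaginary parts of exp (i al |x|^2) W (be x). All
    differentiation is thus done on real-valued functions. *)
Definition phased (h : R -> R) (al be : R) x : R := h (al * qf x) * W (be *: x).

Let smooth_scaleW n be f : smooth n f -> smooth n (fun x => f (be *: x)).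
Proof.
move=> sf; under eq_fun do rewrite -[X in f X]addr0.
exact: smooth_affine.
Qed.

Let smooth_phase n h al : smooth1 n h -> smooth n (fun x => h (al * qf x)).
Proof.
move=> sh; apply: (smooth_comp n h) => //; apply: smoothZ; exact: smooth_qf.
Qed.

Lemma smooth_phased n h al be : smooth1 n h -> smooth n (phased h al be).
Proof.
by move=> sh; apply: smoothM; [exact: smooth_phase|exact: smooth_scaleW].
Qed.

Let partial_phase i h al x : smooth1 0 h ->
  partial i (fun x => h (al * qf x)) x = derive1 h (al * qf x) * (2 * al * x ord0 i).
Proof.
move=> sh; rewrite (partial_comp i h (fun x => al * qf x)).
- rewrite partialZ ?partial_qf; last by have [] := smooth_qf 0.
  by ring.
- exact: smooth1_derivable sh.
- by have [] := smoothZ al (smooth_qf 0).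
Qed.

Let partial_scaleW i be f x : smooth 0 f ->
  partial i (fun x => f (be *: x)) x = be * partial i f (be *: x).
Proof.
move=> sf; under eq_fun do rewrite -[X in f X]addr0.
rewrite (partial_affine i be 0 f x) ?addr0//.
by have [] := sf.
Qed.

Lemma partial_phased i h al be x : smooth1 0 h ->
  partial i (phased h al be) x =
  derive1 h (al * qf x) * (2 * al * x ord0 i) * W (be *: x)
  + be * h (al * qf x) * partial i W (be *: x).
Proof.
move=> sh.
rewrite (partialM i (fun x => h (al * qf x)) (fun x => W (be *: x))).
- rewrite partial_phase// partial_scaleW; last exact: sW.
  by ring.
- by have [] := smooth_phase al sh.
- by have [] := smooth_scaleW be (sW 0).
Qed.

Lemma partial2_phased i h al be x : smooth1 1 h ->
  partial i (partial i (phased h al be)) x =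
  4 * al ^+ 2 * x ord0 i ^+ 2 * derive1 (derive1 h) (al * qf x) * W (be *: x)
  + 2 * al * derive1 h (al * qf x) * W (be *: x)
  + 4 * al * be * derive1 h (al * qf x) * (x ord0 i * partial i W (be *: x))
  + be ^+ 2 * h (al * qf x) * partial i (partial i W) (be *: x).
Proof.
move=> sh; have sh0 := smooth1_low _ _ sh; have sh1 := smooth1_derive _ _ sh.
have sW1 n : smooth n (partial i W) by have [_] := sW n.+1; apply.
pose A x := derive1 h (al * qf x) * (2 * al * x ord0 i).
have -> : partial i (phased h al be) =
   (A \* (fun x => W (be *: x))) \+ ((fun x => be * h (al * qf x)) \* (fun x => partial i W (be *: x))).
  by apply/funext => y; rewrite partial_phased.
have sA : smooth 0 A.
  apply: (smoothM 0 (fun x => derive1 h (al * qf x))); first exact: smooth_phase.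
  by apply: smoothZ; exact: smooth_coord.
have dA : differentiable A x by have [] := sA.
have dW : differentiable (fun x => W (be *: x)) x by have [] := smooth_scaleW be (sW 0).
have dW1 : differentiable (fun x => partial i W (be *: x)) x by have [] := smooth_scaleW be (sW1 0).
have dh : differentiable (fun x => be * h (al * qf x)) x by have [] := smoothZ be (smooth_phase al sh0).
have pA : partial i A x = derive1 (derive1 h) (al * qf x) * (2 * al * x ord0 i) * (2 * al * x ord0 i)
   + derive1 h (al * qf x) * (2 * al).
  rewrite (partialM i (fun x => derive1 h (al * qf x)) (fun x => 2 * al * x ord0 i)).
  - rewrite partial_phase// partialZ ?partial_coord ?eqxx; last exact: differentiable_coord.
    rewrite (_ : true%:R = 1 :> R)//; ring.
  - by have [] := smooth_phase al sh1.
  - by have [] := smoothZ (2 * al) (smooth_coord 0 i).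
rewrite partialD; [|exact: differentiableM|exact: differentiableM].
rewrite (partialM i A (fun x => W (be *: x)) x dA dW) pA.
rewrite (partialM i (fun x => be * h (al * qf x)) (fun x => partial i W (be *: x)) x dh dW1).
rewrite (partial_scaleW i be x (sW 0)) (partial_scaleW i be x (sW1 0)).
rewrite partialZ; last by have [] := smooth_phase al sh0.
rewrite partial_phase// /A; ring.
Qed.

Lemma laplacian_phased h al be x : smooth1 1 h ->
  \sum_i partial i (partial i (phased h al be)) x =
  4 * al ^+ 2 * qf x * derive1 (derive1 h) (al * qf x) * W (be *: x)
  + d%:R * (2 * al * derive1 h (al * qf x) * W (be *: x))
  + 4 * al * be * derive1 h (al * qf x) * (\sum_i x ord0 i * partial i W (be *: x))
  + be ^+ 2 * h (al * qf x) * (\sum_i partial i (partial i W) (be *: x)).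
Proof.
move=> sh; transitivity (\sum_i (4 * al ^+ 2 * x ord0 i ^+ 2 * derive1 (derive1 h) (al * qf x) * W (be *: x)
    + 2 * al * derive1 h (al * qf x) * W (be *: x)
    + 4 * al * be * derive1 h (al * qf x) * (x ord0 i * partial i W (be *: x))
    + be ^+ 2 * h (al * qf x) * partial i (partial i W) (be *: x))).
  by apply: eq_bigr => i _; exact: partial2_phased.
rewrite !big_split /= -!mulr_sumr sumr_const card_ord mulr_natl.
congr (_ + _ + _ + _).
by rewrite -!mulr_suml -mulr_sumr.
by rewrite -mulr_natl; ring.
Qed.

(** The chain rule along the ray b -> b x produces the radial term x . grad f, the one that the
    equation of y2 is to cancel. *)
Lemma derive_ray f be x : smooth 0 f ->
  is_derive be (1 : R) (fun b => f (b *: x)) (\sum_i x ord0 i * partial i f (be *: x)).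
Proof.
move=> sf; have df y : differentiable f y by have [] := sf.
have dl : differentiable (fun b : R => b *: x) be by exact: differentiableZl.
have dfl : differentiable (fun b : R => f (b *: x)) be.
  exact: (@differentiable_comp _ _ _ _ (fun b : R => b *: x) f).
apply: DeriveDef; first exact: diff_derivable.
rewrite deriveE//.
rewrite (_ : (fun b : R => f (b *: x)) = f \o (fun b : R => b *: x))// diff_comp//=.
have -> : 'd (fun b : R => b *: x) be (1 : R) = x.
  by rewrite diff_val scale1r.
have -> : 'd f (be *: x) x = 'd f (be *: x) (\sum_i x ord0 i *: delta_mx ord0 i).
  by rewrite -row_sum_delta.
rewrite linear_sum /=.
by apply: eq_bigr => i _; rewrite linearZ /= /partial deriveE.
Qed.

Lemma is_derive_phased_time h (Y1 Y2 : R -> R) (dY1 dY2 t : R) x : smooth1 0 h ->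
  is_derive t (1 : R) Y1 dY1 -> is_derive t (1 : R) Y2 dY2 ->
  is_derive t (1 : R) (fun s => phased h (Y1 s) (Y2 s) x)
    (derive1 h (Y1 t * qf x) * (dY1 * qf x) * W (Y2 t *: x)
     + h (Y1 t * qf x) * (dY2 * \sum_i x ord0 i * partial i W (Y2 t *: x))).
Proof.
move=> sh h1 h2.
have dh s : is_derive s (1 : R) h (derive1 h s).
  by rewrite derive1E; apply: derivableP; exact: smooth1_derivable sh.
have d1 : is_derive t (1 : R) (fun s => Y1 s * qf x) (dY1 * qf x).
  have := is_deriveM h1 (is_derive_cst (qf x) t (1 : R)).
  by rewrite scaler0 add0r [_ *: _]mulrC.
have d2 := @is_derive1_comp R h (fun s => Y1 s * qf x) t _ _ (dh (Y1 t * qf x)) d1.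
have d3 := @is_derive1_comp R (fun b => W (b *: x)) Y2 t _ _ (derive_ray (Y2 t) x (sW 0)) h2.
have d4 := is_deriveM d2 d3.
apply: (is_derive_eq d4); rewrite /= /GRing.scale /=; ring.
Qed.

End phased.

End profile.

(** * Compactly supported profiles and the weak form of the equation *)

Section compactly_supported.
Context {R : realType} {d : nat}.
Implicit Types (x : 'rV[R]_d) (i : 'I_d) (phi : 'rV[R]_d -> R) (rho : R).

Definition supported_in rho phi := forall x, ~ cube rho x -> phi x = 0.

Lemma partial_supported rho phi i : supported_in rho phi -> supported_in rho (partial i phi).
Proof.
move=> s0 x hx; rewrite /partial.
rewrite -(near_eq_derive (f := cst (0:R))) ?derive_cst//.
have oC : open (~` cube rho : set 'rV[R]_d) by rewrite openC; exact: closed_cube.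
by apply: filterS (open_nbhs_nbhs (conj oC hx)) => y hy; rewrite s0.
Qed.

Lemma supported_bounded rho phi : smooth 0 phi -> supported_in rho phi ->
  exists2 M, 0 <= M & forall x, `|phi x| <= M * \1_(cube rho) x.
Proof.
move=> [dphi _] s0.
have [C0|C0] := pselect (@cube R d rho !=set0); last first.
  by exists 0 => // x; rewrite mul0r s0 ?normr0// => hx; apply: C0; exists x.
have cn : {within cube rho, continuous (fun x => `|phi x|)}.
  apply: continuous_subspaceT => x; apply: continuous_comp; last exact: norm_continuous.
  exact: differentiable_continuous.
have [c _ hc] := EVT_max_rV C0 (@compact_cube R d rho) cn.
exists `|phi c| => // x; rewrite indicE.
case: (boolP (x \in _)) => [hx|/negP hx]; first by rewrite mulr1; exact: hc.
by rewrite mulr0 s0 ?normr0// => h; apply: hx; rewrite inE.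
Qed.

Lemma supported_sqintegrable rho phi : smooth 0 phi -> supported_in rho phi ->
  measurable_fun setT phi -> sqintegrable (leb d) phi.
Proof.
move=> sphi s0 mphi; have [M M0 hM] := supported_bounded sphi s0.
have sG := sqintegrable_indic M (@measurable_cube R d rho) (leb_cube_lty R d rho).
apply: (le_sqintegrable mphi sG _).1 => x.
by apply: (le_trans (hM x)); exact: ler_norm.
Qed.

Lemma qf_enorm x : enorm x ^+ 2 = qf x.
Proof. by rewrite /enorm sqr_sqrtr// sumr_ge0// => i _; exact: sqr_ge0. Qed.

Definition lap phi x : R := \sum_i partial i (partial i phi) x.

(** Measurability refers to the product sigma-algebra of row vectors and is carried along as a
    separate clause beside smoothness. *)
Definition test_profile rho phi := [/\ forall n, smooth n phi, supported_in rho phi,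
  measurable_fun setT phi & forall i, measurable_fun setT (partial i (partial i phi))].

Lemma test_profile_sqintegrable rho phi : test_profile rho phi ->
  [/\ sqintegrable (leb d) phi, forall i, sqintegrable (leb d) (partial i (partial i phi)),
      sqintegrable (leb d) (lap phi) & sqintegrable (leb d) (fun x => qf x * phi x)].
Proof.
move=> [sphi s0 mphi mp].
have sp i n : smooth n (partial i phi) by have [_] := sphi n.+1; apply.
have spp i n : smooth n (partial i (partial i phi)) by have [_] := sp i n.+1; apply.
split.
- exact: supported_sqintegrable s0 mphi.
- by move=> i; apply: supported_sqintegrable (mp i) => //; do 2!apply: partial_supported; exact: s0.
- apply: (@supported_sqintegrable rho).
  + by apply: smooth_sum => i.
  + by move=> x hx; rewrite /lap big1// => i _; exact: (partial_supported i (partial_supported i s0) hx).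
  + exact: measurable_sum.
- apply: (@supported_sqintegrable rho).
  + by apply: (smoothM 0 qf) => //; exact: smooth_qf.
  + by move=> x hx; rewrite s0// mulr0.
  + by apply: measurable_funM => //; exact: measurable_qf.
Qed.

Lemma test_profile_test_function rho phi : test_profile rho phi -> test_function phi.
Proof.
move=> [sphi s0 _ _]; apply: (@smooth_test_function R d phi rho) => // x px.
by apply: contrapT => /s0 h; rewrite h eqxx in px.
Qed.

Lemma laplacian_duality rho (u : 'rV[R]_d -> R[i]) phi : inB u -> test_profile rho phi ->
  [/\ sqintegrable (leb d) (fun x => complex.Re (laplacian u x)),
      sqintegrable (leb d) (fun x => complex.Im (laplacian u x)),
      \int[leb d]_x (complex.Re (laplacian u x) * phi x) = \int[leb d]_x (complex.Re (u x) * lap phi x) &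
      \int[leb d]_x (complex.Im (laplacian u x) * phi x) = \int[leb d]_x (complex.Im (u x) * lap phi x)].
Proof.
move=> uB tp; have [sphi spp _ _] := test_profile_sqintegrable tp.
have [su1 su2 _] := inL2_sqintegrable uB.1.
pose b i : midx d 2 := [ffun j => if j == i then ord_max else ord0].
pose g i := weak_deriv (b i) u.
have dual i := weak_deriv2_duality i uB (test_profile_test_function tp).
have sg1 i : sqintegrable (leb d) (fun x => complex.Re (g i x)).
  by have [/inL2_sqintegrable[]] := dual i.
have sg2 i : sqintegrable (leb d) (fun x => complex.Im (g i x)).
  by have [/inL2_sqintegrable[]] := dual i.
have reS x (s : seq 'I_d) : complex.Re (\sum_(i <- s) g i x) = \sum_(i <- s) complex.Re (g i x).
  elim: s => [|j s IH]; first by rewrite !big_nil.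
  by rewrite !big_cons -IH; case: (g j x) => a1 a2; case: (\sum_(i <- s) _).
have imS x (s : seq 'I_d) : complex.Im (\sum_(i <- s) g i x) = \sum_(i <- s) complex.Im (g i x).
  elim: s => [|j s IH]; first by rewrite !big_nil.
  by rewrite !big_cons -IH; case: (g j x) => a1 a2; case: (\sum_(i <- s) _).
have sqS (f : 'I_d -> 'rV[R]_d -> R) (s : seq 'I_d) : (forall i, sqintegrable (leb d) (f i)) ->
    sqintegrable (leb d) (fun x => \sum_(i <- s) f i x).
  move=> sf; elim: s => [|j s IH].
    under eq_fun do rewrite big_nil; split => //; rewrite /sqint.
    by under eq_integral do rewrite expr0n /=; rewrite integral0 ltry.
  under eq_fun do rewrite big_cons.
  exact: (n2_triangle (sf j) IH).1.
have intS (f : 'I_d -> 'rV[R]_d -> R) (p : 'rV[R]_d -> R) (s : seq 'I_d) :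
    (forall i, sqintegrable (leb d) (f i)) -> sqintegrable (leb d) p ->
    \int[leb d]_x ((\sum_(i <- s) f i x) * p x) = \sum_(i <- s) \int[leb d]_x (f i x * p x).
  move=> sf sp; elim: s => [|j s IH].
    rewrite big_nil; under eq_Rintegral do rewrite big_nil mul0r.
    by rewrite /Rintegral integral0.
  rewrite big_cons -IH -RintegralD//.
  - by apply: eq_Rintegral => x _; rewrite big_cons mulrDl.
  - exact: (CauchySchwarz (sf j) sp).1.
  - exact: (CauchySchwarz (sqS f s sf) sp).1.
split.
- under eq_fun do rewrite reS; exact: sqS.
- under eq_fun do rewrite imS; exact: sqS.
- under eq_Rintegral do rewrite reS.
  rewrite intS//; under [in RHS]eq_Rintegral do rewrite mulrC.
  rewrite intS//; apply: eq_bigr => i _; have [_ <- _] := dual i.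
  by apply: eq_Rintegral => x _; rewrite mulrC.
- under eq_Rintegral do rewrite imS.
  rewrite intS//; under [in RHS]eq_Rintegral do rewrite mulrC.
  rewrite intS//; apply: eq_bigr => i _; have [_ _ <-] := dual i.
  by apply: eq_Rintegral => x _; rewrite mulrC.
Qed.

Lemma schrodinger_reim (k1 k2 : R) (v l u : R[i]) (q : R) :
  (v + ('i * (- k1%:C * l + (k2 * q)%:C * u))%C = 0)%C ->
  complex.Re v = - k1 * complex.Im l + k2 * q * complex.Im u /\
  complex.Im v = k1 * complex.Re l - k2 * q * complex.Re u.
Proof.
case: v l u => [v1 v2] [l1 l2] [u1 u2] /= /eqP; rewrite eq_complex /= => /andP[/eqP h1 /eqP h2].
by split; lra.
Qed.

(** The equation tested against a real profile. The Laplacian moves onto phi by duality, and |x|^2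
    is grouped with phi, whose compact support keeps the product square integrable. *)
Lemma schrodinger_pairing rho (k1 k2 : R) (u u' : 'rV[R]_d -> R[i]) phi :
  inB u -> inL2 u' -> test_profile rho phi ->
  {ae leb d, forall x, u' x + ('i * (- k1%:C * laplacian u x + (k2 * enorm x ^+ 2)%:C * u x))%C = 0} ->
  \int[leb d]_x (complex.Re (u' x) * phi x) =
    \int[leb d]_x (complex.Im (u x) * (- k1 * lap phi x + k2 * (qf x * phi x))) /\
  \int[leb d]_x (complex.Im (u' x) * phi x) =
    \int[leb d]_x (complex.Re (u x) * (k1 * lap phi x - k2 * (qf x * phi x))).
Proof.
move=> uB u'L2 tp eqn.
have [sphi spp slap sq] := test_profile_sqintegrable tp.
have [su1 su2 _] := inL2_sqintegrable uB.1.
have [sv1 sv2 _] := inL2_sqintegrable u'L2.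
have [sl1 sl2 d1 d2] := laplacian_duality uB tp.
have mq := @measurable_qf R d.
have key (v l w : 'rV[R]_d -> R) (s t : R) :
    sqintegrable (leb d) v -> sqintegrable (leb d) l -> sqintegrable (leb d) w ->
    {ae leb d, forall x, v x = s * l x + t * qf x * w x} ->
    \int[leb d]_x (v x * phi x) = s * \int[leb d]_x (l x * phi x) + t * \int[leb d]_x (w x * (qf x * phi x)).
  move=> sv sl sw ae.
  have i1 := (CauchySchwarz sl sphi).1.
  have i2 := (CauchySchwarz sw sq).1.
  rewrite -RintegralZl// -RintegralZl// -RintegralD//; last 2 first.
    exact: (integrableZl measurableT s i1).
    exact: (integrableZl measurableT t i2).
  rewrite /Rintegral; congr fine; apply: ae_eq_integral => //.
  - apply/measurable_EFinP; apply: measurable_funM; [exact: sv.1|exact: sphi.1].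
  - apply/measurable_EFinP; apply: measurable_funD; apply: measurable_funM => //; apply: measurable_funM;
      [exact: sl.1|exact: sphi.1|exact: sw.1|exact: sq.1].
  - by apply: filterS ae => x h _; rewrite h; congr EFin; ring.
have comb (w : 'rV[R]_d -> R) (s t : R) : sqintegrable (leb d) w ->
    s * \int[leb d]_x (w x * lap phi x) + t * \int[leb d]_x (w x * (qf x * phi x)) =
    \int[leb d]_x (w x * (s * lap phi x + t * (qf x * phi x))).
  move=> sw.
  have i1 := (CauchySchwarz sw slap).1.
  have i2 := (CauchySchwarz sw sq).1.
  rewrite -RintegralZl// -RintegralZl// -RintegralD//; last 2 first.
    exact: (integrableZl measurableT s i1).
    exact: (integrableZl measurableT t i2).
  by apply: eq_Rintegral => x _; ring.
split.
- rewrite (key _ (fun x => complex.Im (laplacian u x)) (fun x => complex.Im (u x)) (- k1) k2)//.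
    by rewrite d2 comb.
  by apply: filterS eqn => x; rewrite qf_enorm => /schrodinger_reim[].
- rewrite (key _ (fun x => complex.Re (laplacian u x)) (fun x => complex.Re (u x)) k1 (- k2))//.
    by rewrite d1 comb//; apply: eq_Rintegral => x _; rewrite mulNr.
  by apply: filterS eqn => x; rewrite qf_enorm => /schrodinger_reim[_ ->]; rewrite !mulNr.
Qed.

End compactly_supported.

(** * Real and imaginary parts of the solution *)

Section solution_facts.
Context {R : realType} {d : nat}.
Implicit Types (u v : 'rV[R]_d -> R[i]).

Lemma ReD (a b : R[i]) : complex.Re (a + b) = complex.Re a + complex.Re b.
Proof. by case: a; case: b. Qed.
Lemma ImD (a b : R[i]) : complex.Im (a + b) = complex.Im a + complex.Im b.
Proof. by case: a; case: b. Qed.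
Lemma ReN (a : R[i]) : complex.Re (- a) = - complex.Re a.
Proof. by case: a. Qed.
Lemma ImN (a : R[i]) : complex.Im (- a) = - complex.Im a.
Proof. by case: a. Qed.
Lemma ReZ (r : R) (a : R[i]) : complex.Re (r%:C%C * a) = r * complex.Re a.
Proof. by case: a => a1 a2 /=; rewrite mul0r subr0. Qed.
Lemma ImZ (r : R) (a : R[i]) : complex.Im (r%:C%C * a) = r * complex.Im a.
Proof. by case: a => a1 a2 /=; rewrite mul0r addr0. Qed.

Lemma sqintegrable_inL2 v : sqintegrable (leb d) (fun x => complex.Re (v x)) ->
  sqintegrable (leb d) (fun x => complex.Im (v x)) -> inL2 v.
Proof.
move=> [m1 f1] [m2 f2]; split => //; rewrite L2normE.
have -> : (\int[leb d]_x (reim2 v x)%:E =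
  sqint (leb d) (fun x => complex.Re (v x)) + sqint (leb d) (fun x => complex.Im (v x)))%E.
  rewrite /sqint -ge0_integralD//.
  - by move=> x _; rewrite lee_fin sqr_ge0.
  - by apply/measurable_EFinP; exact: measurable_funX.
  - by move=> x _; rewrite lee_fin sqr_ge0.
  - by apply/measurable_EFinP; exact: measurable_funX.
have : (sqint (leb d) (fun x => complex.Re (v x)) + sqint (leb d) (fun x => complex.Im (v x)) < +oo)%E.
  exact: lte_add_pinfty.
by case: (_ + _)%E => [r||]; rewrite /= ?ltry ?ltNyy.
Qed.

Lemma sqintegrable_normc (v : 'rV[R]_d -> R[i]) : inL2 v ->
  sqintegrable (leb d) (fun x => Num.sqrt (reim2 v x)).
Proof.
move=> vL2; have [mr mi voo] := vL2; split.
  apply: (measurableT_comp (f := @Num.sqrt R)).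
    by apply: continuous_measurable_fun; exact: sqrt_continuous.
  by apply: measurable_funD; exact: measurable_funX.
rewrite /sqint; under eq_integral => x _ do rewrite sqr_sqrtr ?addr_ge0 ?sqr_ge0//.
move: voo; rewrite L2normE.
have I0 : (0 <= \int[leb d]_x (reim2 v x)%:E)%E.
  by apply: integral_ge0 => x _; rewrite lee_fin addr_ge0 ?sqr_ge0.
by move: I0; case: (\int[_]_x _)%E => [r||]; rewrite /= ?ltry ?ltNyy.
Qed.

Lemma n2_reim_le v : inL2 v ->
  n2 (leb d) (fun x => complex.Re (v x)) <= fine (L2norm v) /\
  n2 (leb d) (fun x => complex.Im (v x)) <= fine (L2norm v).
Proof.
move=> vL2; have [s1 s2 ->] := inL2_sqintegrable vL2; rewrite /=.
have sr := sqintegrable_normc vL2.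
split.
- apply: (le_sqintegrable s1.1 sr _).2 => x.
  by rewrite (ger0_norm (sqrtr_ge0 _)) -sqrtr_sqr ler_wsqrtr// lerDl sqr_ge0.
- apply: (le_sqintegrable s2.1 sr _).2 => x.
  by rewrite (ger0_norm (sqrtr_ge0 _)) -sqrtr_sqr ler_wsqrtr// lerDr sqr_ge0.
Qed.

Lemma quotient_reim_cvg (T : R) (u : R -> 'rV[R]_d -> R[i]) (u' : 'rV[R]_d -> R[i]) (t : R) (A : set R) :
  A `<=` `[0, T]%classic -> A t ->
  (forall s, A s -> inL2 (u s)) -> inL2 u' ->
  L2norm (fun x => ((s - t)^-1)%:C%C * (u s x - u t x) - u' x)
    @[s --> within `[0, T]%classic t^'] --> (0%:E) ->
  n2 (leb d) (fun x => (s - t)^-1 * (complex.Re (u s x) - complex.Re (u t x)) - complex.Re (u' x))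
    @[s --> within A t^'] --> (0 : R) /\
  n2 (leb d) (fun x => (s - t)^-1 * (complex.Im (u s x) - complex.Im (u t x)) - complex.Im (u' x))
    @[s --> within A t^'] --> (0 : R).
Proof.
move=> AT At sL2 u'L2 cv.
have [r1 i1 _] := inL2_sqintegrable u'L2.
have [r0 i0 _] := inL2_sqintegrable (sL2 _ At).
pose v s x := ((s - t)^-1)%:C%C * (u s x - u t x) - u' x.
have vR s : (fun x => (s - t)^-1 * (complex.Re (u s x) - complex.Re (u t x)) - complex.Re (u' x)) = (fun x => complex.Re (v s x)).
  by apply/funext => x; rewrite /v ReD ReN ReZ ReD ReN.
have vI s : (fun x => (s - t)^-1 * (complex.Im (u s x) - complex.Im (u t x)) - complex.Im (u' x)) = (fun x => complex.Im (v s x)).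
  by apply/funext => x; rewrite /v ImD ImN ImZ ImD ImN.
have vL2 s : A s -> inL2 (v s).
  move=> As; have [r2 i2 _] := inL2_sqintegrable (sL2 _ As).
  apply: sqintegrable_inL2.
  - rewrite -vR; apply: sqintegrableB => //.
    exact: (n2_ger0_norm (s - t)^-1 (sqintegrableB r2 r0)).1.
  - rewrite -vI; apply: sqintegrableB => //.
    exact: (n2_ger0_norm (s - t)^-1 (sqintegrableB i2 i0)).1.
have cf : fine (L2norm (v s)) @[s --> within A t^'] --> (0 : R).
  have : fine (L2norm (v s)) @[s --> within `[0, T]%classic t^'] --> (0 : R) by exact: fine_cvg.
  move=> hT; apply: (cvg_trans _ hT); apply: cvg_app => P.
  change (nbhs t^' (fun x => `[0, T]%classic x -> P x) -> nbhs t^' (fun x => A x -> P x)).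
  by apply: filterS => s h As; apply: h; exact: AT.
have sq (f : R -> R) : (forall s, A s -> 0 <= f s <= fine (L2norm (v s))) ->
    f s @[s --> within A t^'] --> (0 : R).
  move=> hf; apply/cvgrPdist_le => e e0.
  move/cvgrPdist_le : cf => /(_ e e0) hc; rewrite near_withinE in hc; rewrite near_withinE.
  apply: filterS hc => s + As => /(_ As).
  have /andP[f0 fl] := hf s As.
  rewrite !sub0r !normrN (ger0_norm f0) => h; apply: (le_trans fl); apply: (le_trans _ h).
  exact: ler_norm.
split; apply: sq => s As.
- by rewrite n2_ge0 /= vR; exact: (n2_reim_le (vL2 s As)).1.
- by rewrite n2_ge0 /= vI; exact: (n2_reim_le (vL2 s As)).2.
Qed.

End solution_facts.

Section monotone_integral.
Context {dsp : measure_display} {T : measurableType dsp} {R : realType} (mu : {measure set T -> \bar R}).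

(** The integral of a nonnegative function is a supremum over simple functions below it, hence
    monotone without measurability. It is applied to the restriction of u to omega and to the map t
    -> |u(t)| on omega. *)
Lemma le_integral_nonmeasurable (D : set T) (f g : T -> \bar R) :
  (forall x, D x -> 0 <= f x)%E -> (forall x, D x -> f x <= g x)%E ->
  (\int[mu]_(x in D) f x <= \int[mu]_(x in D) g x)%E.
Proof.
move=> f0 fg; have g0 x : D x -> (0 <= g x)%E by move=> Dx; exact: le_trans (f0 x Dx) (fg x Dx).
rewrite !ge0_integralE//; apply: ereal_sup_le => _ [h hf <-]; exists h => // x.
apply: (le_trans (hf x)); rewrite !patchE; case: ifPn => // /set_mem Dx.
exact: fg.
Qed.

End monotone_integral.

Section packet.
Context {R : realType} {d : nat}.
Implicit Types (x y : 'rV[R]_d) (i : 'I_d).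

(** The bounds of [psi_bounds] hold kernel by kernel and the weights are nonnegative, so one C
    serves all superpositions; the Laplacian has d terms, whence d + 1. *)
Lemma packet_bounds : exists2 C : R, 0 < C &
  forall (I : finType) (c : I -> R) (z : I -> 'rV[R]_d), (forall n, 0 <= c n) ->
  forall y, `|superpose c z psi y| <= C * superpose c z kap y /\
            `|lap (superpose c z psi) y| <= C * superpose c z kap y.
Proof.
have [C C0 [hp [hpp _]]] := @psi_bounds R d.
have sp n := @smooth_psi R d n.
have sp1 i n : smooth n (partial i (@psi R d)) by have [_] := sp n.+1; apply.
exists (C * (d%:R + 1)); first by rewrite mulr_gt0// ltr_wpDl.
move=> I c z c0 y.
have gen (g : 'rV[R]_d -> R) : (forall x, `|g x| <= C * kap x) -> `|superpose c z g y| <= C * superpose c z kap y.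
  move=> hg; apply: (le_trans (ler_norm_sum _ _ _)).
  rewrite /superpose mulr_sumr; apply: ler_sum => n _.
  by rewrite normrM (ger0_norm (c0 n)) mulrCA ler_wpM2l.
have S0 : 0 <= superpose c z kap y by apply: superpose_ge0 => // x; exact: kap_ge0.
have CS0 : 0 <= C * superpose c z kap y by rewrite mulr_ge0// ltW.
split.
  apply: (le_trans (gen _ hp)); rewrite mulrDr mulr1 mulrDl lerDr.
  by rewrite -mulrA mulrCA mulr_ge0.
apply: (@le_trans _ _ (\sum_(i < d) C * superpose c z kap y)).
  apply: (le_trans (ler_norm_sum _ _ _)); apply: ler_sum => i _.
  rewrite partial_superpose; last exact: sp.
  rewrite partial_superpose; last exact: sp1.
  by apply: gen => x; exact: (hpp i x).2.
rewrite sumr_const card_ord -[leLHS]mulr_natl.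
rewrite (_ : C * (d%:R + 1) * _ = d%:R * (C * superpose c z kap y) + C * superpose c z kap y); last by ring.
by rewrite lerDl.
Qed.

Lemma sqintegrable_shift (g : 'rV[R]_d -> R) (v : 'rV[R]_d) : sqintegrable (leb d) g ->
  sqintegrable (leb d) (fun x => g (x - v)).
Proof.
move=> [mg goo]; split.
  by apply: (measurableT_comp mg); exact: measurable_fun_shift_rV.
rewrite /sqint (@ge0_integral_shift R d v (fun x => (g x ^+ 2)%:E))//.
- by apply/measurable_EFinP; exact: measurable_funX.
- by move=> x; rewrite lee_fin sqr_ge0.
Qed.

Lemma sqintegrable_sum (I : Type) (s : seq I) (f : I -> 'rV[R]_d -> R) :
  (forall j, sqintegrable (leb d) (f j)) -> sqintegrable (leb d) (fun x => \sum_(j <- s) f j x).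
Proof.
move=> sf; elim: s => [|j s IH].
  under eq_fun do rewrite big_nil; split => //; rewrite /sqint.
  by under eq_integral do rewrite expr0n /=; rewrite integral0 ltry.
under eq_fun do rewrite big_cons.
exact: (n2_triangle (sf j) IH).1.
Qed.

Lemma sqintegrable_superpose (I : finType) (c : I -> R) (z : I -> 'rV[R]_d) g :
  sqintegrable (leb d) g -> sqintegrable (leb d) (superpose c z g).
Proof.
move=> sg; apply: sqintegrable_sum => n; apply: (n2_ger0_norm (c n) _).1.
exact: sqintegrable_shift.
Qed.

Lemma sqintegrable_kap : sqintegrable (leb d) (@kap R d).
Proof.
split; first exact: measurable_kap.
apply: le_lt_trans (integral_kap_lty R d).
have k1 x : kap x <= 1.
  have <- : \prod_(i < d) (1 : R) = 1 by rewrite big1.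
  apply: ler_prod => i _; rewrite invr_ge0 (le_trans _ (oneDsqr_ge1 _))//=.
  exact: oneDsqrV_le1.
apply: ge0_le_integral => //.
- by move=> x _; rewrite lee_fin sqr_ge0.
- by apply/measurable_EFinP; apply: measurable_funX; exact: measurable_kap.
- by apply/measurable_EFinP; exact: measurable_kap.
- by move=> x _; rewrite lee_fin expr2 ger_pMl ?kap_gt0// k1.
Qed.

Lemma measurable_scale (be : R) : measurable_fun setT (fun x : 'rV[R]_d => be *: x).
Proof.
have -> : (fun x : 'rV[R]_d => be *: x) = (fun x => be *: x + 0) by apply/funext => x; rewrite addr0.
exact: measurable_fun_affine_rV.
Qed.

(** The change of variables costs be^(-d/2), at most 2^(d/2), rounded up to 2^d. *)
Lemma n2_dilate (g : 'rV[R]_d -> R) (be : R) : 2^-1 <= be -> sqintegrable (leb d) g ->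
  sqintegrable (leb d) (fun x => g (be *: x)) /\
  n2 (leb d) (fun x => g (be *: x)) <= 2 ^+ d * n2 (leb d) g.
Proof.
move=> be2 [mg goo].
have be0 : 0 < be by apply: lt_le_trans be2; rewrite invr_gt0.
have ma := measurable_scale be.
have e : ((be ^+ d)%:E * sqint (leb d) (fun x => g (be *: x)) = sqint (leb d) g)%E.
  rewrite /sqint -[RHS](@ge0_integral_affine R d be 0)//.
  - by congr (_ * _)%E; apply: eq_integral => x _; rewrite addr0.
  - by apply/measurable_EFinP; exact: measurable_funX.
  - by move=> x; rewrite lee_fin sqr_ge0.
have bd0 : 0 < be ^+ d by rewrite exprn_gt0.
have fin : (sqint (leb d) (fun x => g (be *: x)) < +oo)%E.
  move: e goo (sqint_ge0 (leb d) (fun x => g (be *: x))) => <-.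
  by case: (sqint _ _) => [r||]; rewrite ?ltry// mulry gtr0_sg// mul1e.
split; first by split => //; exact: (measurableT_comp mg).
rewrite /n2.
have -> : fine (sqint (leb d) (fun x => g (be *: x))) = (be ^+ d)^-1 * fine (sqint (leb d) g).
  rewrite -e fineM//; last by rewrite ge0_fin_numE// sqint_ge0.
  by rewrite /= mulrA mulVf ?mul1r// gt_eqF.
rewrite sqrtrM ?invr_ge0 ?(ltW bd0)//; apply: ler_wpM2r; first exact: sqrtr_ge0.
have h : (be ^+ d)^-1 <= 2 ^+ d.
  rewrite -exprVn; apply: lerXn2r; rewrite ?nnegrE ?invr_ge0 ?(ltW be0)//.
  by rewrite -[leRHS]invrK lef_pV2// posrE ?invr_gt0.
apply: (@le_trans _ _ (Num.sqrt (2 ^+ d ^+ 2))).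
  rewrite ler_wsqrtr//; apply: (le_trans h); rewrite expr2 ler_peMl ?exprn_ge0//.
  by apply: exprn_ege1; lra.
by rewrite sqrtr_sqr ger0_norm// exprn_ge0.
Qed.

Section superposed.
Variables (I : finType) (c : I -> R) (z : I -> 'rV[R]_d).

Let W := superpose c z psi.

(** A crude radius enclosing the supports of all shifted unit bumps. It depends on the centers, so
    it serves only qualitative purposes and enters no final constant. *)
Definition packet_radius : R := 1 + \sum_n \sum_i `|z n ord0 i|.

Lemma superpose_supported (g : 'rV[R]_d -> R) : supported_in 1 g ->
  supported_in packet_radius (superpose c z g).
Proof.
move=> g0 y hy; rewrite /superpose big1// => n _; rewrite g0 ?mulr0// => hn.
apply: hy => i; have := hn i; rewrite !mxE => h1.
have h2 : `|y ord0 i| <= `|y ord0 i - z n ord0 i| + `|z n ord0 i|.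
  by rewrite -[X in `|X| <= _](subrK (z n ord0 i)) ler_normD.
apply: (le_trans h2); rewrite /packet_radius lerD//.
rewrite (bigD1 n)//= (bigD1 i)//= -addrA lerDl addr_ge0// sumr_ge0// => j _.
by rewrite sumr_ge0.
Qed.

(** The margin 2 exceeds the support radius 1 of g: a coordinate of z n of size r + 2 is too far
    from a point of [cube r]. *)
Lemma superpose_vanish (g : 'rV[R]_d -> R) (r : R) : supported_in 1 g ->
  (forall n, exists i, r + 2 <= `|z n ord0 i|) ->
  forall y, cube r y -> superpose c z g y = 0.
Proof.
move=> g0 far y hy; rewrite /superpose big1// => n _; rewrite g0 ?mulr0// => hn.
have [i hi] := far n.
have := hn i; rewrite !mxE => h1; have h2 := hy i.
have h3 : `|z n ord0 i| <= `|y ord0 i| + `|y ord0 i - z n ord0 i|.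
  by have := ler_normB (y ord0 i) (y ord0 i - z n ord0 i); rewrite opprB addrCA subrr addr0.
by lra.
Qed.

Lemma psi_supported i : [/\ supported_in 1 (@psi R d), supported_in 1 (partial i (@psi R d)) &
  supported_in 1 (partial i (partial i (@psi R d)))].
Proof.
by have [C C0 [_ [_ h]]] := @psi_bounds R d; split => x hx; have [? [? ?]] := h i x hx.
Qed.

Lemma smooth_packet n : smooth n W.
Proof. by apply: smooth_superpose; exact: smooth_psi. Qed.

Lemma measurable_packet i : [/\ measurable_fun setT W, measurable_fun setT (partial i W) &
  measurable_fun setT (partial i (partial i W))].
Proof.
have sp n := @smooth_psi R d n.
have sp1 n : smooth n (partial i (@psi R d)) by have [_] := sp n.+1; apply.
have [m0 [m1 m2]] := @measurable_psi R d i.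
rewrite /W partial_superpose; last exact: sp.
rewrite partial_superpose; last exact: sp1.
by split; apply: measurable_superpose.
Qed.

Lemma measurable_phase (h : R -> R) (al : R) : continuous h ->
  measurable_fun setT (fun x : 'rV[R]_d => h (al * qf x)).
Proof.
move=> ch; apply: (measurableT_comp (f := h)); first exact: continuous_measurable_fun.
by apply: measurable_funM => //; exact: measurable_qf.
Qed.

Hypothesis d0 : (0 < d)%N.

(** As be >= 1/2, the dilation at most doubles the support. *)
Lemma packet_test_profile (h : R -> R) (al be : R) : (forall n, smooth1 n h) -> 2^-1 <= be ->
  test_profile (2 * packet_radius) (phased W h al be).
Proof.
move=> sh be2.
have be0 : 0 < be by apply: lt_le_trans be2; rewrite invr_gt0.
have i0 : 'I_d by exact: (Ordinal d0).
have sh1 n : smooth1 n (derive1 h) by apply: smooth1_derive.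
have sh2 n : smooth1 n (derive1 (derive1 h)) by apply: smooth1_derive.
have ch := smooth1_continuous 0 _ (sh 0).
have ch1 := smooth1_continuous 0 _ (sh1 0).
have ch2 := smooth1_continuous 0 _ (sh2 0).
have ms := measurable_scale be.
split.
- by move=> n; apply: smooth_phased => //; exact: smooth_packet.
- move=> x hx; rewrite /phased [W _](superpose_supported _) ?mulr0//; first by have [] := psi_supported i0.
  move=> hc; apply: hx => i; have := hc i; rewrite !mxE normrM (gtr0_norm be0) => hb.
  rewrite mulrC -ler_pdivrMr//; apply: le_trans hb; rewrite mulrC ler_wpM2r//.
- have [m0 _ _] := measurable_packet i0.
  by apply: measurable_funM; [exact: measurable_phase|exact: (measurableT_comp m0)].
- move=> i; have [m0 m1 m2] := measurable_packet i.
  have -> : partial i (partial i (phased W h al be)) = fun x =>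
    4 * al ^+ 2 * x ord0 i ^+ 2 * derive1 (derive1 h) (al * qf x) * W (be *: x)
    + 2 * al * derive1 h (al * qf x) * W (be *: x)
    + 4 * al * be * derive1 h (al * qf x) * (x ord0 i * partial i W (be *: x))
    + be ^+ 2 * h (al * qf x) * partial i (partial i W) (be *: x).
    by apply/funext => x; rewrite partial2_phased// => n; exact: smooth_packet.
  have mc : measurable_fun setT (fun x : 'rV[R]_d => x ord0 i) by exact: measurable_coord.
  have n0 := measurableT_comp m0 ms; have n1 := measurableT_comp m1 ms; have n2 := measurableT_comp m2 ms.
  have p0 := measurable_phase al ch; have p1 := measurable_phase al ch1; have p2 := measurable_phase al ch2.
  apply: measurable_funD; first (apply: measurable_funD; first apply: measurable_funD).
  - apply: measurable_funM n0; apply: measurable_funM p2; apply: measurable_funM; first exact: measurable_cst.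
    exact: measurable_funX.
  - by apply: measurable_funM n0; apply: measurable_funM p1; exact: measurable_cst.
  - apply: measurable_funM; last exact: measurable_funM mc n1.
    by apply: measurable_funM p1; exact: measurable_cst.
  - by apply: measurable_funM n2; apply: measurable_funM p0; exact: measurable_cst.
Qed.

End superposed.

End packet.

(** * Observation of a packet *)

Section trig.
Context {R : realType}.

Lemma derive1_sin : derive1 (@sin R) = cos.
Proof. by apply/funext => s; rewrite derive1E; have [_ ->] := is_derive_sin s. Qed.

Lemma derive1_cos : derive1 (@cos R) = (fun s => - sin s).
Proof. by apply/funext => s; rewrite derive1E; have [_ ->] := is_derive_cos s. Qed.

Lemma derive1_Nsin : derive1 (fun s : R => - sin s) = (fun s => - cos s).
Proof.
apply/funext => s; rewrite derive1E.
by have [_ ->] := is_deriveN (is_derive_sin s).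
Qed.

Lemma norm_cos_le1 (s : R) : `|cos s| <= 1.
Proof. by rewrite ler_norml cos_geN1 cos_le1. Qed.

Lemma norm_sin_le1 (s : R) : `|sin s| <= 1.
Proof. by rewrite ler_norml sin_geN1 sin_le1. Qed.
End trig.

(** * Time evolution of the pairing of the solution with the packet *)

Section evolution.
Context {R : realType} {d : nat}.
Variables (d0 : (0 < d)%N) (T tau K1 K2 rho C : R) (k1 k2 : R -> R) (Y1 Y2 : R -> R).
Variables (u u' : R -> 'rV[R]_d -> R[i]).
Variables (I : finType) (c : I -> R) (z : I -> 'rV[R]_d).
Hypotheses (tau0 : 0 < tau) (tauT : tau <= T) (rho0 : 0 <= rho).
Hypothesis uB : forall t, 0 <= t <= T -> inB (u t).
Hypothesis u'L2 : forall t, 0 <= t <= T -> inL2 (u' t).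
Hypothesis du : forall t, 0 <= t <= T ->
  L2norm (fun x => ((s - t)^-1)%:C%C * (u s x - u t x) - u' t x)
    @[s --> within `[0, T]%classic t^'] --> (0%:E : \bar R).
Hypothesis eqn : forall t, 0 < t <= T -> {ae leb d, forall x,
  u' t x + ('i * (- (k1 t)%:C * laplacian (u t) x + (k2 t * enorm x ^+ 2)%:C * u t x))%C = 0}.
Hypothesis k1K : forall t, 0 <= t <= T -> 0 <= k1 t <= K1.
Hypothesis k2K : forall t, 0 <= t <= T -> 0 <= k2 t <= K2.
Hypotheses (cY1 : continuous Y1) (cY2 : continuous Y2) (Y10 : Y1 0 = 0) (Y20 : Y2 0 = 1).
Hypothesis Yb : forall s, `|Y1 s| <= 1 /\ 2^-1 <= Y2 s <= 3 / 2.
Hypothesis dY : forall t, 0 < t < tau ->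
  is_derive t (1 : R) Y1 (- 4 * k1 t * Y1 t ^+ 2 - k2 t) /\
  is_derive t (1 : R) Y2 (- 4 * k1 t * Y1 t * Y2 t).
Hypotheses (c0 : forall n, 0 <= c n) (C0 : 0 < C).
Let W := superpose c z psi.
Let S := superpose c z kap.
Hypothesis WS : forall y, `|W y| <= C * S y /\ `|lap W y| <= C * S y.
Hypothesis far : forall n, exists i, 3 / 2 * rho + 2 <= `|z n ord0 i|.

Let sW n : smooth n W. Proof. exact: smooth_packet. Qed.
Let w h (s : R) : 'rV[R]_d -> R := phased W h (Y1 s) (Y2 s).
Let rr := 2 * packet_radius z.
Let K : set 'rV[R]_d := cube rr.
Let ind : 'rV[R]_d -> R := \1_(~` cube rho).

Let smooth_cos n : smooth1 n (@cos R). Proof. exact: (smooth1_sin_cos n).2. Qed.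
Let smooth_sin n : smooth1 n (@sin R). Proof. exact: (smooth1_sin_cos n).1. Qed.

Let Yhalf s : 2^-1 <= Y2 s. Proof. by have [_ /andP[]] := Yb s. Qed.

Let tpw h s : (forall n, smooth1 n h) -> test_profile rr (w h s).
Proof. by move=> sh; apply: packet_test_profile. Qed.

Let inT t : 0 < t < tau -> 0 <= t <= T.
Proof. by move=> /andP[a b]; rewrite ltW//= (le_trans (ltW b)). Qed.

Let inT' t : 0 <= t <= tau -> 0 <= t <= T.
Proof. by move=> /andP[a b]; rewrite a (le_trans b). Qed.

Let scaled_support s x : ~ K x -> ~ cube (packet_radius z) (Y2 s *: x).
Proof.
move=> hx hc; apply: hx => i; have := hc i; rewrite !mxE normrM.
have b0 : 0 < Y2 s by apply: lt_le_trans (Yhalf s); rewrite invr_gt0.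
rewrite (gtr0_norm b0) => hb; rewrite /rr mulrC -ler_pdivrMr//; apply: le_trans hb.
by rewrite mulrC ler_wpM2r// Yhalf.
Qed.

Let dYb t : 0 < t < tau -> `|- 4 * k1 t * Y1 t ^+ 2 - k2 t| <= 4 * K1 + K2 /\
  `|- 4 * k1 t * Y1 t * Y2 t| <= 6 * K1.
Proof.
move=> ht; have /andP[a1 b1] := k1K (inT ht); have /andP[a2 b2] := k2K (inT ht).
have [y1 /andP[y2 y3]] := Yb t.
have y1s : Y1 t ^+ 2 <= 1 by rewrite -(real_normK (num_real (Y1 t))) expr_le1.
have y1s0 := sqr_ge0 (Y1 t).
split; first by rewrite ler_norml; apply/andP; split; nra.
have p1 : `|Y1 t * Y2 t| <= 3 / 2.
  rewrite normrM (ger0_norm (_ : 0 <= Y2 t)); last by apply: le_trans y2; rewrite invr_ge0.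
  have := normr_ge0 (Y1 t); move: (`|Y1 t| : R) y1 => p p1 p0; nra.
move: p1; rewrite !ler_norml => /andP[p1 p2].
by apply/andP; split; nra.
Qed.

(** A qualitative majorant, supported in [K], for the packet and its time derivative. M depends on
    the centers; it only justifies differentiation and limits under the integral. *)
Let packet_time_bound h : (forall n, smooth1 n h) -> (forall s, `|h s| <= 1) ->
  (forall s, `|derive1 h s| <= 1) ->
  exists M : R, (forall s x, `|w h s x| <= M * \1_K x) /\
    (forall t x, 0 < t < tau -> derivable (fun s => w h s x) t (1 : R) /\
       `|derive1 (fun s => w h s x) t| <= M * \1_K x).
Proof.
move=> sh h1 dh1.
have [s0 _ _] := @psi_supported R d (Ordinal d0).
have sup0 : supported_in (packet_radius z) W by exact: superpose_supported.
have [M0 M00 hM0] := supported_bounded (sW 0) sup0.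
have sW1 i n : smooth n (partial i W) by have [_] := sW n.+1; apply.
have hM1 i := supported_bounded (sW1 i 0) (partial_supported i sup0).
pose M1 i := projT1 (cid2 (hM1 i)).
have M10 i : 0 <= M1 i by rewrite /M1; case: (cid2 _).
have hM1' i y : `|partial i W y| <= M1 i.
  rewrite /M1; case: (cid2 _) => m m0 hm /=; apply: (le_trans (hm y)).
  by rewrite indicE; case: (_ \in _); rewrite ?mulr1 ?mulr0.
have hM0' y : `|W y| <= M0.
  by apply: (le_trans (hM0 y)); rewrite indicE; case: (_ \in _); rewrite ?mulr1 ?mulr0.
have t00 : (0 : R) <= 0 <= T by apply/andP; split => //; exact: (le_trans (ltW tau0) tauT).
have K10 : 0 <= K1 by have /andP[a b] := k1K t00; exact: le_trans b.
have K20 : 0 <= K2 by have /andP[a b] := k2K t00; exact: le_trans b.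
have rr0 : 0 <= rr.
  by rewrite /rr mulr_ge0// addr_ge0// sumr_ge0// => n _; rewrite sumr_ge0.
(* [Q] bounds |x|^2 on [K]. The two summands of [A] come from the time derivatives of the phase and
   of the dilation. *)
pose Q := d%:R * rr ^+ 2.
pose A := (4 * K1 + K2) * Q * M0 + 6 * K1 * \sum_(i < d) rr * M1 i.
have A0 : 0 <= A.
  rewrite /A /Q; repeat (first [done | exact: ler0n | exact: sqr_ge0
    | apply: sumr_ge0 => i _ | apply: addr_ge0 | apply: mulr_ge0]).
exists (M0 + A); split.
  move=> s x; rewrite indicE; case: (boolP (x \in K)) => [_|/negP hx].
    rewrite mulr1 /w /phased normrM; apply: (@le_trans _ _ (1 * M0)); first exact: ler_pM.
    by rewrite mul1r lerDl.
  rewrite mulr0 /w /phased sup0 ?mulr0 ?normr0//.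
  by apply: scaled_support => h0; apply: hx; rewrite inE.
move=> t x ht.
have [d1 d2] := dY ht.
have dw := is_derive_phased_time sW x (sh 0) d1 d2.
have [[b1 b2] [ex vx]] := (dYb ht, dw).
split; first exact: ex.
rewrite derive1E [X in `|X|]vx indicE; case: (boolP (x \in K)) => [|/negP hx]; last first.
  have nc : ~ cube (packet_radius z) (Y2 t *: x).
    by apply: scaled_support => h0; apply: hx; rewrite inE.
  rewrite sup0// mulr0 big1 ?mulr0 ?addr0 ?normr0//.
  by move=> i _; rewrite (partial_supported i sup0 nc) mulr0.
rewrite inE mulr1 => Kx.
have qx : 0 <= qf x <= Q.
  rewrite /qf sumr_ge0 /=; last by move=> i _; exact: sqr_ge0.
  rewrite /Q -[d in d%:R]card_ord -sumr_const mulr_suml; apply: ler_sum => i _.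
  by rewrite mul1r -(real_normK (num_real (x ord0 i))) lerXn2r// ?nnegrE//; exact: Kx.
apply: (@le_trans _ _ A); last by rewrite lerDr.
apply: (le_trans (ler_normD _ _)); apply: lerD.
  rewrite normrM; apply: ler_pM => //.
  rewrite normrM -[leRHS]mul1r; apply: ler_pM => //.
  rewrite normrM; apply: ler_pM => //.
  by rewrite ger0_norm; have /andP[] := qx.
rewrite normrM -[leRHS]mul1r; apply: ler_pM => //.
rewrite normrM; apply: ler_pM => //.
apply: (le_trans (ler_norm_sum _ _ _)); apply: ler_sum => i _.
by rewrite normrM; apply: ler_pM => //; exact: Kx.
Qed.

Let pRe t : 0 <= t <= T -> sqintegrable (leb d) (fun x => complex.Re (u t x)).
Proof. by move=> ht; have [] := inL2_sqintegrable (uB ht).1. Qed.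

Let pIm t : 0 <= t <= T -> sqintegrable (leb d) (fun x => complex.Im (u t x)).
Proof. by move=> ht; have [] := inL2_sqintegrable (uB ht).1. Qed.

Let pRe' t : 0 <= t <= T -> sqintegrable (leb d) (fun x => complex.Re (u' t x)).
Proof. by move=> ht; have [] := inL2_sqintegrable (u'L2 ht). Qed.

Let pIm' t : 0 <= t <= T -> sqintegrable (leb d) (fun x => complex.Im (u' t x)).
Proof. by move=> ht; have [] := inL2_sqintegrable (u'L2 ht). Qed.

Let subT : `[0, tau]%classic `<=` `[0, T]%classic.
Proof. by move=> s /=; rewrite !in_itv /=; exact: inT'. Qed.

Let quo t : 0 <= t <= tau ->
  n2 (leb d) (fun x => (s - t)^-1 * (complex.Re (u s x) - complex.Re (u t x)) - complex.Re (u' t x))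
    @[s --> within `[0, tau]%classic t^'] --> (0 : R) /\
  n2 (leb d) (fun x => (s - t)^-1 * (complex.Im (u s x) - complex.Im (u t x)) - complex.Im (u' t x))
    @[s --> within `[0, tau]%classic t^'] --> (0 : R).
Proof.
move=> ht; apply: (quotient_reim_cvg subT) (u'L2 (inT' ht)) (du (inT' ht)).
- by rewrite /= in_itv.
- by move=> s /=; rewrite in_itv /= => hs; exact: (uB (inT' hs)).1.
Qed.

(** [I1 + I2] is the real part of <u(s), w(s)> for w = [w cos] + i [w sin]. *)
Let I1 s := \int[leb d]_x (complex.Re (u s x) * w cos s x).
Let I2 s := \int[leb d]_x (complex.Im (u s x) * w sin s x).

(** [e1] + i [e2] is the residual of w in the equation, that is w_t + i (- k1 Delta w + k2 |x|^2 w).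
    It equals k1 (2 d Y1 w - i Y2^2 exp (i Y1 |x|^2) (Delta W)(Y2 x)). *)
Let e1 t x := k1 t * (d%:R * (2 * Y1 t) * w cos t x + Y2 t ^+ 2 * (sin (Y1 t * qf x) * lap W (Y2 t *: x))).
Let e2 t x := k1 t * (d%:R * (2 * Y1 t) * w sin t x - Y2 t ^+ 2 * (cos (Y1 t * qf x) * lap W (Y2 t *: x))).

Let sin_bounds : (forall s : R, `|sin s| <= 1) /\ (forall s : R, `|derive1 sin s| <= 1).
Proof. by split => s; rewrite ?derive1_sin ?norm_sin_le1 ?norm_cos_le1. Qed.

Let cos_bounds : (forall s : R, `|cos s| <= 1) /\ (forall s : R, `|derive1 cos s| <= 1).
Proof. by split => s; rewrite ?derive1_cos ?normrN ?norm_sin_le1 ?norm_cos_le1. Qed.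

Let mw h : (forall n, smooth1 n h) -> forall s, measurable_fun setT (w h s).
Proof. by move=> sh s; have [] := tpw s sh. Qed.

Let lapw h s x : (forall n, smooth1 n h) -> lap (w h s) x =
  4 * Y1 s ^+ 2 * qf x * derive1 (derive1 h) (Y1 s * qf x) * W (Y2 s *: x)
  + d%:R * (2 * Y1 s * derive1 h (Y1 s * qf x) * W (Y2 s *: x))
  + 4 * Y1 s * Y2 s * derive1 h (Y1 s * qf x) * (\sum_i x ord0 i * partial i W (Y2 s *: x))
  + Y2 s ^+ 2 * h (Y1 s * qf x) * lap W (Y2 s *: x).
Proof. by move=> sh; exact: laplacian_phased. Qed.

Let dtw h t x : 0 < t < tau -> (forall n, smooth1 n h) -> derive1 (fun s => w h s x) t =
  derive1 h (Y1 t * qf x) * ((- 4 * k1 t * Y1 t ^+ 2 - k2 t) * qf x) * W (Y2 t *: x)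
  + h (Y1 t * qf x) * ((- 4 * k1 t * Y1 t * Y2 t) * \sum_i x ord0 i * partial i W (Y2 t *: x)).
Proof.
move=> ht sh; have [d1 d2] := dY ht.
by rewrite derive1E; have [_ ->] := is_derive_phased_time sW x (sh 0) d1 d2.
Qed.

(** The equation of [Y1] cancels the terms in |x|^2 W and that of [Y2] the terms in x . grad W, so
    that only W and its Laplacian survive in [e1]. *)
Let dcos t x : 0 < t < tau -> derive1 (fun s => w cos s x) t =
  e1 t x - (k1 t * lap (w sin t) x - k2 t * (qf x * w sin t x)).
Proof.
move=> ht; rewrite dtw// lapw// derive1_sin derive1_cos /e1 /w /phased; ring.
Qed.

Let dsin t x : 0 < t < tau -> derive1 (fun s => w sin s x) t =
  e2 t x - (- k1 t * lap (w cos t) x + k2 t * (qf x * w cos t x)).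
Proof.
move=> ht; rewrite dtw// lapw// derive1_sin derive1_cos derive1_Nsin /e2 /w /phased; ring.
Qed.

Let mlapW : measurable_fun setT (lap W).
Proof. by apply: measurable_sum => i; have [] := measurable_packet c z i. Qed.

Let me1 t : measurable_fun setT (e1 t).
Proof.
apply: measurable_funM => //; apply: measurable_funD.
  by apply: measurable_funM => //; exact: mw.
apply: measurable_funM => //; apply: measurable_funM.
  exact: measurable_phase (smooth1_continuous 0 _ (smooth_sin 0)).
by apply: (measurableT_comp mlapW); exact: measurable_scale.
Qed.

Let me2 t : measurable_fun setT (e2 t).
Proof.
apply: measurable_funM => //; apply: measurable_funB.
  by apply: measurable_funM => //; exact: mw.
apply: measurable_funM => //; apply: measurable_funM.
  exact: measurable_phase (smooth1_continuous 0 _ (smooth_cos 0)).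
by apply: (measurableT_comp mlapW); exact: measurable_scale.
Qed.

Let sS : sqintegrable (leb d) S.
Proof. by apply: sqintegrable_superpose; exact: sqintegrable_kap. Qed.

Let S0 y : 0 <= S y.
Proof. by apply: superpose_ge0 => // x; exact: kap_ge0. Qed.

Let K10 : 0 <= K1.
Proof.
have t00 : (0 : R) <= 0 <= T by apply/andP; split => //; exact: (le_trans (ltW tau0) tauT).
by have /andP[a b] := k1K t00; exact: le_trans b.
Qed.

(* Y2 <= 3/2, so the scaled points of [cube rho] lie in [cube (3/2 rho)], where the packet vanishes. *)
Let dominated (g : 'rV[R]_d -> R) (k t : R) : 0 <= k -> measurable_fun setT g ->
  (forall x, `|g x| <= k * S (Y2 t *: x)) -> (forall x, cube (3 / 2 * rho) (Y2 t *: x) -> g x = 0) ->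
  [/\ sqintegrable (leb d) g, n2 (leb d) g <= k * (2 ^+ d * n2 (leb d) S) &
      forall x, g x = ind x * g x].
Proof.
move=> k0 mg gS g0.
have [s1 h1] := n2_dilate (Yhalf t) sS.
have [s2 h2] := n2_ger0_norm k s1.
have [s3 h3] : sqintegrable (leb d) g /\ n2 (leb d) g <= n2 (leb d) (fun x => k * S (Y2 t *: x)).
  by apply: le_sqintegrable => // x; apply: (le_trans (gS x)); exact: ler_norm.
split => //.
  by apply: (le_trans h3); rewrite h2 (ger0_norm k0) ler_wpM2l.
move=> x; rewrite /ind indicE; case: (boolP (x \in _)) => [_|]; first by rewrite -[LHS]mul1r.
rewrite in_setC negbK => /set_mem hx; rewrite mul0r g0// => i; rewrite !mxE normrM.
have [_ /andP[y1 y2]] := Yb t.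
have y0 : 0 <= Y2 t by apply: le_trans y1; rewrite invr_ge0.
by rewrite (ger0_norm y0); apply: ler_pM => //; exact: hx.
Qed.

Let lapW_vanish y : cube (3 / 2 * rho) y -> W y = 0 /\ lap W y = 0.
Proof.
move=> hy; have sp n := @smooth_psi R d n.
have sp1 i n : smooth n (partial i (@psi R d)) by have [_] := sp n.+1; apply.
split.
  apply: (superpose_vanish c _ far hy).
  by have [s0 _ _] := @psi_supported R d (Ordinal d0).
rewrite /lap big1 // => i _; rewrite /W.
rewrite partial_superpose; last exact: sp.
rewrite partial_superpose; last exact: sp1.
apply: (superpose_vanish c _ far hy).
by have [_ _ s2] := @psi_supported R d i.
Qed.

Let N := 2 ^+ d * n2 (leb d) S.

Let w_dominated h t : (forall n, smooth1 n h) -> (forall s, `|h s| <= 1) ->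
  [/\ sqintegrable (leb d) (w h t), n2 (leb d) (w h t) <= C * N & forall x, w h t x = ind x * w h t x].
Proof.
move=> sh h1; apply: (@dominated _ C t); first exact: ltW.
- exact: mw.
- move=> x; rewrite /w /phased normrM -[leRHS]mul1r; apply: ler_pM => //.
  by have [] := WS (Y2 t *: x).
- by move=> x /lapW_vanish[w0 _]; rewrite /w /phased w0 mulr0.
Qed.

(** 2 d bounds the factor 2 d |Y1|, and 3 bounds Y2^2 <= 9/4. *)
Let Ce := K1 * (C * (2 * d%:R + 3)).

Let Ce0 : 0 <= Ce.
Proof. by rewrite /Ce !mulr_ge0// ?addr_ge0// ?mulr_ge0// ltW. Qed.

Let e_bound t x (p q : R) : 0 <= t <= T -> `|p| <= 1 -> `|q| <= 1 ->
  `|k1 t * (d%:R * (2 * Y1 t) * (p * W (Y2 t *: x)) + Y2 t ^+ 2 * (q * lap W (Y2 t *: x)))| <= Ce * S (Y2 t *: x).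
Proof.
move=> ht p1 q1; have /andP[k0 kK] := k1K ht.
have [y1 /andP[y2 y3]] := Yb t.
have [w1 w2] := WS (Y2 t *: x); have s0 := S0 (Y2 t *: x).
have hk : `|k1 t| <= K1 by rewrite ger0_norm.
rewrite /Ce normrM -[leRHS]mulrA; apply: ler_pM => //.
have y20 : 0 <= Y2 t by apply: le_trans y2; rewrite invr_ge0.
have ys : Y2 t ^+ 2 <= 3.
  by nra.
have a1 : `|d%:R * (2 * Y1 t) * (p * W (Y2 t *: x))| <= 2 * d%:R * (C * S (Y2 t *: x)).
  rewrite 2!normrM; apply: ler_pM => //.
    rewrite normr_nat mulrC normrM (ger0_norm (_ : 0 <= 2 :> R))// -mulrA ler_wpM2l//.
    by rewrite -[leRHS]mul1r; apply: ler_pM.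
  by rewrite normrM -[leRHS]mul1r; apply: ler_pM.
have a2 : `|Y2 t ^+ 2 * (q * lap W (Y2 t *: x))| <= 3 * (C * S (Y2 t *: x)).
  rewrite normrM; apply: ler_pM => //; first by rewrite ger0_norm// sqr_ge0.
  by rewrite normrM -[leRHS]mul1r; apply: ler_pM.
apply: (le_trans (ler_normD _ _)).
rewrite (_ : C * _ * _ = 2 * d%:R * (C * S (Y2 t *: x)) + 3 * (C * S (Y2 t *: x))); last by ring.
exact: lerD.
Qed.

Let e1_dominated t : 0 <= t <= T ->
  [/\ sqintegrable (leb d) (e1 t), n2 (leb d) (e1 t) <= Ce * N & forall x, e1 t x = ind x * e1 t x].
Proof.
move=> ht; apply: (@dominated _ Ce t) => //.
- by move=> x; apply: e_bound => //; [exact: norm_cos_le1|exact: norm_sin_le1].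
- by move=> x /lapW_vanish[w0 l0]; rewrite /e1 /w /phased w0 l0 !mulr0 addr0 mulr0.
Qed.

Let e2_dominated t : 0 <= t <= T ->
  [/\ sqintegrable (leb d) (e2 t), n2 (leb d) (e2 t) <= Ce * N & forall x, e2 t x = ind x * e2 t x].
Proof.
move=> ht; apply: (@dominated _ Ce t) => //.
- move=> x; rewrite /e2 -mulrN -mulNr; apply: e_bound => //; first exact: norm_sin_le1.
  by rewrite normrN norm_cos_le1.
- by move=> x /lapW_vanish[w0 l0]; rewrite /e2 /w /phased w0 l0 !mulr0 subr0 mulr0.
Qed.

(** The Schrodinger operator is symmetric: its contributions through u' and through the derivative
    of w cancel, and only the residual is paired with u. *)
Let is_derive_I t : 0 < t < tau ->
  is_derive t (1 : R) (fun s => I1 s + I2 s)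
    (\int[leb d]_x (complex.Re (u t x) * e1 t x) + \int[leb d]_x (complex.Im (u t x) * e2 t x)).
Proof.
move=> /[dup] ht /andP[t0 ttau].
have t01 : 0 <= t <= tau by rewrite !ltW.
have tT := inT ht.
have tT' : 0 < t <= T by rewrite t0 (le_trans (ltW ttau)).
have [q1 q2] := quo t01.
have [M1 [w1b w1d]] := packet_time_bound smooth_cos cos_bounds.1 cos_bounds.2.
have [M2 [w2b w2d]] := packet_time_bound smooth_sin sin_bounds.1 sin_bounds.2.
have mK : measurable K by exact: measurable_cube.
have Koo : (leb d K < +oo)%E by exact: leb_cube_lty.
have D1 := @is_derive_pairing _ _ R (leb d) (fun s x => complex.Re (u s x)) (fun x => complex.Re (u' t x))
  (w cos) K M1 tau t t0 ttau (fun s hs => pRe (inT' hs)) (pRe' tT) q1 mK Koo (mw smooth_cos)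
  (fun s x _ => w1b s x) (fun s x hs => (w1d s x hs).1) (fun s x hs => (w1d s x hs).2).
have D2 := @is_derive_pairing _ _ R (leb d) (fun s x => complex.Im (u s x)) (fun x => complex.Im (u' t x))
  (w sin) K M2 tau t t0 ttau (fun s hs => pIm (inT' hs)) (pIm' tT) q2 mK Koo (mw smooth_sin)
  (fun s x _ => w2b s x) (fun s x hs => (w2d s x hs).1) (fun s x hs => (w2d s x hs).2).
apply: (is_derive_eq (is_deriveD D1 D2)).
have tp1 := tpw t smooth_cos; have tp2 := tpw t smooth_sin.
have [P1 _] := schrodinger_pairing (uB tT) (u'L2 tT) tp1 (eqn tT').
have [_ P2] := schrodinger_pairing (uB tT) (u'L2 tT) tp2 (eqn tT').
rewrite P1 P2.
have [_ _ l1 qw1] := test_profile_sqintegrable tp1.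
have [_ _ l2 qw2] := test_profile_sqintegrable tp2.
have [se1 _ _] := e1_dominated tT; have [se2 _ _] := e2_dominated tT.
have h1 : sqintegrable (leb d) (fun x => k1 t * lap (w sin t) x - k2 t * (qf x * w sin t x)).
  exact: (sqintegrableB (n2_ger0_norm (k1 t) l2).1 (n2_ger0_norm (k2 t) qw2).1).
have h2 : sqintegrable (leb d) (fun x => - k1 t * lap (w cos t) x + k2 t * (qf x * w cos t x)).
  exact: (n2_triangle (n2_ger0_norm (- k1 t) l1).1 (n2_ger0_norm (k2 t) qw1).1).1.
have E1 : \int[leb d]_x (complex.Re (u t x) * derive1 (fun s => w cos s x) t) =
    \int[leb d]_x (complex.Re (u t x) * e1 t x) -
    \int[leb d]_x (complex.Re (u t x) * (k1 t * lap (w sin t) x - k2 t * (qf x * w sin t x))).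
  rewrite -RintegralB//.
  - by apply: eq_Rintegral => x _; rewrite dcos// mulrBr.
  - exact: (CauchySchwarz (pRe tT) se1).1.
  - exact: (CauchySchwarz (pRe tT) h1).1.
have E2 : \int[leb d]_x (complex.Im (u t x) * derive1 (fun s => w sin s x) t) =
    \int[leb d]_x (complex.Im (u t x) * e2 t x) -
    \int[leb d]_x (complex.Im (u t x) * (- k1 t * lap (w cos t) x + k2 t * (qf x * w cos t x))).
  rewrite -RintegralB//.
  - by apply: eq_Rintegral => x _; rewrite dsin// mulrBr.
  - exact: (CauchySchwarz (pIm tT) se2).1.
  - exact: (CauchySchwarz (pIm tT) h2).1.
rewrite E1 E2; ring.
Qed.

(** Measured outside a cube instead of on omega: the cube is measurable, and once it contains the
    closure of Omega its complement lies in omega. *)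
Definition outer_energy t : R :=
  n2 (leb d) (fun x => \1_(~` cube rho) x * complex.Re (u t x)) ^+ 2 +
  n2 (leb d) (fun x => \1_(~` cube rho) x * complex.Im (u t x)) ^+ 2.

Let a t := n2 (leb d) (fun x => ind x * complex.Re (u t x)).
Let b t := n2 (leb d) (fun x => ind x * complex.Im (u t x)).

Let mind : measurable_fun setT ind.
Proof. by apply: measurable_indic; apply: measurableC; exact: measurable_cube. Qed.

Let ind_le (f : 'rV[R]_d -> R) : sqintegrable (leb d) f ->
  sqintegrable (leb d) (fun x => ind x * f x) /\ n2 (leb d) (fun x => ind x * f x) <= n2 (leb d) f.
Proof.
move=> sf; apply: le_sqintegrable => //; first by apply: measurable_funM => //; exact: sf.1.
move=> x; rewrite normrM /ind indicE; case: (_ \in _); first by rewrite normr1 mul1r.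
by rewrite normr0 mul0r.
Qed.

(** If g vanishes on the cube, only the part of f outside it enters Cauchy-Schwarz. Here the
    observation region appears. *)
Let ind_pairing (f g : 'rV[R]_d -> R) : sqintegrable (leb d) f -> sqintegrable (leb d) g ->
  (forall x, g x = ind x * g x) ->
  `|\int[leb d]_x (f x * g x)| <= n2 (leb d) (fun x => ind x * f x) * n2 (leb d) g.
Proof.
move=> sf sg gi; rewrite (_ : \int[leb d]_x (f x * g x) = \int[leb d]_x (ind x * f x * g x)).
  exact: (CauchySchwarz (ind_le sf).1 sg).2.
by apply: eq_Rintegral => x _; rewrite {1}gi mulrCA mulrA.
Qed.

(** Reverse triangle inequality, cutting off by [ind] being a contraction of L^2. *)
Let n2_ind_continuous (P : R -> 'rV[R]_d -> R) :
  (forall s, `[0, tau]%classic s -> sqintegrable (leb d) (P s)) ->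
  (forall t, `[0, tau]%classic t -> n2 (leb d) (fun x => P s x - P t x) @[s --> within `[0, tau]%classic (nbhs t)] --> (0 : R)) ->
  {within `[0, tau], continuous (fun s => n2 (leb d) (fun x => ind x * P s x))}.
Proof.
move=> sP cP; apply/subspace_continuousP => t ht.
have tri s s' : `[0, tau]%classic s -> `[0, tau]%classic s' ->
    n2 (leb d) (fun x => ind x * P s x) - n2 (leb d) (fun x => ind x * P s' x) <= n2 (leb d) (fun x => P s x - P s' x).
  move=> hs hs'; have sd := sqintegrableB (sP s hs) (sP s' hs').
  have [si hi] := ind_le sd.
  have [_ h] := n2_triangle si (ind_le (sP s' hs')).1.
  have e : ((fun x => ind x * (P s x - P s' x)) \+ (fun x => ind x * P s' x)) = (fun x => ind x * P s x).
    by apply/funext => x /=; rewrite -mulrDr subrK.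
  rewrite e in h; rewrite lerBlDr; apply: (le_trans h); by rewrite lerD2r.
apply/cvgrPdist_le => e e0.
move/cvgrPdist_le : (cP t ht) => /(_ e e0); rewrite !near_withinE; apply: filterS => s h hs.
have := h hs; rewrite sub0r normrN ger0_norm ?n2_ge0// => hb.
have t1 := tri s t hs ht.
have t2 := tri t s ht hs.
have sym : n2 (leb d) (fun x => P t x - P s x) = n2 (leb d) (fun x => P s x - P t x).
  have -> : (fun x => P t x - P s x) = (fun x => -1 * (P s x - P t x)).
    by apply/funext => x; rewrite mulN1r opprB.
  by rewrite (n2_ger0_norm (-1) (sqintegrableB (sP s hs) (sP t ht))).2 normrN1 mul1r.
rewrite sym in t2.
rewrite ler_norml; apply/andP; split; last exact: (le_trans t2 hb).
by rewrite lerNl opprB; exact: (le_trans t1 hb).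
Qed.

Let L2c t : `[0, tau]%classic t ->
  n2 (leb d) (fun x => complex.Re (u s x) - complex.Re (u t x)) @[s --> within `[0, tau]%classic (nbhs t)] --> (0 : R) /\
  n2 (leb d) (fun x => complex.Im (u s x) - complex.Im (u t x)) @[s --> within `[0, tau]%classic (nbhs t)] --> (0 : R).
Proof.
move=> ht; have ht' : 0 <= t <= tau by move: ht; rewrite /= in_itv.
have [q1 q2] := quo ht'.
split.
- apply: (n2_cvg_of_quotient ht _ (pRe' (inT' ht')) q1) => s.
  by rewrite /= in_itv /= => hs; exact: (pRe (inT' hs)).
- apply: (n2_cvg_of_quotient ht _ (pIm' (inT' ht')) q2) => s.
  by rewrite /= in_itv /= => hs; exact: (pIm (inT' hs)).
Qed.

(** Continuity in time makes the energy integrable and its integral differentiable. *)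
Lemma outer_energy_continuous : {within `[0, tau], continuous outer_energy}.
Proof.
have ca : {within `[0, tau], continuous a}.
  apply: (@n2_ind_continuous (fun s x => complex.Re (u s x))).
  - by move=> s; rewrite /= in_itv /= => hs; exact: (pRe (inT' hs)).
  - by move=> t ht; exact: (L2c ht).1.
have cb : {within `[0, tau], continuous b}.
  apply: (@n2_ind_continuous (fun s x => complex.Im (u s x))).
  - by move=> s; rewrite /= in_itv /= => hs; exact: (pIm (inT' hs)).
  - by move=> t ht; exact: (L2c ht).2.
have -> : outer_energy = (fun t => a t * a t + b t * b t) by apply/funext => t; rewrite /outer_energy !expr2.
move=> t; apply: cvgD; first exact: cvgM (ca t) (ca t).
exact: cvgM (cb t) (cb t).
Qed.

Let w_continuous h x : smooth1 0 h -> continuous (fun s => w h s x).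
Proof.
move=> sh s; rewrite /w /phased.
have ch := smooth1_continuous 0 _ sh.
apply: cvgM.
  apply: (@continuous_comp _ _ _ (fun s => Y1 s * qf x) h); last exact: ch.
  by apply: cvgM; [exact: cY1|exact: cvg_cst].
apply: (@continuous_comp _ _ _ Y2 (fun y => W (y *: x))); first exact: cY2.
apply: differentiable_continuous.
apply: (@differentiable_comp _ _ _ _ (fun y : R => y *: x) W); first exact: differentiableZl.
by have [] := sW 0.
Qed.

Let I_continuous : {within `[0, tau], continuous (fun s => I1 s + I2 s)}.
Proof.
have [M1 [w1b _]] := packet_time_bound smooth_cos cos_bounds.1 cos_bounds.2.
have [M2 [w2b _]] := packet_time_bound smooth_sin sin_bounds.1 sin_bounds.2.
have mK : measurable K by exact: measurable_cube.
have Koo : (leb d K < +oo)%E by exact: leb_cube_lty.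
apply/subspace_continuousP => t ht; apply: cvgD.
- apply: (@pairing_continuous _ _ R (leb d) `[0, tau]%classic (fun s x => complex.Re (u s x)) (w cos) K M1 t) => //.
  + by move=> s; rewrite /= in_itv /= => hs; exact: (pRe (inT' hs)).
  + exact: (L2c ht).1.
  + exact: mw.
  + by move=> x; exact: w_continuous.
- apply: (@pairing_continuous _ _ R (leb d) `[0, tau]%classic (fun s x => complex.Im (u s x)) (w sin) K M2 t) => //.
  + by move=> s; rewrite /= in_itv /= => hs; exact: (pIm (inT' hs)).
  + exact: (L2c ht).2.
  + exact: mw.
  + by move=> x; exact: w_continuous.
Qed.

(** 2^d is the cost of the dilation, C / tau comes from differentiating the cutoff 1 - t/tau, and
    the term with K1 from the residual. *)
Definition evolution_const : R :=
  2 ^+ d * (C / tau + K1 * (C * (2 * d%:R + 3))) * n2 (leb d) (superpose c z kap).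

(** With a and b the outer norms of the real and imaginary parts of u(t), every pairing is bounded
    by a or b times a constant, and a + b <= lam / 2 + (a^2 + b^2) / lam leaves only the squared
    energy. *)
Let J_derive_bound t lam : 0 < t < tau -> 0 < lam ->
  `|- tau^-1 * (I1 t + I2 t) + (1 - t / tau) * (\int[leb d]_x (complex.Re (u t x) * e1 t x) + \int[leb d]_x (complex.Im (u t x) * e2 t x))|
  <= evolution_const * (lam / 2 + outer_energy t / lam).
Proof.
move=> /[dup] ht /andP[t0 tt] lam0; have tT := inT ht.
have [s1 n1 i1] := w_dominated t smooth_cos cos_bounds.1.
have [s2 n2' i2] := w_dominated t smooth_sin sin_bounds.1.
have [s3 n3 i3] := e1_dominated tT.
have [s4 n4 i4] := e2_dominated tT.
have a0 : 0 <= a t by exact: n2_ge0.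
have b0 : 0 <= b t by exact: n2_ge0.
have B1 : `|I1 t| <= a t * (C * N) by apply: (le_trans (ind_pairing (pRe tT) s1 i1)); rewrite ler_wpM2l.
have B2 : `|I2 t| <= b t * (C * N) by apply: (le_trans (ind_pairing (pIm tT) s2 i2)); rewrite ler_wpM2l.
have B3 : `|\int[leb d]_x (complex.Re (u t x) * e1 t x)| <= a t * (Ce * N).
  by apply: (le_trans (ind_pairing (pRe tT) s3 i3)); rewrite ler_wpM2l.
have B4 : `|\int[leb d]_x (complex.Im (u t x) * e2 t x)| <= b t * (Ce * N).
  by apply: (le_trans (ind_pairing (pIm tT) s4 i4)); rewrite ler_wpM2l.
have ti0 : 0 < tau^-1 by rewrite invr_gt0.
have tt1 : 0 <= 1 - t / tau <= 1.
  have h1 : 0 <= t / tau by apply: divr_ge0; exact: ltW.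
  have h2 : t / tau <= 1 by rewrite ler_pdivrMr ?mul1r ?(ltW tt).
  by apply/andP; split; lra.
have N0 : 0 <= N by rewrite /N mulr_ge0 ?exprn_ge0 ?n2_ge0.
have CeN : 0 <= Ce * N by rewrite mulr_ge0.
have step : (a t + b t) * (tau^-1 * (C * N) + Ce * N) <= evolution_const * (lam / 2 + outer_energy t / lam).
  have -> : tau^-1 * (C * N) + Ce * N = evolution_const by rewrite /evolution_const /N /Ce; ring.
  have G0 : 0 <= evolution_const.
    rewrite /evolution_const; apply: mulr_ge0; last exact: n2_ge0.
    apply: mulr_ge0; first exact: exprn_ge0.
    by apply: addr_ge0 => //; rewrite mulr_ge0// ltW.
  rewrite mulrC; apply: ler_wpM2l => //.
  have -> : outer_energy t = a t ^+ 2 + b t ^+ 2 by [].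
  rewrite -(ler_pM2r lam0) [leRHS]mulrDl divfK ?gt_eqF//.
  have : 0 <= (lam - (a t + b t)) ^+ 2 by exact: sqr_ge0.
  have : 0 <= (a t - b t) ^+ 2 by exact: sqr_ge0.
  by nra.
apply: (le_trans _ step).
apply: (le_trans (ler_normD _ _)); rewrite [leRHS]mulrDr; apply: lerD.
  rewrite normrM normrN (gtr0_norm ti0) [leRHS]mulrCA; apply: ler_wpM2l; first exact: ltW.
  by apply: (le_trans (ler_normD _ _)); rewrite [leRHS]mulrDl lerD.
have /andP[tt2 tt3] := tt1.
rewrite normrM (ger0_norm tt2) -[leRHS]mul1r; apply: ler_pM => //.
by apply: (le_trans (ler_normD _ _)); rewrite [leRHS]mulrDl lerD.
Qed.

(** [J_derive_bound] integrated over [0, tau]: the cutoff is 1 at time 0, where the pairing is that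
    of the datum with W, and 0 at tau. *)
Lemma evolution_bound (lam : R) : 0 < lam ->
  lebesgue_measure.-integrable `[0, tau] (EFin \o outer_energy) /\
  \int[leb d]_x (complex.Re (u 0 x) * superpose c z psi x) <=
  evolution_const * (lam * tau / 2 + (\int[lebesgue_measure]_(t in `[0, tau]) outer_energy t) / lam).
Proof.
move=> lam0.
(* Frozen outside [0, tau], the energy is continuous on the line, as the fundamental theorem of
   calculus is applied to it. *)
pose E s := outer_energy (clamp 0 tau s).
have cE : continuous E by apply: continuous_clamp; [exact: ltW|exact: outer_energy_continuous].
have EE s : s \in `[0, tau]%classic -> E s = outer_energy s.
  by rewrite inE /= in_itv /= => hs; rewrite /E clamp_id.
have iE : lebesgue_measure.-integrable `[0, tau] (EFin \o E).
  apply: continuous_compact_integrable; first exact: segment_compact.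
  exact: continuous_subspaceT.
have iE' : lebesgue_measure.-integrable `[0, tau] (EFin \o outer_energy).
  by apply: eq_integrable iE => // s hs; rewrite /= EE.
split => //.
pose M t := \int[lebesgue_measure]_(s in `[0, t]) E s.
have cM : {within `[0, tau], continuous M}.
  exact: (parameterized_integral_continuous (ltW tau0) iE).
have dM t : 0 < t < tau -> is_derive t (1 : R) M (E t).
  move=> /andP[t0 tt].
  have [h1 h2] := @continuous_FTC1_closed R E 0 t tau tt iE t0 (cE t).
  by apply: DeriveDef; [exact: h1|rewrite -derive1E; exact: h2].
have eM : \int[lebesgue_measure]_(t in `[0, tau]) outer_energy t = M tau.
  by apply: eq_Rintegral => s hs; rewrite EE.
rewrite eM.
(* A primitive of the bound is added to the cut-off pairing, so that the derivative of [Phi] is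
   nonnegative. *)
pose Phi t := (1 - t / tau) * (I1 t + I2 t) + evolution_const * (lam / 2 * t + M t / lam).
pose dPhi t := (- tau^-1 * (I1 t + I2 t) + (1 - t / tau) * (\int[leb d]_x (complex.Re (u t x) * e1 t x) + \int[leb d]_x (complex.Im (u t x) * e2 t x)))
  + evolution_const * (lam / 2 + E t / lam).
have dP t : t \in `]0, tau[%R -> is_derive t (1 : R) Phi (dPhi t).
  rewrite in_itv /= => ht.
  have h1 : is_derive t (1 : R) (fun t => 1 - t / tau) (- tau^-1).
    have h := is_deriveB (is_derive_cst (1:R) t (1:R)) (is_deriveZ tau^-1 (is_derive_id t (1:R))).
    have -> : (fun t => 1 - t / tau) = (cst 1 - tau^-1 *: id) :> (R -> R).
      by apply/funext => s; rewrite [s / tau]mulrC.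
    by apply: (is_derive_eq h); rewrite [_ *: _]mulr1 sub0r.
  have h2 := is_deriveM h1 (is_derive_I ht).
  have h3 : is_derive t (1 : R) (fun t => lam / 2 * t + M t / lam) (lam / 2 + E t / lam).
    have h := is_deriveD (is_deriveZ (lam / 2) (is_derive_id t (1:R))) (is_deriveZ lam^-1 (dM t ht)).
    have -> : (fun t => lam / 2 * t + M t / lam) = ((lam / 2) *: id + lam^-1 *: M) :> (R -> R).
      by apply/funext => s; rewrite [M s / lam]mulrC.
    by apply: (is_derive_eq h); rewrite [_ *: 1]mulr1 [E t / _]mulrC.
  have h4 := is_deriveD h2 (is_deriveZ evolution_const h3).
  apply: (is_derive_eq h4); rewrite /dPhi /GRing.scale /=; ring.
have cP : {within `[0, tau], continuous Phi}.
  have c1 : continuous (fun t : R => 1 - t / tau).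
    by move=> t; apply: cvgB; [exact: cvg_cst|apply: cvgM; [exact: cvg_id|exact: cvg_cst]].
  have c2 : continuous (fun t : R => lam / 2 * t).
    by move=> t; apply: cvgM; [exact: cvg_cst|exact: cvg_id].
  move=> t; apply: cvgD.
    by apply: cvgM; [exact: (continuous_subspaceT c1)|exact: I_continuous].
  apply: cvgM; first exact: cvg_cst.
  apply: cvgD; first exact: (continuous_subspaceT c2).
  by apply: cvgM; [exact: cM|exact: cvg_cst].
have [t] := MVT tau0 dP cP.
rewrite in_itv /= => ht; rewrite subr0 => mvt.
have pos : 0 <= dPhi t.
  have := J_derive_bound ht lam0; have -> : outer_energy t = E t.
    apply/esym/EE; rewrite inE /= in_itv /=; case/andP: ht => p q.
    by rewrite (ltW p) (ltW q).
  by rewrite /dPhi ler_norml => /andP[h _]; rewrite addrC -[X in _ + X]opprK subr_ge0 lerNl.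
have : Phi 0 <= Phi tau.
  by rewrite -subr_ge0 mvt; apply: mulr_ge0; [exact: pos|exact: ltW].
have -> : Phi 0 = \int[leb d]_x (complex.Re (u 0 x) * superpose c z psi x).
  have M0 : M 0 = 0 by rewrite /M set_itv1 Rintegral_set1.
  rewrite /Phi M0 mul0r subr0 mul1r mulr0 mul0r addr0 mulr0 addr0.
  (* At time 0 the phase vanishes and the packet is the real function W. *)
  have -> : I2 0 = 0.
    transitivity (\int[leb d]_(x in [set: 'rV[R]_d]) (0 : R)); last by rewrite /Rintegral integral0.
    by apply: eq_Rintegral => x _; rewrite /w /phased Y10 mul0r sin0 mul0r mulr0.
  rewrite addr0 /I1; apply: eq_Rintegral => x _.
  by rewrite /w /phased Y10 Y20 mul0r cos0 mul1r scale1r.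
rewrite /Phi (divff (lt0r_neq0 tau0)) subrr mul0r add0r => h; apply: (le_trans h).
by have -> : lam * tau / 2 = lam / 2 * tau by ring.
Qed.

End evolution.

(** * Gaussian sums *)

Section gaussian_packets.
Context {R : realType} {d : nat}.
Local Notation normc := (@ComplexField.Normc.normc _).

Lemma superpose_le (I : finType) (c : I -> R) (q z : I -> 'rV[R]_d) (g h : 'rV[R]_d -> R) (K : R) x :
  (forall n, 0 <= c n) -> (forall n, g (x - q n) <= K * h (x - z n)) ->
  superpose c q g x <= K * superpose c z h x.
Proof.
move=> c0 gh; rewrite /superpose mulr_sumr; apply: ler_sum => n _.
by rewrite mulrCA ler_wpM2l.
Qed.

Lemma sqintegrable_box : sqintegrable (leb d) (@box R d).
Proof.
have := sqintegrable_indic (mu := leb d) 1 (measurable_cube R d 2^-1) (leb_cube_lty R d 2^-1).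
by congr sqintegrable; apply/funext => x; rewrite mul1r.
Qed.

Definition young_const : R := kapA d * fine (\int[leb d]_x (@kap R d x)%:E).

Lemma young_const_gt0 : 0 < young_const.
Proof.
rewrite /young_const mulr_gt0 ?kapA_gt0// fine_gt0// integral_kap_lty andbT.
exact: integral_kap_gt0.
Qed.

Lemma n2_superpose_kap (I : finType) (c : I -> R) (z : I -> 'rV[R]_d) : (forall n, 0 <= c n) ->
  n2 (leb d) (superpose c z kap) <= young_const * n2 (leb d) (superpose c z box).
Proof.
move=> c0; have sS := sqintegrable_superpose c z (@sqintegrable_kap R d).
have sF := sqintegrable_superpose c z sqintegrable_box.
have := integral_superpose_kap_sqr R d I c z c0.
have fk : (\int[leb d]_x (@kap R d x)%:E)%E \is a fin_num.
  by rewrite ge0_fin_numE ?integral_kap_lty// ltW// integral_kap_gt0.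
have -> : (\int[leb d]_x (superpose c z kap x ^+ 2)%:E = (n2 (leb d) (superpose c z kap) ^+ 2)%:E)%E by rewrite n2_sqr.
have -> : (\int[leb d]_x (superpose c z box x ^+ 2)%:E = (n2 (leb d) (superpose c z box) ^+ 2)%:E)%E by rewrite n2_sqr.
rewrite -(fineK fk) -EFin_expe -!EFinM lee_fin -!exprMn => h.
rewrite -(@ler_pXn2r _ 2) ?nnegrE ?mulr_ge0 ?n2_ge0//.
- exact: ltW (kapA_gt0 R d).
- by apply: fine_ge0; exact: ltW (integral_kap_gt0 R d).
Qed.

Definition gauss (x : 'rV[R]_d) : R := expR (- enorm x ^+ 2).

(** In each coordinate, 1 + s^2 <= exp (s^2). *)
Lemma gauss_le_kap (x : 'rV[R]_d) : gauss x <= kap x.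
Proof.
rewrite /gauss qf_enorm /qf -sumrN expR_sum; apply: ler_prod => i _.
rewrite expR_ge0 /= expRN lef_pV2 ?posrE ?expR_gt0//.
exact: expR_ge1Dx.
Qed.

Lemma sqintegrable_gauss : sqintegrable (leb d) gauss.
Proof.
apply: (le_sqintegrable (g := kap) _ (@sqintegrable_kap R d) _).1.
  have -> : gauss = expR \o (fun x => - qf x) by apply/funext => x; rewrite /gauss qf_enorm.
  apply: (measurableT_comp (f := @expR R)).
    by apply: continuous_measurable_fun; exact: continuous_expR.
  by apply: measurable_funN; exact: measurable_qf.
by move=> x; rewrite !ger0_norm ?expR_ge0 ?gauss_le_kap ?kap_ge0.
Qed.

(** The upper comparison between the original center q and the moved center z; [box_le_gauss_shift]
    is the lower one. *)
Lemma gauss_shift_le_kap (r : R) (x q z : 'rV[R]_d) : (forall i, `|q ord0 i - z ord0 i| <= r) ->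
  gauss (x - q) <= (2 * (1 + r ^+ 2)) ^+ d * kap (x - z).
Proof.
move=> h; apply: (le_trans (gauss_le_kap _)); apply: kap_near => i.
rewrite !mxE [leLHS](_ : _ = `|q ord0 i - z ord0 i|)// -normrN; congr `|_|; ring.
Qed.

(** On the unit cube around z each coordinate of x - q is at most r + 1/2, rounded up to r + 1. *)
Lemma box_le_gauss_shift (r : R) (x q z : 'rV[R]_d) : (forall i, `|q ord0 i - z ord0 i| <= r) ->
  expR (- (d%:R * (r + 1) ^+ 2)) * box (x - z) <= gauss (x - q).
Proof.
move=> h; rewrite /box /= indicE; have [/set_mem hb|_] := boolP (_ \in _); last by rewrite mulr0 expR_ge0.
rewrite mulr1 /gauss ler_expR lerN2 qf_enorm /qf.
have -> : d%:R * (r + 1) ^+ 2 = \sum_(i < d) (r + 1) ^+ 2 by rewrite sumr_const card_ord mulr_natl.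
apply: ler_sum => i _; rewrite -real_normK ?num_real// lerXn2r ?nnegrE//.
  by apply: (le_trans (normr_ge0 _) (le_trans (h i) _)); rewrite lerDl.
have := hb i; have := h i; rewrite !mxE.
have -> : x ord0 i - q ord0 i = (x ord0 i - z ord0 i) - (q ord0 i - z ord0 i) by ring.
move=> h1 h2; apply: (le_trans (ler_normB _ _)); rewrite addrC lerD//.
by apply: (le_trans h2); rewrite invf_le1// ler1n.
Qed.

Lemma gaussian_sumE N (a : midx d N -> 'rV[R]_d) (c : midx d N -> R) :
  gaussian_sum a c = superpose (fun n => if (mdeg n <= N)%N then c n else 0) (fun n => - a n) gauss.
Proof.
apply/funext => x; rewrite /gaussian_sum /superpose big_mkcond/=; apply: eq_bigr => n _.
by case: ifP => _; rewrite ?mul0r// opprK.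
Qed.

Lemma n2_sqrE (f : 'rV[R]_d -> R) : sqintegrable (leb d) f ->
  n2 (leb d) f ^+ 2 = \int[leb d]_x (f x * f x).
Proof.
move=> sf; apply: EFin_inj; rewrite n2_sqr// /sqint /Rintegral fineK.
  by apply: eq_integral => x _; rewrite expr2.
exact: (integrable_fin_num measurableT (CauchySchwarz sf sf).1).
Qed.

(** As g is real, the complex L^2 error controls the error of the real part of v, and the triangle
    inequality gives the bound on the norm of v. *)
Lemma L2norm_le_approx (v : 'rV[R]_d -> R[i]) (g : 'rV[R]_d -> R) (eta : R) :
  inL2 v -> sqintegrable (leb d) g -> (L2norm (fun x => (v x - (g x)%:C%C)%R) <= eta%:E)%E ->
  n2 (leb d) (fun x => complex.Re (v x) - g x) <= eta /\
  (L2norm v - eta%:E <= (n2 (leb d) g)%:E)%E.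
Proof.
move=> vL2 sg le_eta; have [sr si e] := inL2_sqintegrable vL2.
pose e0 x : R[i] := v x - (g x)%:C%C.
have eR : (fun x => complex.Re (e0 x)) = (fun x => complex.Re (v x) - g x).
  by apply/funext => x; rewrite /e0 ReD ReN.
have eI : (fun x => complex.Im (e0 x)) = (fun x => complex.Im (v x)).
  by apply/funext => x; rewrite /e0 ImD ImN /= oppr0 addr0.
have L2e : inL2 e0.
  by apply: sqintegrable_inL2; rewrite ?eR ?eI//; exact: sqintegrableB.
have [_ _ en] := inL2_sqintegrable L2e.
have [h1 _] := n2_reim_le L2e.
move: le_eta; rewrite -/e0 en lee_fin => le_eta.
split; first by rewrite -eR; apply: (le_trans h1); rewrite en.
rewrite e -EFinB lee_fin lerBlDl.
have sn := sqintegrable_normc L2e.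
have abs_g : sqintegrable (leb d) (fun x => `|g x|).
  apply: (le_sqintegrable _ sg _).1; last by move=> x; rewrite normr_id.
  by apply: measurableT_comp; [exact: normr_measurable|exact: sg.1].
have [st ht] := n2_triangle sn abs_g.
apply: (le_trans (le_sqintegrable (sqintegrable_normc vL2).1 st _).2).
  move=> x; rewrite [leLHS]ger0_norm ?sqrtr_ge0// [leRHS]ger0_norm ?addr_ge0 ?sqrtr_ge0//=.
  have nE (w : R[i]) : normc w = Num.sqrt (complex.Re w ^+ 2 + complex.Im w ^+ 2) by case: w.
  rewrite /reim2 -!nE (_ : `|g x| = normc (g x)%:C%C); last by rewrite nE /= expr0n addr0 sqrtr_sqr.
  by have := le_normcD (e0 x) (g x)%:C%C; rewrite {1}/e0 subrK.
apply: (le_trans ht); apply: lerD => //.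
apply: (le_sqintegrable abs_g.1 sg _).2 => x; by rewrite normr_id.
Qed.

End gaussian_packets.

(** * From the observed energy to the size of the packet *)

Section observation.
Context {R : realType} {d : nat}.
Local Notation normc := (@ComplexField.Normc.normc _).

(** Both g and W lie above multiples of the sum of boxes F, so c1 c2 |F|^2 <= <g, W>. This is at
    most <f, W> + eta C N, the error of replacing f by g. Since N <= A |F| by Young's inequality,
    N^2 is bounded by a multiple of N (Y + eta), and one factor N is divided out. *)
Lemma n2_packet_bound (I : finType) (c : I -> R) (z : I -> 'rV[R]_d) (f g : 'rV[R]_d -> R)
    (C c1 c2 G eta tau M Y : R) :
  (forall n, 0 <= c n) -> sqintegrable (leb d) f -> sqintegrable (leb d) g ->
  0 < C -> 0 < c1 -> 0 < c2 -> 0 <= G -> 0 < eta -> 0 <= tau -> 0 <= Y -> M <= Y ^+ 2 ->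
  (forall x, `|superpose c z psi x| <= C * superpose c z kap x) ->
  (forall x, c1 * superpose c z box x <= g x) ->
  (forall x, c2 * superpose c z box x <= superpose c z psi x) ->
  n2 (leb d) (fun x => f x - g x) <= eta ->
  (forall lam, 0 < lam -> \int[leb d]_x (f x * superpose c z psi x) <=
    G * n2 (leb d) (superpose c z kap) * (lam * tau / 2 + M / lam)) ->
  n2 (leb d) (superpose c z kap) <=
    @young_const R d ^+ 2 / (c1 * c2) * (G * (tau / 2 + 1) + C) * (Y + eta).
Proof.
move=> c0 sf sg C0 c10 c20 G0 eta0 tau0 Y0 MY WS gF WF fg fW.
set W := superpose c z psi; set F := superpose c z box; set N := n2 _ _.
have sS := sqintegrable_superpose c z (@sqintegrable_kap R d).
have sF : sqintegrable (leb d) F := sqintegrable_superpose c z (@sqintegrable_box R d).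
have F0 x : 0 <= F x by apply: superpose_ge0 => // y; exact: box_ge0.
have S0 x : 0 <= superpose c z kap x by apply: superpose_ge0 => // y; exact: kap_ge0.
have [sCS nCS] := n2_ger0_norm C sS.
have [sW nW] : sqintegrable (leb d) W /\ n2 (leb d) W <= C * N.
  have mW : measurable_fun setT W.
    by apply: measurable_superpose; apply: measurable_tens => i; apply: (smooth1_continuous 0); exact: smooth1_bump.
  have [|s h] := le_sqintegrable mW sCS; last first.
    by split => //; apply: (le_trans h); rewrite nCS gtr0_norm.
  by move=> x; apply: (le_trans (WS x)); exact: ler_norm.
have N0 : 0 <= N by exact: n2_ge0.
have A0 := @young_const_gt0 R d.
set A := young_const in A0 *.
have NF : N <= A * n2 (leb d) F by exact: n2_superpose_kap.
have cc0 : 0 < c1 * c2 by exact: mulr_gt0.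
have lower : c1 * c2 * n2 (leb d) F ^+ 2 <= \int[leb d]_x (g x * W x).
  have iF := (CauchySchwarz (n2_ger0_norm c1 sF).1 (n2_ger0_norm c2 sF).1).1.
  have -> : c1 * c2 * n2 (leb d) F ^+ 2 = \int[leb d]_x ((c1 * F x) * (c2 * F x)).
    rewrite n2_sqrE// -RintegralZl//; last exact: (CauchySchwarz sF sF).1.
    by apply: eq_Rintegral => x _; ring.
  apply: le_Rintegral => //; first exact: (CauchySchwarz sg sW).1.
  by move=> x _; apply: ler_pM => //; rewrite mulr_ge0// ltW.
have upper : \int[leb d]_x (g x * W x) <= \int[leb d]_x (f x * W x) + eta * (C * N).
  have sd := sqintegrableB sf sg.
  have -> : \int[leb d]_x (g x * W x) = \int[leb d]_x (f x * W x) - \int[leb d]_x ((f x - g x) * W x).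
    rewrite -RintegralB//.
    - by apply: eq_Rintegral => x _; ring.
    - exact: (CauchySchwarz sf sW).1.
    - exact: (CauchySchwarz sd sW).1.
  rewrite lerD2l; apply: (le_trans (ler_norm _)); rewrite normrN.
  apply: (le_trans (CauchySchwarz sd sW).2).
  by apply: ler_pM => //; exact: n2_ge0.
(* The value given to lam; eta keeps it positive even when Y = 0. *)
have ye0 : 0 < Y + eta by rewrite ltr_wpDl.
have mid : (Y + eta) * tau / 2 + M / (Y + eta) <= (tau / 2 + 1) * (Y + eta).
  have : M / (Y + eta) <= Y + eta.
    rewrite ler_pdivrMr// -expr2; apply: (le_trans MY); rewrite lerXn2r ?nnegrE ?(ltW ye0)//.
    by rewrite lerDl ltW.
  by move=> h; rewrite [leRHS](_ : _ = (Y + eta) * tau / 2 + (Y + eta)) ?lerD2l//; ring.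
set Q := (G * (tau / 2 + 1) + C) * (Y + eta).
have key : c1 * c2 * n2 (leb d) F ^+ 2 <= N * Q.
  apply: (le_trans lower); apply: (le_trans upper).
  apply: (le_trans (lerD (fW _ ye0) (lexx _))).
  rewrite [leRHS](_ : _ = G * N * ((tau / 2 + 1) * (Y + eta)) + (Y + eta) * (C * N)); last by rewrite /Q; ring.
  apply: lerD; first by apply: ler_wpM2l => //; exact: mulr_ge0.
  by apply: ler_wpM2r; [rewrite mulr_ge0// ltW|rewrite lerDr].
have Q0 : 0 <= Q.
  by rewrite /Q mulr_ge0 ?(ltW ye0)// addr_ge0 ?(ltW C0)// mulr_ge0// addr_ge0// divr_ge0.
rewrite -[leRHS]mulrA -/Q mulrAC ler_pdivlMr//.
(* Dividing by N requires N to be positive; for N = 0 the claim is immediate. *)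
have [->|Nneq] := eqVneq N 0; first by rewrite mul0r mulr_ge0// sqr_ge0.
have Np : 0 < N by rewrite lt_neqAle eq_sym Nneq.
rewrite -(ler_pM2l Np).
apply: (@le_trans _ _ (A ^+ 2 * (c1 * c2 * n2 (leb d) F ^+ 2))).
  rewrite [leLHS](_ : _ = c1 * c2 * N ^+ 2); last by ring.
  rewrite [leRHS](_ : _ = c1 * c2 * (A * n2 (leb d) F) ^+ 2); last by ring.
  rewrite ler_wpM2l ?(ltW cc0)// lerXn2r ?nnegrE// mulr_ge0 ?(ltW A0)//; exact: n2_ge0.
rewrite [leRHS](_ : _ = A ^+ 2 * (N * Q)); last by ring.
by rewrite ler_wpM2l// sqr_ge0.
Qed.

Lemma outer_energy_le (rho : R) (om : set 'rV[R]_d) (u : R -> 'rV[R]_d -> R[i]) t :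
  ~` cube rho `<=` om -> inL2 (u t) ->
  ((outer_energy rho u t)%:E <= L2norm_on om (u t) ^+ 2)%E.
Proof.
move=> rho_om uL2; have [s1 s2 _] := inL2_sqintegrable uL2.
have mi : measurable_fun setT (\1_(~` cube rho) : 'rV[R]_d -> R).
  by apply: measurable_indic; apply: measurableC; exact: measurable_cube.
have si (f : 'rV[R]_d -> R) : sqintegrable (leb d) f -> sqintegrable (leb d) (fun x => \1_(~` cube rho) x * f x).
  move=> sf; apply: (le_sqintegrable _ sf _).1; first by apply: measurable_funM => //; exact: sf.1.
  move=> x; rewrite normrM indicE; case: (_ \in _); first by rewrite normr1 mul1r.
  by rewrite normr0 mul0r.
have [q1 q2] := (si _ s1, si _ s2).
rewrite /outer_energy EFinD !n2_sqr// /L2norm_on Lnorm2E sqr_sqrte; last exact: sqint_ge0.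
rewrite /sqint -ge0_integralD//.
- apply: le_integral_nonmeasurable => x _; first by rewrite -EFinD lee_fin addr_ge0// sqr_ge0.
  rewrite -EFinD lee_fin !exprMn -mulrDr indicE.
  have [hx|hx] := pselect (cube rho x); first by rewrite memNset ?expr0n ?mul0r ?sqr_ge0//=; apply.
  by rewrite mem_set// expr1n mul1r patchE mem_set ?normc_sqr//; exact: rho_om.
- by move=> x _; rewrite lee_fin sqr_ge0.
- by apply/measurable_EFinP; apply: measurable_funX; exact: q1.1.
- by move=> x _; rewrite lee_fin sqr_ge0.
- by apply/measurable_EFinP; apply: measurable_funX; exact: q2.1.
Qed.

(** Extended by zero beyond tau, the outer energy lies at each time of ]0, T[ below the squared norm
    of u(t) on omega. *)
Lemma integral_outer_energy_le (rho T tau y : R) (om : set 'rV[R]_d) (u : R -> 'rV[R]_d -> R[i]) :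
  ~` cube rho `<=` om -> (forall t, 0 <= t <= T -> inL2 (u t)) -> 0 < tau -> tau <= T ->
  lebesgue_measure.-integrable `[0, tau] (EFin \o outer_energy rho u) ->
  L2norm_time_space T om u = y%:E ->
  \int[lebesgue_measure]_(t in `[0, tau]) outer_energy rho u t <= y ^+ 2.
Proof.
move=> rho_om uL2 tau0 tauT iE yE.
have E0 t : 0 <= outer_energy rho u t by rewrite addr_ge0// sqr_ge0.
rewrite -lee_fin EFin_expe -yE /L2norm_time_space sqr_sqrte; last first.
  by apply: integral_ge0 => t _; exact: sqre_ge0.
rewrite /Rintegral fineK; last exact: (integrable_fin_num _ iE).
have mE : measurable_fun `]0, tau[ (EFin \o outer_energy rho u).
  apply: (measurable_funS _ _ (measurable_int _ iE)) => //.
  by move=> t /=; rewrite !in_itv /= => /andP[a b]; rewrite !ltW.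
rewrite integral_itv_bndoo//.
have -> : `]0, tau[%classic = `]0, T[%classic `&` `]0, tau[%classic :> set R.
  apply/seteqP; split => [t|t [_]//]; rewrite /= !in_itv /= => /andP[a b].
  by rewrite a b (lt_le_trans b tauT).
rewrite integral_mkcondr; apply: le_integral_nonmeasurable => t.
  by move=> _; rewrite patchE; case: ifP => // _; rewrite lee_fin.
rewrite /= in_itv /= => /andP[t0 tT]; rewrite patchE; case: ifP => _; last exact: sqre_ge0.
by apply: outer_energy_le => //; apply: uL2; rewrite !ltW.
Qed.

(** Only a center with all coordinates below r in absolute value is moved, to the constant vector r;
    its displacement is then at most 2 r, whatever the family of centers. *)
Lemma far_centers (I : finType) (q : I -> 'rV[R]_d) (r : R) : (0 < d)%N -> 0 <= r ->
  exists z : I -> 'rV[R]_d, (forall n, exists i, r <= `|z n ord0 i|) /\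
    (forall n i, `|q n ord0 i - z n ord0 i| <= 2 * r).
Proof.
move=> d0 r0; exists (fun n => if [exists i, r <= `|q n ord0 i|] then q n else const_mx r).
split=> n.
  case: ifPn => [/existsP//|_]; exists (Ordinal d0).
  by rewrite mxE ger0_norm.
move=> i; case: ifPn => [_|/existsPn h]; first by rewrite subrr normr0 mulr_ge0.
rewrite mxE; apply: (le_trans (ler_normB _ _)); rewrite (ger0_norm r0) mulr2n mulrDl mul1r lerD//.
by have := h i; rewrite -ltNge => /ltW.
Qed.

Lemma bounded_cube (Om : set 'rV[R]_d) : bounded_set Om ->
  exists2 rho : R, 0 <= rho & closure Om `<=` cube rho.
Proof.
move=> /pinfty_ex_gt0 [M M0 hM]; exists M; first exact: ltW.
have h : Om `<=` cube M.
  move=> x Ox i; apply: (le_trans _ (hM x Ox)).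
  by rewrite /Num.norm/= mx_normrE; apply: (le_bigmax_cond _ (fun ij => `|x ij.1 ij.2|) (j := (ord0, i))).
by rewrite (closure_id (cube M)).1; [exact: closure_subset|exact: closed_cube].
Qed.

End observation.

(** * The constants as functions of T and the coefficient norms *)

Section constants.
Context {R : realType}.
Variables (d : nat) (C C1 cc T K2 K1 : R).

(** tau: the denominator makes it at most T and satisfies the two conditions of [riccati_bounds], 16
    lying above both 4 and 12. The absolute values keep the constants nonnegative for arbitrary real
    arguments, among them T = 0, where division by zero gives 0. *)
Definition obs_time : R := `|T| / (1 + `|T| * (16 * `|K1| + `|K2|)).

(** [evolution_const] for tau = [obs_time] and the bound |K1|, without the norm of S. *)
Definition obs_growth : R := 2 ^+ d * (C / obs_time + `|K1| * (C * (2 * d%:R + 3))).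

(** C1 passes from S to the sum of Gaussians, the middle factor is that of [n2_packet_bound], and 1
    + 1/T replaces Y + eta by Y + T eta. *)
Definition obs_const : R :=
  C1 * (@young_const R d ^+ 2 / cc * (obs_growth * (obs_time / 2 + 1) + C)) * (1 + `|T|^-1).

Let den0 : 0 < 1 + `|T| * (16 * `|K1| + `|K2|).
Proof. by rewrite ltr_pwDl// mulr_ge0// addr_ge0// mulr_ge0. Qed.

Lemma obs_time_ge0 : 0 <= obs_time.
Proof. by rewrite divr_ge0// ltW. Qed.

Lemma obs_timeP : 0 < T -> [/\ 0 < obs_time, obs_time <= T,
  (4 * `|K1| + `|K2|) * obs_time < 1 & 12 * `|K1| * obs_time < 1].
Proof.
move=> T0; have Te : `|T| = T by rewrite gtr0_norm.
have k1 : 0 <= T * `|K1| by rewrite mulr_ge0// ltW.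
have k2 : 0 <= T * `|K2| by rewrite mulr_ge0// ltW.
have d0 := den0; rewrite /obs_time; rewrite !Te in d0 *; split.
- exact: divr_gt0.
- by rewrite ler_pdivrMr// ler_peMr ?(ltW T0)// lerDl mulr_ge0 ?(ltW T0)// addr_ge0// mulr_ge0.
- by rewrite mulrA ltr_pdivrMr// mul1r; lra.
- by rewrite mulrA ltr_pdivrMr// mul1r; lra.
Qed.

Lemma obs_growth_ge0 : 0 <= C -> 0 <= obs_growth.
Proof.
move=> C0; rewrite mulr_ge0// addr_ge0//; first by rewrite divr_ge0// obs_time_ge0.
by rewrite !mulr_ge0// addr_ge0// mulr_ge0.
Qed.

Lemma obs_const_gt0 : 0 < C -> 0 < C1 -> 0 < cc -> 0 < obs_const.
Proof.
move=> C0 C10 cc0; rewrite /obs_const; apply: mulr_gt0; last by rewrite ltr_pwDl// invr_ge0.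
apply: mulr_gt0 => //; apply: mulr_gt0.
  by rewrite divr_gt0// exprn_gt0// young_const_gt0.
apply: ltr_wpDl => //; apply: mulr_ge0; first exact: obs_growth_ge0 (ltW C0).
apply: addr_ge0 => //; apply: divr_ge0 => //.
exact: obs_time_ge0.
Qed.

End constants.

(** * The observability estimate *)

Unset Implicit Arguments.

Theorem theorem4 (R : realType) (d : nat) (hd : (0 < d)%N)
    (Om : set 'rV[R]_d) (hOm : bounded_domain Om)
    (hcenter : centered_at_origin Om) :
  exists C : R -> R -> R -> R,
    (forall T k2_norm k1_norm, C T k2_norm k1_norm != 0) /\
    forall (k1 k2 : R -> R) (TD : \bar R),
      admissible_coefficients k1 k2 ->
      nonzero_flow d k1 k2 (time_interval TD) ->
    forall T : R, 0 < T -> (T%:E < TD)%E ->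
    forall y1 y2 y3 : R -> R, riccati_system T k1 k2 y1 y2 y3 ->
    forall (N : nat) (eta : R) (a : midx d N -> 'rV[R]_d) (c : midx d N -> R)
      (u0 : 'rV[R]_d -> R[i]) (u : R -> 'rV[R]_d -> R[i]),
      in_class_A eta a c u0 ->
      B_solution T k1 k2 u0 u ->
      (forall t, 0 <= t <= T ->
         Num.sqrt ((max_spread a ^+ 2 + 2 - 2 * ln (Num.sqrt (D0 y2 y3 t)))
                   / (4 * D0 y2 y3 t))
         + max_spread a / y2 t + ediam Om / 2 < max_center a) ->
      (L2norm u0 - eta%:E <=
         (C T (Linfty_norm T k2) (C1_norm T k1))%:E *
         (L2norm_time_space T (~` closure Om) u + (T * eta)%:E))%E.
Proof.
have [_ _ _ /bounded_cube[rho rho0 Omrho]] := hOm.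
have [C C0 WS] := @packet_bounds R d.
(* The packet has to vanish on the cube of size 3/2 rho, and [superpose_vanish] asks for the margin
   2. *)
pose r := 3 / 2 * rho + 2.
have r0 : 0 <= r by rewrite addr_ge0// mulr_ge0.
(* The constants C1 and c1 compare the kernels at the original and the moved centers, for
   displacements up to 2 r; c2 compares [psi] with [box]. They depend only on d and rho, hence on
   Omega. *)
pose C1 : R := (2 * (1 + (2 * r) ^+ 2)) ^+ d.
pose c1 : R := expR (- (d%:R * (2 * r + 1) ^+ 2)).
pose c2 : R := expR (- (3 / 4)^-1) ^+ d.
have C10 : 0 < C1 by apply: exprn_gt0; apply: mulr_gt0 => //; apply: ltr_pwDl => //; exact: sqr_ge0.
have c10 : 0 < c1 by exact: expR_gt0.
have c20 : 0 < c2 by apply: exprn_gt0; exact: expR_gt0.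
exists (obs_const d C C1 (c1 * c2)); split.
  by move=> T K2 K1; rewrite gt_eqF// obs_const_gt0// mulr_gt0.
move=> k1 k2 TD adm _ T T0 _ y1 y2 y3 ric N eta a c0 u0 u [Bu0 _ /andP[eta0 _] c0_ge0 approx].
move=> [uB _ [u' [u'L2 du _ eqn]] u0E] _.
set K1 := C1_norm T k1; set K2 := Linfty_norm T k2.
have [k1C1 [m m0 mk1] ck2 k2_ge0] := adm.
have k1K t : 0 <= t <= T -> 0 <= k1 t <= `|K1|.
  move=> /[dup] tT /andP[t0 _]; have k10 : 0 <= k1 t by apply: (le_trans (ltW m0)); exact: mk1.
  rewrite k10 /=; apply: (le_trans (ler_norm _)); apply: (le_trans _ (ler_norm _)).
  apply: le_C1_norm => //; apply: within_cc_cy; apply/subspace_continuousP => s hs.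
  exact: is_deriv_in_continuous (k1C1.1 s hs).
have k2K t : 0 <= t <= T -> 0 <= k2 t <= `|K2|.
  move=> /[dup] tT /andP[t0 _]; rewrite k2_ge0//=; apply: (le_trans _ (ler_norm _)).
  by apply: le_Linfty_norm => //; exact: within_cc_cy.
have [tau0 tauT s1 s2] := @obs_timeP R T K2 K1 T0.
set tau := obs_time T K2 K1 in tau0 tauT s1 s2.
have [Y1 [Y2 [cY1 cY2 [Y10 Y20] Yb dY]]] := riccati_bounds adm ric tau0 tauT k1K k2K s1 s2.
(* Extended by zero to multi-indices with |n| > N, so that the sums run over a whole finite type. *)
pose c n := if (mdeg n <= N)%N then c0 n else 0.
have c_ge0 n : 0 <= c n by rewrite /c; case: ifP => // h; exact: c0_ge0.
have [z [far near]] := far_centers (fun n => - a n) hd r0.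
have gE := gaussian_sumE a c0; rewrite -/c in gE.
set g := gaussian_sum a c0 in gE approx.
have sg : sqintegrable (leb d) g by rewrite gE; exact: sqintegrable_superpose sqintegrable_gauss.
have u0L2 : inL2 u0 by have [] := Bu0.
have [fg norm_g] := L2norm_le_approx u0L2 sg approx.
apply: (le_trans norm_g).
have B0 := obs_const_gt0 d T K2 K1 C0 C10 (mulr_gt0 c10 c20).
have Teta : 0 <= T * eta by rewrite mulr_ge0// ltW.
(* If the observation is infinite, so is the right-hand side, its constant being positive. *)
have [YE|[Y YE]] : L2norm_time_space T (~` closure Om) u = +oo%E \/
    exists Y : R, L2norm_time_space T (~` closure Om) u = Y%:E.
  have : (0 <= L2norm_time_space T (~` closure Om) u)%E by exact: sqrte_ge0.
  by case: (L2norm_time_space _ _ _) => [Y _|_|//]; [right; exists Y|left].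
  by rewrite YE addye// gt0_muley ?lte_fin// leey.
have Y0 : 0 <= Y by rewrite -lee_fin -YE; exact: sqrte_ge0.
have evo := evolution_bound hd tau0 tauT uB u'L2 du eqn k1K k2K cY1 cY2 Y10 Y20 Yb dY c_ge0 C0
  (WS _ c z c_ge0) far.
have MY : \int[lebesgue_measure]_(t in `[0, tau]) outer_energy rho u t <= Y ^+ 2.
  apply: (integral_outer_energy_le _ _ tau0 tauT (evo 1 ltr01).1 YE).
    by apply: subsetC.
  by move=> t tT; have [] := uB t tT.
have [sf _ _] := inL2_sqintegrable u0L2.
have bound := @n2_packet_bound R d _ c z (fun x => complex.Re (u0 x)) g C c1 c2 (obs_growth d C T K2 K1)
  eta tau _ Y c_ge0 sf sg C0 c10 c20 (obs_growth_ge0 _ _ _ _ (ltW C0)) eta0 (ltW tau0) Y0 MY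
  (fun x => (WS _ c z c_ge0 x).1) _ _ fg _.
have {}bound : n2 (leb d) (superpose c z kap) <=
    @young_const R d ^+ 2 / (c1 * c2) * (obs_growth d C T K2 K1 * (tau / 2 + 1) + C) * (Y + eta).
  apply: bound.
  - move=> x; rewrite gE /superpose mulr_sumr; apply: ler_sum => n _.
    by rewrite mulrCA ler_wpM2l// /c1; apply: box_le_gauss_shift.
  - move=> x; rewrite /superpose mulr_sumr; apply: ler_sum => n _.
    by rewrite mulrCA ler_wpM2l//; exact: psi_ge_box.
  - move=> lam lam0; apply: (le_trans _ (evo lam lam0).2).
    (* The initial condition holds almost everywhere, so pairing with u0 or with u at time 0 gives
       the same integral. *)
    rewrite le_eqVlt; apply/orP; left; apply/eqP; congr fine.
    have mW : measurable_fun setT (superpose c z (@psi R d)).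
      by apply: measurable_superpose; apply: measurable_tens => i; apply: (smooth1_continuous 0); exact: smooth1_bump.
    have T00 : 0 <= (0 : R) <= T by rewrite lexx ltW.
    have [sf0 _ _] := inL2_sqintegrable (uB 0 T00).1.
    apply: ae_eq_integral => //.
    + by apply/measurable_EFinP; apply: measurable_funM => //; exact: sf.1.
    + by apply/measurable_EFinP; apply: measurable_funM => //; exact: sf0.1.
    + by apply: filterS u0E => x e _; rewrite /= e.
rewrite YE -EFinD -EFinM lee_fin.
have g_le : n2 (leb d) g <= C1 * n2 (leb d) (superpose c z kap).
  have sS := sqintegrable_superpose c z (@sqintegrable_kap R d).
  have [sCS nCS] := n2_ger0_norm C1 sS.
  rewrite -[X in X * _](gtr0_norm C10) -nCS; apply: (le_sqintegrable sg.1 sCS _).2 => x.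
  have S0 : 0 <= superpose c z kap x by apply: superpose_ge0 => // y; exact: kap_ge0.
  rewrite [leRHS]ger0_norm ?mulr_ge0 ?(ltW C10)// ger0_norm; last first.
    by rewrite gE; apply: superpose_ge0 => // y; exact: expR_ge0.
  rewrite gE; apply: superpose_le => // n; exact: gauss_shift_le_kap.
apply: (le_trans g_le); rewrite /obs_const -!(mulrA C1) ler_wpM2l ?(ltW C10)//.
apply: (le_trans bound); rewrite -[leRHS]mulrA ler_wpM2l//.
  rewrite mulr_ge0// ?divr_ge0 ?sqr_ge0 ?mulr_ge0 ?(ltW c10) ?(ltW c20)//.
  by rewrite addr_ge0 ?(ltW C0)// mulr_ge0 ?obs_growth_ge0 ?(ltW C0)// addr_ge0// divr_ge0// ltW.
(* The factor 1 + 1/T turns T eta into eta plus a nonnegative remainder. *)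
have -> : (1 + `|T|^-1) * (Y + T * eta) = Y + eta + (Y / T + T * eta).
  by rewrite gtr0_norm//; field; rewrite gt_eqF.
by rewrite lerDl addr_ge0// divr_ge0// ltW.
Qed.
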